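(* Let $X$ be a projective curve over an algebraically closed field $k$ with exactly two irreducible components $Y$ and $Z$, both smooth, meeting transversally at a single point $P$. Let $d,r$ be integers and $\delta,\delta'$ positive integers with $\delta\mid\delta'$. Then $$\rho_{\delta',\delta}^{-1}\big(G^{r,*}_{d,\delta}(X)\big)\subseteq G^{r,*}_{d,\delta'}(X),$$ and the restriction $$\rho_{\delta',\delta}\colon\rho_{\delta',\delta}^{-1}\big(G^{r,*}_{d,\delta}(X)\big)\longrightarrow G^{r,*}_{d,\delta}(X)$$ is an isomorphism. Furthermore, if $\delta'>\delta$, then $$\rho_{\delta',\delta}\big(G^{r,*}_{d,\delta'}(X)\big)=G^r_{d,\delta}(X).$$
   Context: **Twist $\delta$-sequence.** Let $I$ be an invertible sheaf on $X$ and $\delta\ge1$. For $m\in\mathbb Z$ put $L_m:=I|_Y\otimes\mathcal O_Y(\lfloor -m/\delta\rfloor P)$ and $M_m:=I|_Z\otimes\mathcal O_Z(\lfloor m/\delta\rfloor P)$. If $\delta\mid m$, let $I^{(m)}$ be the (unique up to isomorphism) invertible sheaf on $X$ with restrictions $L_m$ to $Y$ and $M_m$ to $Z$; otherwise let $I^{(m)}:=L_m\oplus M_m$. Let $\rho_{m,Y}\colon I^{(m)}\to L_m$ and $\rho_{m,Z}\colon I^{(m)}\to M_m$ be the natural surjections (restrictions if $\delta\mid m$, projections otherwise). The kernel of $\rho_{m,Z}$ is naturally $L_{m+1}$ (it is $L_m(-P)$ if $\delta\mid m$, and $L_m$ otherwise), giving an inclusion $\iota_{m,Y}\colon L_{m+1}\to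 I^{(m)}$; the kernel of $\rho_{m,Y}$ is naturally $M_{m-1}$, giving $\iota_{m,Z}\colon M_{m-1}\to I^{(m)}$. Put $\varphi^i:=\iota_{i+1,Z}\rho_{i,Z}\colon I^{(i)}\to I^{(i+1)}$ and $\varphi_i:=\iota_{i,Y}\rho_{i+1,Y}\colon I^{(i+1)}\to I^{(i)}$. The collection $(I^{(i)},\varphi^i,\varphi_i\mid i\in\mathbb Z)$ is the twist $\delta$-sequence associated to $I$. **Level-$\delta$ limit linear series.** A level-$\delta$ limit linear series of degree $d$ and rank $r$ on $X$ is $\mathfrak g=(I;V^{(i)},i\in\mathbb Z)$, where $I$ is an invertible sheaf of (total) degree $d$ on $X$ and $V^{(i)}\subseteq\Gamma(X,I^{(i)})$ are subspaces of dimension $r+1$ with $\varphi^i(V^{(i)})\subseteq V^{(i+1)}$ and $\varphi_i(V^{(i+1)})\subseteq V^{(i)}$ for all $i$. It is exact if moreover $\varphi^i(V^{(i)})=\ker(\varphi_i|_{V^{(i+1)}})$ and $\varphi_i(V^{(i+1)})=\ker(\varphi^i|_{V^{(i)}})$ for all $i$. Limit linear series are identified up to shifting indices; equivalently, one normalizes so that $I$ has degree $d$ on $Y$ and $0$ on $Z$, which is assumed below. (Then all $V^{(i)}$ are determined by those with $0\le i\le d\delta$.) **Moduli space.** $G^r_{d,\delta}(X)$ is the projective $k$-scheme parameterizing level-$\delta$ limit linear series of degree $d$ and rank $r$ on $X$. It represents the functor sending a $k$-scheme $T$ to the set of data (up to the natural isomorphism, including twisting by line bundles from $T$) of an invertible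 sheaf $\mathcal I$ on $X\times T$ of relative degree $d$ on $Y\times T$ and $0$ on $Z\times T$, and, for each $i\in\mathbb Z$ (equivalently $0\le i\le d\delta$), a locally free rank-$(r+1)$ subsheaf $\mathcal V^{(i)}\subseteq p_{2*}(\mathcal I\otimes p_1^*\mathcal O_X^{(i)})$ which remains injective into the pushforward after every base change $T'\to T$, such that the maps induced by $\varphi^i,\varphi_i$ (those of the twist $\delta$-sequence of $\mathcal O_X$) send $\mathcal V^{(i)}$ into $\mathcal V^{(i+1)}$ and $\mathcal V^{(i+1)}$ into $\mathcal V^{(i)}$. The subset $G^{r,*}_{d,\delta}(X)\subseteq G^r_{d,\delta}(X)$ of exact limit linear series is open, and is regarded as an open subscheme. **Forgetful maps.** If $\delta'=c\delta$ and $(I^{(i)})$ is the twist $\delta'$-sequence of $I$, then $(I^{(ci)})_{i\in\mathbb Z}$ with the composed maps $\varphi^{c(i+1)-1}\cdots\varphi^{ci}$ and $\varphi_{ci}\cdots\varphi_{c(i+1)-1}$ is the twist $\delta$-sequence of $I$. The morphism $\rho_{\delta',\delta}\colon G^r_{d,\delta'}(X)\to G^r_{d,\delta}(X)$ sends $(I;V^{(i)},i\in\mathbb Z)$ to $(I;V^{(ci)},i\in\mathbb Z)$. *)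

(* Defs.v *)
(* - Schemes over k are handled through their functors of points on (nonzero,
     commutative) k-algebras: a morphism of k-schemes is an isomorphism iff it
     is one on these functors, and a moduli space is the functor it represents.
   - A closed subscheme V(J) of P^n_k is tested on its points which are given
     by homogeneous coordinates, i.e. on the morphisms Spec A -> V(J) whose
     tautological line is trivial.  Every morphism Spec A -> V(J) is of this
     form locally on Spec A, so these points determine all sheaves, sections
     and morphisms of sheaves on V(J), and on its base changes V(J)_R. *)
From HB Require Import structures.
From mathcomp Require Import all_boot all_order all_algebra.
From mathcomp Require Import mpoly.

Set Implicit Arguments.
Unset Strict Implicit.
Unset Printing Implicit Defensive.

Import GRing.Theory.
Local Open Scope ring_scope.

(* [b : M x N -> Q] exhibits Q as the tensor product of M and N over A,
   where N and Q are B-modules and A acts on them through [f : A -> B].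
   With N = B this says that Q is the extension of scalars of M. *)
Definition bilinear_along (A B : comNzRingType) (f : A -> B)
    (M : lmodType A) (N Q : lmodType B) (b : M -> N -> Q) : Prop :=
  (forall a m m' n, b (a *: m + m') n = f a *: b m n + b m' n) /\
  (forall a m n n', b m (a *: n + n') = a *: b m n + b m n').

Definition is_tensor (A B : comNzRingType) (f : A -> B)
    (M : lmodType A) (N Q : lmodType B) (b : M -> N -> Q) : Prop :=
  bilinear_along f b /\
  forall (Q' : lmodType B) (b' : M -> N -> Q'), bilinear_along f b' ->
    exists l : Q -> Q', [/\ linear l, forall m n, l (b m n) = b' m n &
      forall l' : Q -> Q', linear l' -> (forall m n, l' (b m n) = b' m n) ->
        l' =1 l].

Definition invertible_module (A : comNzRingType) (M : lmodType A) : Prop :=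
  exists (N : lmodType A) (b : M -> N -> A^o), is_tensor idfun b.

(* [g : A -> B] is the localization of A at the powers of f. *)
Definition is_localization (A B : comNzRingType) (f : A) (g : A -> B) : Prop :=
  [/\ exists u, u * g f = 1,
      forall b, exists a m, b * g f ^+ m = g a &
      forall a, g a = 0 -> exists m, f ^+ m * a = 0].

Definition generates_unit_ideal (A : comNzRingType) N (f : 'I_N -> A) : Prop :=
  exists w : 'I_N -> A, \sum_i w i * f i = 1.

(* Coordinates on a free module of rank one: a generator [gen] together with
   the coordinate function it determines. *)
Record frame (A : comNzRingType) (M : lmodType A) := Frame {
  gen :> M;
  coord : M -> A;
  coordK : forall m, coord m *: gen = m;
  genK : forall a, coord (a *: gen) = a }.

(* The integer power u ^ n of a unit u with inverse u'. *)
Definition upow (A : comNzRingType) (u u' : A) (n : int) : A :=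
  match n with Posz m => u ^+ m | Negz m => u' ^+ m.+1 end.

Record kalg (k : comNzRingType) := KAlg {
  kring :> comNzRingType;
  kstr : {rmorphism k -> kring} }.

Record khom (k : comNzRingType) (A B : kalg k) := KHom {
  kmap :> {rmorphism A -> B};
  kmapK : forall a, kmap (kstr A a) = kstr B a }.

Definition kself (k : comNzRingType) : kalg k := KAlg idfun.

Definition kinit (k : comNzRingType) (A : kalg k) : khom (kself k) A :=
  @KHom k (kself k) A (kstr A) (fun=> erefl).

Lemma kcomp_subproof (k : comNzRingType) (A B C : kalg k) (g : khom B C)
  (f : khom A B) a : (g \o f) (kstr A a) = kstr C a.
Proof. by rewrite /= !kmapK. Qed.

Definition kcomp (k : comNzRingType) (A B C : kalg k) (g : khom B C)
    (f : khom A B) : khom A C :=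
  @KHom k A C (g \o f : {rmorphism A -> C}) (kcomp_subproof g f).

Section Projective.

Variables (k : closedFieldType) (n : nat).

Local Notation poly := {mpoly k[n.+1]}.

Definition homogeneous_ideal (J : poly -> Prop) : Prop :=
  [/\ J 0, forall f g, J f -> J g -> J (f + g), forall f g, J g -> J (f * g) &
      forall f d, J f -> J (pihomog mdeg d f)].

(* The points of Proj k[x_0, ..., x_n]: homogeneous primes not containing
   the irrelevant ideal. *)
Definition proj_prime (J : poly -> Prop) : Prop :=
  [/\ homogeneous_ideal J, ~ J 1,
      forall f g, J (f * g) -> J f \/ J g & exists i, ~ J 'X_i].

(* For J in Proj: its closure has Krull dimension 1. *)
Definition dimension1 (J : poly -> Prop) : Prop :=
  (exists q, [/\ proj_prime q, forall f, J f -> q f & exists2 f, q f & ~ J f]) /\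
  (forall q q', proj_prime q -> proj_prime q' ->
     (forall f, J f -> q f) -> (exists2 f, q f & ~ J f) ->
     (forall f, q f -> q' f) -> forall f, q' f -> q f).

(* [v] is the vector of homogeneous coordinates of an A-point of V(J). *)
Definition on_proj (J : poly -> Prop) (A : kalg k) (v : 'rV[A]_n.+1) : Prop :=
  (exists w : 'rV[A]_n.+1, \sum_i w 0 i * v 0 i = 1) /\
  (forall f, J f -> (map_mpoly (kstr A) f).@[fun i => v 0 i] = 0).

(* Equality of points given by homogeneous coordinates. *)
Definition same_point (A : comNzRingType) (v w : 'rV[A]_n.+1) : Prop :=
  exists u u' : A, u * u' = 1 /\ w = u *: v.

(* Smoothness over k, by the infinitesimal lifting criterion (V(J) is of
   finite presentation over k). *)
Definition smooth (J : poly -> Prop) : Prop :=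
  forall (A B : kalg k) (g : khom A B),
    (forall b, exists a, g a = b) ->
    (forall a a', g a = 0 -> g a' = 0 -> a * a' = 0) ->
    forall v : 'rV[B]_n.+1, on_proj J v ->
    exists2 w : 'rV[A]_n.+1, on_proj J w & same_point (map_mx g w) v.

(* A morphism Spec A -> V(J) given by homogeneous coordinates. *)
Record kchart (J : poly -> Prop) := KChart {
  calg : kalg k;
  cvec : 'rV[calg]_n.+1;
  con : on_proj J cvec }.

(* A morphism Spec A -> V(J)_R. *)
Record chart (J : poly -> Prop) (R : kalg k) := Chart {
  ckc : kchart J;
  cstr : khom R (calg ckc) }.

Definition cring J R (p : chart J R) : kalg k := calg (ckc p).

(* A morphism Spec B -> Spec A over V(J)_R. *)
Record chom J R (p q : chart J R) := CHom {
  cmap :> khom (cring p) (cring q);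
  cmap_str : forall a, cmap (cstr p a) = cstr q a;
  cmap_vec : same_point (map_mx cmap (cvec (ckc p))) (cvec (ckc q)) }.

(* The chart [p] factors through the R-point of projective space with
   coordinates [v]. *)
Definition factors_through J (R : kalg k) (v : 'rV[R]_n.+1) (p : chart J R) :
    Prop :=
  same_point (map_mx (cstr p) v) (cvec (ckc p)).

(* A quasi-coherent sheaf on V(J)_R is the family of its pullbacks to the
   charts, with their base change isomorphisms ([sh_cart]); it is invertible
   if it is locally free of rank one ([sh_inv]). *)
Record invertible (J : poly -> Prop) (R : kalg k) := Invertible {
  sh :> forall p : chart J R, lmodType (cring p);
  res : forall p q, chom p q -> sh p -> sh q;
  res_id : forall p (h : chom p p), h =1 id -> res h =1 id;
  res_comp : forall p q r (h : chom p q) (h' : chom q r) (h'' : chom p r),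
    h'' =1 h' \o h -> res h'' =1 res h' \o res h;
  sh_cart : forall p q (h : chom p q),
    @is_tensor _ _ h (sh p) (cring q)^o (sh q) (fun s c => c *: res h s);
  sh_inv : forall p, exists N (f : 'I_N -> cring p), generates_unit_ideal f /\
    forall i q (h : chom p q), is_localization (f i) h -> inhabited (frame (sh q)) }.

Record sheaf_hom J R (L L' : invertible J R) := SheafHom {
  shmap :> forall p, L p -> L' p;
  shmap_lin : forall p, linear (@shmap p);
  shmap_nat : forall p q (h : chom p q) s,
    shmap (res h s) = res h (shmap s) }.

Lemma osheaf_cart J R (p q : chart J R) (h : chom p q) :
  @is_tensor _ _ h (cring p)^o (cring q)^o (cring q)^o
    (fun s c => c *: (h s : (cring q)^o)).
Proof.
split; first split=> [a m m' c|a m c c'].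
- by rewrite rmorphD rmorphM scalerDr /GRing.scale /= mulrCA.
- by rewrite scalerDl scalerA.
move=> Q b [b1 b2]; have bZ1 a m c : b (a *: m) c = h a *: b m c.
  have b0 x : b 0 x = 0.
    by have := b1 (-1) 0 0 x; rewrite scaler0 addr0 rmorphN rmorph1 scaleN1r addNr.
  by have := b1 a m 0 c; rewrite b0 !addr0.
have bZ2 a m c : b m (a *: c) = a *: b m c.
  have b0 x : b x 0 = 0.
    by have := b2 (-1) x 0 0; rewrite scaler0 addr0 scaleN1r addNr.
  by have := b2 a m c 0; rewrite b0 !addr0.
exists (b 1); split.
- by move=> a x y; rewrite b2.
- move=> m c; rewrite /GRing.scale /= mulrC -[h m * c]/(h m *: (c : _^o)) bZ2.
  by rewrite -bZ1 /GRing.scale /= mulr1.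
- move=> l llin lb x; have := lb 1 x.
  by rewrite rmorph1 /GRing.scale /= mulr1.
Qed.

Lemma osheaf_inv J R (p : chart J R) :
  exists N (f : 'I_N -> cring p), generates_unit_ideal f /\
    forall i (q : chart J R) (h : chom p q), is_localization (f i) h ->
      inhabited (frame (cring q)^o).
Proof.
exists 1%N, (fun=> 1); split; first by exists (fun=> 1); rewrite big_ord1 mulr1.
move=> _ q h _; constructor; apply: (@Frame _ (cring q)^o 1 id) => m;
  by rewrite /GRing.scale /= mulr1.
Qed.

Lemma osheaf_comp J R (p q r : chart J R) (h : chom p q) (h' : chom q r)
  (h'' : chom p r) : h'' =1 h' \o h -> h'' =1 h' \o h.
Proof. by []. Qed.

Definition osheaf J R : invertible J R :=
  @Invertible J R (fun p => (cring p)^o) (fun _ _ h => h)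
    (fun _ _ e => e) (@osheaf_comp J R) (@osheaf_cart J R) (@osheaf_inv J R).

Definition sheaf_iso J R (L L' : invertible J R) : Prop :=
  exists j : sheaf_hom L L', forall p, bijective (@shmap _ _ _ _ j p).

(* j : L -> L' has zero scheme the R-point v of V(J).  When V(J) is a smooth
   curve, this means that j identifies L with L'(-v), the inclusion of L'(-v)
   in L' being j. *)
Definition zero_scheme J R (L L' : invertible J R) (j : sheaf_hom L L')
    (v : 'rV[R]_n.+1) : Prop :=
  on_proj J v /\ forall p, (forall s : L p, j p s = 0) <-> factors_through v p.

(* The degree on a smooth curve over an algebraically closed field:
   deg O = 0 and deg L'(-v) = deg L' - 1. *)
Inductive has_degree J R : invertible J R -> int -> Prop :=
| HasDegree0 L : sheaf_iso L (osheaf J R) -> has_degree L 0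
| HasDegreeD L L' (j : sheaf_hom L L') v d :
    zero_scheme j v -> has_degree L d -> has_degree L' (d + 1)
| HasDegreeB L L' (j : sheaf_hom L L') v d :
    zero_scheme j v -> has_degree L' d -> has_degree L (d - 1).

(* [restr] is the pullback along the inclusion of V(J')_R in V(J)_R. *)
Section Restriction.
Variables (J J' : poly -> Prop) (sJ : forall f, J f -> J' f).

Lemma kincl_subproof (p : kchart J') : on_proj J (cvec p).
Proof. by case: (con p) => hw hv; split=> // f /sJ; apply: hv. Qed.

Definition kincl (p : kchart J') : kchart J := KChart (kincl_subproof p).

Definition incl R (p : chart J' R) : chart J R := @Chart J R (kincl (ckc p)) (cstr p).

Definition incl_hom R (p q : chart J' R) (h : chom p q) : chom (incl p) (incl q) :=
  @CHom J R (incl p) (incl q) h (cmap_str h) (cmap_vec h).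

Definition restr R (L : invertible J R) : invertible J' R :=
  @Invertible J' R (fun p => L (incl p)) (fun p q h => res (incl_hom h))
    (fun p h e => @res_id _ _ L (incl p) (incl_hom h) e)
    (fun p q r h h' h'' e =>
       @res_comp _ _ L _ _ _ (incl_hom h) (incl_hom h') (incl_hom h'') e)
    (fun p q h => sh_cart L (incl_hom h))
    (fun p => let: ex_intro N (ex_intro f (conj f1 fL)) := sh_inv L (incl p) in
       ex_intro _ N (ex_intro _ f (conj f1
         (fun i q h e => fL i (incl q) (incl_hom h) e)))).
End Restriction.

(* [base_change] is the pullback along V(J)_R' -> V(J)_R. *)
Section BaseChange.
Variables (J : poly -> Prop) (R R' : kalg k) (g : khom R R').

Definition cbase (p : chart J R') : chart J R := @Chart J R (ckc p) (kcomp (cstr p) g).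

Lemma cbase_subproof (p q : chart J R') (h : chom p q) a :
  h (cstr (cbase p) a) = cstr (cbase q) a.
Proof. exact: cmap_str. Qed.

Definition cbase_hom (p q : chart J R') (h : chom p q) : chom (cbase p) (cbase q) :=
  @CHom J R (cbase p) (cbase q) h (cbase_subproof h) (cmap_vec h).

Definition base_change (L : invertible J R) : invertible J R' :=
  @Invertible J R' (fun p => L (cbase p)) (fun p q h => res (cbase_hom h))
    (fun p h e => @res_id _ _ L (cbase p) (cbase_hom h) e)
    (fun p q r h h' h'' e =>
       @res_comp _ _ L _ _ _ (cbase_hom h) (cbase_hom h') (cbase_hom h'') e)
    (fun p q h => sh_cart L (cbase_hom h))
    (fun p => let: ex_intro N (ex_intro f (conj f1 fL)) := sh_inv L (cbase p) in
       ex_intro _ N (ex_intro _ f (conj f1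
         (fun i q h e => fL i (cbase q) (cbase_hom h) e)))).
End BaseChange.

(* Pullback of a sheaf on V(J) to V(J)_R; unlike [base_change (kinit R)], its
   value on a chart depends on the underlying k-chart only, and so commutes
   with further base changes up to conversion. *)
Section Constant.
Variables (J : poly -> Prop) (R : kalg k).

Definition cconst (p : chart J R) : chart J (kself k) :=
  @Chart J (kself k) (ckc p) (kinit _).

Lemma cconst_subproof (p q : chart J R) (h : chom p q) a :
  h (cstr (cconst p) a) = cstr (cconst q) a.
Proof. exact: kmapK. Qed.

Definition cconst_hom (p q : chart J R) (h : chom p q) : chom (cconst p) (cconst q) :=
  @CHom J (kself k) (cconst p) (cconst q) h (cconst_subproof h) (cmap_vec h).

Definition const_sheaf (L : invertible J (kself k)) : invertible J R :=
  @Invertible J R (fun p => L (cconst p)) (fun p q h => res (cconst_hom h))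
    (fun p h e => @res_id _ _ L (cconst p) (cconst_hom h) e)
    (fun p q r h h' h'' e =>
       @res_comp _ _ L _ _ _ (cconst_hom h) (cconst_hom h') (cconst_hom h'') e)
    (fun p q h => sh_cart L (cconst_hom h))
    (fun p => let: ex_intro N (ex_intro f (conj f1 fL)) := sh_inv L (cconst p) in
       ex_intro _ N (ex_intro _ f (conj f1
         (fun i q h e => fL i (cconst q) (cconst_hom h) e)))).
End Constant.

(* A section of I (x) T^m is given by its coordinate with respect to
   e (x) t^m, for all charts p and all frames e of I and t of T on p;
   [is_section] expresses compatibility with restriction and with changes of
   frames. *)
Definition presec J R (I T : invertible J R) : Type :=
  forall p : chart J R, frame (I p) -> frame (T p) -> cring p.

Definition is_section J R (I T : invertible J R) (m : int) (s : presec I T) : Prop :=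
  forall (p q : chart J R) (h : chom p q)
    (e : frame (I p)) (t : frame (T p)) (e' : frame (I q)) (t' : frame (T q)) u',
    coord t' (res h t) * u' = 1 ->
    s q e' t' = h (s p e t) * coord e' (res h e) * upow (coord t' (res h t)) u' m.

Definition eqsec J R (I T : invertible J R) (s s' : presec I T) : Prop :=
  forall p e t, s p e t = s' p e t.

Definition zerosec J R (I T : invertible J R) : presec I T := fun _ _ _ => 0.
#[global] Arguments zerosec {J R} I T.

Definition lincomb J R (I T : invertible J R) N (c : 'I_N -> R)
    (s : 'I_N -> presec I T) : presec I T :=
  fun p e t => \sum_j cstr p (c j) * s j p e t.

(* X is the closed subscheme of P^n_k with homogeneous ideal the intersection
   of the homogeneous primes of Y and Z.  Transversality at P: the
   scheme-theoretic intersection of Y and Z is the reduced point P; since Y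
   and Z are 1-dimensional, it also makes them incomparable. *)
Record two_component_curve := TwoComponentCurve {
  idY : poly -> Prop;
  idZ : poly -> Prop;
  ptP : 'rV[kself k]_n.+1;
  idY_prime : proj_prime idY;
  idZ_prime : proj_prime idZ;
  idY_dim : dimension1 idY;
  idZ_dim : dimension1 idZ;
  idY_smooth : smooth idY;
  idZ_smooth : smooth idZ;
  ptP_Y : on_proj idY ptP;
  ptP_Z : on_proj idZ ptP;
  YZ_transversal : forall (A : kalg k) (v : 'rV[A]_n.+1),
    on_proj idY v -> on_proj idZ v -> same_point (map_mx (kstr A) ptP) v }.

Definition idX (X : two_component_curve) : poly -> Prop :=
  fun f => idY X f /\ idZ X f.

Definition idXY (X : two_component_curve) f (h : idX X f) : idY X f := h.1.
Definition idXZ (X : two_component_curve) f (h : idX X f) : idZ X f := h.2.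

(* The term of index delta of the twist delta-sequence of O_X: an invertible
   sheaf T on X with T|_Y = O_Y(-P) and T|_Z = O_Z(P), unique up to
   isomorphism.  Accordingly O_Y(aP) = T^(-a)|_Y, O_Z(aP) = T^a|_Z, and the
   term of index a * delta of that sequence is T^a. *)
Record twister (X : two_component_curve) := Twister {
  twT :> invertible (idX X) (kself k);
  twY : sheaf_hom (restr (@idXY X) twT) (osheaf (idY X) (kself k));
  twZ : sheaf_hom (osheaf (idZ X) (kself k)) (restr (@idXZ X) twT);
  twY_zero : zero_scheme twY (ptP X);
  twZ_zero : zero_scheme twZ (ptP X) }.

Section Twist.

Variables (X : two_component_curve) (T : twister X).

Local Notation onY L := (restr (@idXY X) L).
Local Notation onZ L := (restr (@idXZ X) L).
Local Notation TT R := (const_sheaf R T).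

(* A section of I^(m) over X_R.  If delta | m it is a section over X, recorded
   with its restrictions to Y and Z; otherwise I^(m) = L_m (+) M_m and it is
   given by sections over Y and over Z, the component over X being 0. *)
Record tsec R (I : invertible (idX X) R) := TSec {
  tX : presec I (TT R);
  tY : presec (onY I) (onY (TT R));
  tZ : presec (onZ I) (onZ (TT R)) }.
#[global] Arguments tX {R I} _.
#[global] Arguments tY {R I} _.
#[global] Arguments tZ {R I} _.

Section Ops.
Variables (R : kalg k) (I : invertible (idX X) R).

Definition eqt (s s' : tsec I) : Prop :=
  [/\ eqsec (tX s) (tX s'), eqsec (tY s) (tY s') & eqsec (tZ s) (tZ s')].

Definition zerot : tsec I :=
  TSec (zerosec I _) (zerosec (onY I) _) (zerosec (onZ I) _).

Definition lincombt N (c : 'I_N -> R) (s : 'I_N -> tsec I) : tsec I :=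
  TSec (lincomb c (fun j => tX (s j))) (lincomb c (fun j => tY (s j)))
       (lincomb c (fun j => tZ (s j))).

(* L_m = I|_Y (x) O_Y(floor(-m/delta) P) and M_m = I|_Z (x) O_Z(floor(m/delta) P). *)
Definition is_tsec (delta : nat) (m : int) (s : tsec I) : Prop :=
  [/\ is_section (- (- m %/ delta)%Z) (tY s),
      is_section (m %/ delta)%Z (tZ s) &
      if (delta %| m)%Z then
        [/\ is_section (m %/ delta)%Z (tX s),
            forall p e t, tY s p e t = tX s (incl (@idXY X) p) e t &
            forall p e t, tZ s p e t = tX s (incl (@idXZ X) p) e t]
      else eqsec (tX s) (zerosec I _)].

(* t = phi^i(s), for sections s of I^(i) and t of I^(i+1): t is zero on Y, and
   on Z it is the image of s|_Z under the inclusion of M_i in M_(i+1), which is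
   multiplication by 1 in O_Z(P) if delta | i + 1 and the identity otherwise.
   A section of I^(i+1) is determined by its restrictions to Y and Z. *)
Definition phi_up (delta : nat) (i : int) (s t : tsec I) : Prop :=
  eqsec (tY t) (zerosec (onY I) _) /\
  forall p e (tau : frame (onZ (TT R) p)),
    tZ t p e tau =
      (if (delta %| i + 1)%Z then coord tau (twZ T (cconst p) 1) else 1) * tZ s p e tau.

(* t = phi_i(s), for sections s of I^(i+1) and t of I^(i). *)
Definition phi_down (delta : nat) (i : int) (s t : tsec I) : Prop :=
  (forall p e (tau : frame (onY (TT R) p)),
    tY t p e tau =
      (if (delta %| i)%Z then twY T (cconst p) tau else 1) * tY s p e tau) /\
  eqsec (tZ t) (zerosec (onZ I) _).

End Ops.

Definition presec_base J R R' (g : khom R R') (I T' : invertible J R)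
    (s : presec I T') : presec (base_change g I) (base_change g T') :=
  fun p e t => s (cbase g p) e t.
#[global] Arguments presec_base {J R R'} g {I T'} s.

Definition tsec_base R R' (g : khom R R') (I : invertible (idX X) R) (s : tsec I) :
    tsec (base_change g I) :=
  @TSec R' (base_change g I) (presec_base g (tX s)) (presec_base g (tY s))
    (presec_base g (tZ s)).
#[global] Arguments tsec_base {R R'} g {I} s.

Definition submodule R (I : invertible (idX X) R) (V : tsec I -> Prop) : Prop :=
  forall N (c : 'I_N -> R) s t,
    (forall j, V (s j)) -> eqt t (lincombt c s) -> V t.

(* The R'-span of the restrictions to X_R' of the elements of V. *)
Definition span_base R R' (g : khom R R') (I : invertible (idX X) R)
    (V : tsec I -> Prop) : tsec (base_change g I) -> Prop :=
  fun t => exists N (c : 'I_N -> R') (s : 'I_N -> tsec I),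
    (forall j, V (s j)) /\ eqt t (lincombt c (fun j => tsec_base g (s j))).
#[global] Arguments span_base {R R'} g {I} V.

(* V is locally free of rank r + 1 on Spec R and remains injective into the
   space of sections after every base change: Spec R is covered by open
   subsets Spec R_f over which V has a basis of r + 1 sections that remain
   linearly independent over every R_f-algebra. *)
Definition locally_free_subsheaf (r : int) R (I : invertible (idX X) R)
    (V : tsec I -> Prop) : Prop :=
  exists2 m : nat, m%:Z = r + 1 &
  exists N (f : 'I_N -> R), generates_unit_ideal f /\
  forall l (Rf : kalg k) (g : khom R Rf), is_localization (f l) g ->
  exists s : 'I_m -> tsec (base_change g I),
    (forall t, span_base g V t <-> exists c : 'I_m -> Rf, eqt t (lincombt c s)) /\
    forall (R' : kalg k) (h : khom Rf R') (c : 'I_m -> R'),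
      eqt (lincombt c (fun j => tsec_base h (s j))) (zerot _) ->
      forall j, c j = 0.

(* The degree of L on the geometric fibres of V(J)_R over Spec R is d. *)
Definition relative_degree J R (L : invertible J R) (d : int) : Prop :=
  forall (K : closedFieldType) (i : {rmorphism k -> K}) (g : khom R (KAlg i)),
    has_degree (base_change g L) d.

Record lls_data (R : kalg k) := LLSData {
  llsI : invertible (idX X) R;
  llsV : int -> tsec llsI -> Prop }.
#[global] Arguments llsV {R} _ _ _.

Definition is_lls (d r : int) (delta : nat) R (x : lls_data R) : Prop :=
  [/\ relative_degree (onY (llsI x)) d,
      relative_degree (onZ (llsI x)) 0 &
      forall i,
      [/\ forall s, llsV x i s -> is_tsec delta i s,
          submodule (llsV x i),
          locally_free_subsheaf r (llsV x i),
          forall s, llsV x i s -> exists2 t, llsV x (i + 1) t & phi_up delta i s t &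
          forall s, llsV x (i + 1) s -> exists2 t, llsV x i t & phi_down delta i s t]].

Definition exact_lls (delta : nat) R (x : lls_data R) : Prop :=
  forall i,
    (forall t, llsV x (i + 1) t ->
       (exists2 s, llsV x i s & phi_up delta i s t) <-> phi_down delta i t (zerot _)) /\
    (forall t, llsV x i t ->
       (exists2 s, llsV x (i + 1) s & phi_down delta i s t) <-> phi_up delta i t (zerot _)).

Definition lls_base R R' (g : khom R R') (x : lls_data R) : lls_data R' :=
  @LLSData R' (base_change g (llsI x)) (fun i => span_base g (llsV x i)).

(* t is the section lambda (x) s, where [b] is an isomorphism of
   Lambda (x) I' with I, Lambda being an invertible R-module. *)
Definition twisted J (R : kalg k) (Lambda : lmodType R) (I I' T' : invertible J R)
    (b : forall p, Lambda -> I' p -> I p) (lambda : Lambda)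
    (s : presec I' T') (t : presec I T') : Prop :=
  forall p (e' : frame (I' p)) (e : frame (I p)) tau,
    t p e tau = coord e (b p lambda e') * s p e' tau.

Definition twistedt (R : kalg k) (Lambda : lmodType R) (I I' : invertible (idX X) R)
    (b : forall p, Lambda -> I' p -> I p) (lambda : Lambda)
    (s : tsec I') (t : tsec I) : Prop :=
  [/\ twisted b lambda (tX s) (tX t),
      @twisted (idY X) R Lambda (onY I) (onY I') _ (fun p => b (incl (@idXY X) p)) lambda (tY s) (tY t) &
      @twisted (idZ X) R Lambda (onZ I) (onZ I') _ (fun p => b (incl (@idXZ X) p)) lambda (tZ s) (tZ t)].

(* Isomorphism of families over Spec R, up to twisting by line bundles on
   Spec R. *)
Definition lls_iso (delta : nat) R (x x' : lls_data R) : Prop :=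
  exists (Lambda : lmodType R) (b : forall p, Lambda -> llsI x' p -> llsI x p),
  [/\ invertible_module Lambda,
      forall p, is_tensor (cstr p) (b p),
      forall p q (h : chom p q) lambda s, b q lambda (res h s) = res h (b p lambda s) &
      forall i t, llsV x i t <->
        exists N (lambda : 'I_N -> Lambda) (s' : 'I_N -> tsec (llsI x'))
          (s : 'I_N -> tsec (llsI x)),
          [/\ forall j, [/\ llsV x' i (s' j), is_tsec delta i (s j) &
                            twistedt b (lambda j) (s' j) (s j)] &
              eqt t (lincombt (fun=> 1) s)]].

End Twist.

End Projective.

(* A functor from k-algebras to sets, the set attached to R being the set of
   elements of [fob R] satisfying [fmem], modulo [feq]. *)
Record kfunctor (k : comNzRingType) := KFunctor {
  fob : kalg k -> Type;
  fmem : forall R, fob R -> Prop;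
  feq : forall R, fob R -> fob R -> Prop;
  fmor : forall R R', khom R R' -> fob R -> fob R' }.
Arguments fmem {k} _ {R} _.
Arguments feq {k} _ {R} _ _.
Arguments fmor {k} _ {R R'} _ _.

Definition fsub (k : comNzRingType) (F : kfunctor k)
    (P : forall R, fob F R -> Prop) : kfunctor k :=
  @KFunctor k (fob F) (fun R x => fmem F x /\ P R x) (@feq k F) (@fmor k F).

Definition fmorphism (k : comNzRingType) (F F' : kfunctor k)
  (u : forall R, fob F R -> fob F' R) : Prop :=
  [/\ forall R (x : fob F R), fmem F x -> fmem F' (u R x),
      forall R (x y : fob F R), fmem F x -> fmem F y -> feq F x y ->
        feq F' (u R x) (u R y) &
      forall R R' (g : khom R R') (x : fob F R), fmem F x ->
        feq F' (u R' (fmor F g x)) (fmor F' g (u R x))].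

Definition fiso (k : comNzRingType) (F F' : kfunctor k)
  (u : forall R, fob F R -> fob F' R) : Prop :=
  [/\ fmorphism u,
      forall R (x y : fob F R), fmem F x -> fmem F y ->
        feq F' (u R x) (u R y) -> feq F x y &
      forall R (y : fob F' R), fmem F' y ->
        exists2 x : fob F R, fmem F x & feq F' (u R x) y].

(* Surjectivity on the underlying sets of points: a point of F' is the class
   of its K-points, for K a field, modulo extensions of K. *)
Definition fsurj (k : comNzRingType) (F F' : kfunctor k)
  (u : forall R, fob F R -> fob F' R) : Prop :=
  forall (K : fieldType) (i : {rmorphism k -> K}) (y : fob F' (KAlg i)),
  fmem F' y ->
  exists (K' : fieldType) (i' : {rmorphism k -> K'})
         (g : khom (KAlg i) (KAlg i')) (x : fob F (KAlg i')),
    fmem F x /\ feq F' (u (KAlg i') x) (fmor F' g y).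

Arguments fmorphism {k} F F' u.
Arguments fiso {k} F F' u.
Arguments fsurj {k} F F' u.

Section Moduli.

Variables (k : closedFieldType) (n : nat) (X : two_component_curve k n) (T : twister X).
Variables (d r : int).

(* G^r_{d,delta}(X) *)
Definition Gmod (delta : nat) : kfunctor k :=
  @KFunctor k (lls_data T) (@is_lls k n X T d r delta) (@lls_iso k n X T delta)
    (@lls_base k n X T).

(* The R-points of G^r_{d,delta}(X) all of whose fibres are exact, i.e. those
   that factor through the open subset of exact limit linear series. *)
Definition exact_fibres (delta : nat) R (x : lls_data T R) : Prop :=
  forall (K : fieldType) (i : {rmorphism k -> K}) (g : khom R (KAlg i)),
    exact_lls delta (lls_base g x).

Definition Gstar (delta : nat) : kfunctor k := fsub (F := Gmod delta) (exact_fibres delta).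

(* rho_{c * delta, delta} *)
Definition rho (c : nat) R (x : lls_data T R) : lls_data T R :=
  @LLSData k n X T R (llsI x) (fun i => llsV x (i * c%:Z)).

Definition rho_inv_Gstar (delta delta' : nat) : kfunctor k :=
  fsub (F := Gmod delta') (fun R x => @exact_fibres delta R (rho (delta' %/ delta) x)).

End Moduli.

(* Main.v *)
(* Put D = c delta.  If V^(i) -> V^(i+1) -> V^(i) is exact on all fibres over
   Spec R, a contracting homotopy of this 2-periodic complex lifts from each
   residue field to a neighbourhood; hence the complex is locally split, and it
   is exact over R.  For 0 < j < c the term of index i c + j of a lift to level
   D then consists of the pairs (u|_Y, v|_Z) with u in V^(i+1) and v in V^(i):
   push a section up to the index (i+1) c and down to i c, use exactness, and
   cancel the equation of P.  So the lift is unique and exact; conversely these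
   pairs form a lift, with local basis (w_l|_Y, sum_m S_lm v_m|_Z), where v, w
   are local bases of V^(i), V^(i+1) and S is the homotopy.

   Over a field let A and B be the matrices of V^(i) -> V^(i+1) and back, for
   row vectors, with A G A = A and B H B = B.  Choose Q with A G Q = A and (Q, B)
   exact.  The terms between V^(i) and V^(i+1) are given by the pairs of matrices
   (1, A), (1 - A G, Q), (B, 1 - B H), ..., (B, 1 - B H), (B, 1), which describe
   the Y-parts of a basis in terms of v|_Y and its Z-parts in terms of w|_Z, up to
   the equations of P; consecutive terms are exact, and the inner pair
   (1 - A G, Q) only fits in because c > 1.

   Sections are handled on the charts (R[x]/J_R)[1/s] of the affine cone: the
   equation of P is a nonzerodivisor there, because J is prime and R[x] is flat
   over k[x]. *)
From HB Require Import structures.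
From mathcomp Require Import all_boot all_order all_algebra.
From mathcomp Require Import mpoly ring_quotient.
From mathcomp Require Import boolp classical_sets.
From mathcomp Require Import ring.
(* Required last, since mathcomp also defines coord. *)
Require Import Defs.

Set Implicit Arguments.
Unset Strict Implicit.
Unset Printing Implicit Defensive.

Import Order.TTheory GRing.Theory Num.Theory.
Local Open Scope ring_scope.

(** * Ideals and localization *)

(** The obstacle is that sections are known only through their coordinates on arbitrary charts,
    possibly nonreduced or supported at P, where the equation of P is a zero divisor or even zero.
    On such a chart it can be neither cancelled nor divided out. Both operations become possible for
    sections, because every chart is locally pulled back from finitely many cone charts. This list
    is uniform in the charts, so it also bounds the exponents when identities over R_f are brought
    back to R. A morphism of charts preserves homogeneous coordinates only up to a unit, so two cone
    charts over the same chart have to be rescaled before they can be compared.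

    A term of a series is a predicate on sections over R, and its base changes are spans of
    restrictions. Bases and matrices are therefore kept over R, up to powers of the function f being
    inverted.

    Over a field the failure of exactness of (A, B) is measured by ker A / im B and ker B / im A.
    These have the same dimension because both matrices are square of the same size; Q is chosen so
    that they cancel each other. *)

Section Ideals.
Variable A : comNzRingType.
Implicit Types (I : A -> Prop) (a b : A).

Definition is_ideal I : Prop :=
  [/\ I 0, forall a b, I a -> I b -> I (a + b) & forall a b, I b -> I (a * b)].

Definition max_ideal I : Prop :=
  [/\ is_ideal I, ~ I 1 & forall a, ~ I a -> exists b, I (b * a - 1)].

Lemma ideal_opp I a : is_ideal I -> I a -> I (- a).
Proof. by case=> _ _ IM Ia; rewrite -mulN1r; apply: IM. Qed.

Lemma ideal_sum I N (f : 'I_N -> A) :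
  is_ideal I -> (forall i, I (f i)) -> I (\sum_i f i).
Proof. by case=> I0 ID _ If; elim/big_ind: _. Qed.

Lemma max_ideal_mul I a b : max_ideal I -> I (a * b) -> I a \/ I b.
Proof.
case=> idI _ maxI Iab; case: (EM (I a)) => [|/maxI [c Ic]]; first by left.
right; have [_ ID IM] := idI.
rewrite (_ : b = c * (a * b) + (- b) * (c * a - 1)); last first.
  by rewrite mulrBr mulr1 mulNr opprK mulrA [b * _]mulrC addrA subrr add0r.
by apply: ID; apply: IM.
Qed.

Lemma max_ideal_exp I a n : max_ideal I -> I (a ^+ n) -> I a.
Proof.
move=> mI; elim: n => [|n IHn]; first by rewrite expr0; case: mI.
by rewrite exprS => /(max_ideal_mul mI) [].
Qed.

Lemma max_ideal_sum I N (f : 'I_N -> A) :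
  max_ideal I -> ~ I (\sum_i f i) -> exists i, ~ I (f i).
Proof.
move=> [idI _ _] nI; apply: contrapT => nf; apply: nI.
by apply: ideal_sum => // i; apply: contrapT => nIi; apply: nf; exists i.
Qed.

Lemma max_ideal_mulN I a b : max_ideal I -> ~ I a -> ~ I b -> ~ I (a * b).
Proof. by move=> mI na nb /(max_ideal_mul mI) []. Qed.

Lemma exists_max_ideal I : is_ideal I -> ~ I 1 ->
  exists2 M, max_ideal M & forall a, I a -> M a.
Proof.
move=> idI nI1.
pose P (J : set A) := (forall a, ~ J a) \/
  [/\ is_ideal J, ~ J 1 & forall a, I a -> J a].
case: (@Zorn_bigcup A P).
  move=> F FP totF.
  case: (EM (exists2 J, F J & exists a, J a)); last first.
    by move=> nF; left => a [J FJ Ja]; apply: nF; exists J => //; exists a.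
  case=> J FJ [a Ja]; right.
  have FI K : F K -> (exists x, K x) ->
      [/\ is_ideal K, ~ K 1 & forall a, I a -> K a].
    by move=> FK [x Kx]; case: (FP K FK) => // /(_ x).
  have [[J0 _ _] _ IJ] := FI J FJ (ex_intro _ a Ja).
  split; last by move=> x Ix; exists J => //; apply: IJ.
    split; first by exists J.
      move=> x y [K FK Kx] [L FL Ly].
      case: (totF K L FK FL) => [KL|LK].
        have [[_ LD _] _ _] := FI L FL (ex_intro _ y Ly).
        by exists L => //; apply: LD => //; apply: KL.
      have [[_ KD _] _ _] := FI K FK (ex_intro _ x Kx).
      by exists K => //; apply: KD => //; apply: LK.
    move=> x y [K FK Ky]; exists K => //.
    by have [[_ _ KM] _ _] := FI K FK (ex_intro _ y Ky); apply: KM.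
  by case=> K FK K1; have [_ ] := FI K FK (ex_intro _ 1 K1).
move=> M [PM maxM].
case: PM => [M0|[idM nM1 IM]].
  case: (maxM (I : set A)); last by right.
  by split=> [x /M0 //|/(_ 0)]; case: idI => I0 _ _ /(_ I0) /M0.
exists M => //; split=> // a nMa.
(* [L] is the ideal generated by [M] and [a]. If [a] were not invertible modulo [M], it would be
   proper and larger than [M]. *)
pose L : set A := fun x => exists b, M (x - b * a).
apply: contrapT => nb.
have [M0 MD MM] := idM.
apply: (maxM L).
  split; first by move=> x Mx; exists 0; rewrite mul0r subr0.
  by move=> /(_ a) La; apply: nMa; apply: La; exists 1; rewrite mul1r subrr.
right; split.
- split; first by exists 0; rewrite mul0r subr0.
    move=> x y [b Mb] [c Mc]; exists (b + c).
    by rewrite mulrDl opprD addrACA; apply: MD.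
  by move=> x y [b Mb]; exists (x * b); rewrite -mulrA -mulrBr; apply: MM.
- by case=> b Mb; apply: nb; exists b; rewrite -opprB; apply: ideal_opp.
- by move=> x /IM Mx; exists 0; rewrite mul0r subr0.
Qed.

Lemma ideal1P I : is_ideal I ->
  (forall M, max_ideal M -> exists2 a, I a & ~ M a) -> I 1.
Proof.
move=> idI H; apply: contrapT => /(exists_max_ideal idI) [M mM IM].
by have [a /IM] := H M mM.
Qed.

Lemma ideal_ann (x : A) : is_ideal (fun a => a * x = 0).
Proof.
split=> [|a b ax bx|a b bx]; first by rewrite mul0r.
  by rewrite mulrDl ax bx addr0.
by rewrite -mulrA bx mulr0.
Qed.

(** The annihilator of [x] lies in no maximal ideal, so it contains 1. This is how equalities on a
    chart are checked locally. *)
Lemma ann0 (x : A) :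
  (forall M, max_ideal M -> exists2 a, a * x = 0 & ~ M a) -> x = 0.
Proof. by move/(ideal1P (ideal_ann x)); rewrite mul1r. Qed.

Lemma unit_idealN N (f : 'I_N -> A) M :
  generates_unit_ideal f -> max_ideal M -> exists i, ~ M (f i).
Proof.
case=> w w1 mM; have [idM nM1 _] := mM.
rewrite -w1 in nM1; have [i Mi] := max_ideal_sum mM nM1.
by exists i => Mf; apply: Mi; case: idM => _ _; apply.
Qed.

(** Quasi-compactness of Spec A: the ideal generated by the elements satisfying [P] contains 1, and
    writing 1 takes only finitely many of them. *)
Lemma max_ideal_finite (P : A -> Prop) :
  (forall M, max_ideal M -> exists2 a, P a & ~ M a) ->
  exists N (f : 'I_N -> A), (forall i, P (f i)) /\ generates_unit_ideal f.
Proof.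
move=> H.
pose I a := exists N (f : 'I_N -> A) (w : 'I_N -> A),
  (forall i, P (f i)) /\ \sum_i w i * f i = a.
have idI : is_ideal I.
  split.
  - by exists 0%N, (fun=> 0), (fun=> 0); split=> [[]|]//; rewrite big_ord0.
  - move=> a b [N [f [w [Pf <-]]]] [N' [f' [w' [Pf' <-]]]].
    exists (N + N')%N, (fun i => match split i with inl j => f j | inr j => f' j end),
      (fun i => match split i with inl j => w j | inr j => w' j end).
    split; first by move=> i; case: (split i).
    rewrite big_split_ord /=; congr (_ + _); apply: eq_bigr => i _.
      by rewrite (unsplitK (inl i : 'I_N + 'I_N')).
    by rewrite (unsplitK (inr i : 'I_N + 'I_N')).
  - move=> a b [N [f [w [Pf <-]]]]; exists N, f, (fun i => a * w i); split=> //.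
    by rewrite mulr_sumr; apply: eq_bigr => i _; rewrite mulrA.
suff [N [f [w [Pf w1]]]] : I 1 by exists N, f; split=> //; exists w.
apply: ideal1P => // M /H [a Pa nMa]; exists a => //.
by exists 1%N, (fun=> a), (fun=> 1); split=> //; rewrite big_ord1 mul1r.
Qed.

(** A maximal ideal is prime, so if it contained all the powers it would contain all the [f i]. *)
Lemma unit_ideal_exp N (f : 'I_N -> A) m :
  generates_unit_ideal f -> generates_unit_ideal (fun i => f i ^+ m).
Proof.
move=> gf.
pose I a := exists w : 'I_N -> A, \sum_i w i * f i ^+ m = a.
suff [w w1] : I 1 by exists w.
apply: ideal1P; last first.
    move=> M mM; have [i nMi] := unit_idealN gf mM; exists (f i ^+ m).
      exists (fun j => (j == i)%:R); rewrite (bigD1 i) //= eqxx mul1r big1 ?addr0 //.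
      by move=> j /negPf ->; rewrite mul0r.
    by move=> /(max_ideal_exp mM).
  split; first by exists (fun=> 0); rewrite big1 // => i _; rewrite mul0r.
    move=> a b [w <-] [w' <-]; exists (fun i => w i + w' i).
    by rewrite -big_split; apply: eq_bigr => i _; rewrite mulrDl.
  move=> a b [w <-]; exists (fun i => a * w i).
  by rewrite mulr_sumr; apply: eq_bigr => i _; rewrite mulrA.
Qed.

End Ideals.

Lemma max_ideal_preim (A B : comNzRingType) (f : {rmorphism A -> B}) M N (g : 'I_N -> A) :
  generates_unit_ideal g -> max_ideal M -> exists i, ~ M (f (g i)).
Proof.
case=> w w1; apply: unit_idealN; exists (f \o w) => /=.
rewrite -[RHS](rmorph1 f) -w1 rmorph_sum; apply: eq_bigr => i _.
by rewrite rmorphM.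
Qed.

(* C is the localization of B / I at the powers of s. *)
Definition is_locq (B C : comNzRingType) (I : B -> Prop) (s : B) (pi : B -> C) :=
  [/\ exists u, u * pi s = 1, forall c, exists b m, c * pi s ^+ m = pi b &
      forall b, pi b = 0 <-> exists m, I (s ^+ m * b)].

(** * Localization of a quotient ring and its universal property *)

Section LocQuot.
Variables (B : comNzRingType) (I : B -> Prop) (s : B).
Hypotheses (idI : is_ideal I) (sI : forall m, ~ I (s ^+ m)).

(** This is s ^ m F(1/s), with the denominators cleared, when [F] has size at most m. *)
Let hom m (F : {poly B}) := \sum_(i < m) F`_i * s ^+ (m - i).

Lemma hom_widen m m' (F : {poly B}) : (size F <= m)%N -> (m <= m')%N ->
  hom m' F = s ^+ (m' - m) * hom m F.
Proof.
move=> sF mm'; rewrite /hom (big_ord_widen m' (fun i => F`_i * s ^+ (m - i))) //.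
rewrite mulr_sumr [RHS]big_mkcond /=; apply: eq_bigr => i _.
case: ltnP => im; last by rewrite nth_default ?mul0r // (leq_trans sF).
by rewrite mulrCA -exprD addnBA 1?ltnW // subnK.
Qed.

(** The localization is built as a quotient of B[X], with X in the role of 1/s; this is the kernel
    of B[X] -> (B/I)[1/s], described by clearing denominators. *)
Definition locq_kernel : pred {poly B} := fun F => `[< exists2 m, (size F <= m)%N & I (hom m F) >].

Local Notation K := locq_kernel.

Lemma locq_kernel_ideal : idealr_closed K.
Proof.
have [I0 ID IM] := idI.
have KD F G : K F -> K G -> K (F + G).
  move=> /asboolP [m sF hF] /asboolP [m' sG hG]; apply/asboolP.
  exists (maxn m m').
    rewrite (leq_trans (size_polyD _ _)) // geq_max !leq_max.
    by rewrite sF sG orbT.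
  have -> : hom (maxn m m') (F + G) = hom (maxn m m') F + hom (maxn m m') G.
    by rewrite /hom -big_split; apply: eq_bigr => i _; rewrite coefD mulrDl.
  rewrite (hom_widen sF (leq_maxl _ _)) (hom_widen sG (leq_maxr _ _)).
  by apply: ID; apply: IM.
have KC c F : K F -> K (c%:P * F).
  move=> /asboolP [m sF hF]; apply/asboolP; exists m.
    by rewrite mul_polyC (leq_trans (size_scale_leq _ _)).
  have -> : hom m (c%:P * F) = c * hom m F.
    by rewrite /hom mulr_sumr; apply: eq_bigr => i _; rewrite coefCM mulrA.
  exact: IM.
have KX F : K F -> K ('X * F).
  move=> /asboolP [m sF hF]; apply/asboolP; exists m.+1.
    by rewrite (leq_trans (size_polyMleq _ _)) // size_polyX.
  suff -> : hom m.+1 ('X * F) = hom m F by [].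
  rewrite /hom big_ord_recl coefXM /= mul0r add0r; apply: eq_bigr => i _.
  by rewrite coefXM /= subSS.
have K0 : K 0.
  apply/asboolP; exists 0%N; rewrite ?size_poly0 //.
  by rewrite /hom big_ord0.
split=> //.
  apply/asboolP => -[m sF hF]; apply: (sI (m := m)).
  move: sF hF; rewrite size_poly1; case: m => // m _.
  rewrite /hom big_ord_recl coefC /= mul1r subn0 big1 ?addr0 // => i _.
  by rewrite coefC /= mul0r.
(* Horner's rule reduces multiplication by an arbitrary [F] to multiplication by constants and by
   'X. *)
move=> F; elim/poly_ind: F => [|F c IHF] G H KG KH.
  by rewrite mul0r add0r.
rewrite mulrDl -mulrA -addrA; apply: IHF; first exact: KX.
by apply: KD => //; apply: KC.
Qed.

HB.instance Definition _ := isIdealr.Build {poly B} K locq_kernel_ideal.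

Lemma locq_exists : exists (C : comNzRingType) (pi : {rmorphism B -> C}), is_locq I s pi.
Proof.
pose kI : idealr {poly B} := K.
pose C : comNzRingType := {ideal_quot kI}.
pose p : {rmorphism {poly B} -> C} := \pi_{ideal_quot kI}%qT.
have p0 F : p F = 0 <-> K F.
  rewrite -[K F]/(F \in K) -[F in F \in K]subr0.
  rewrite Quotient.idealrBE -(rmorph0 p); split=> [->//|/eqP //].
pose pi : {rmorphism B -> C} := p \o polyC.
exists C, pi; have [I0 ID IM] := idI.
have pX : p 'X * pi s = 1.
  apply/eqP; rewrite -subr_eq0 -(rmorph1 p) -rmorphM -rmorphB; apply/eqP/p0/asboolP.
  exists 2%N.
    rewrite (leq_trans (size_polyD _ _)) // geq_max size_polyN size_poly1 andbT.
    by rewrite mulrC mul_polyC (leq_trans (size_scale_leq _ _)) // size_polyX.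
  rewrite /hom !big_ord_recl big_ord0 /=.
  rewrite !coefB !coefMC !coefX !coefC /= mul0r sub0r mul1r subr0 addr0.
  by rewrite subn0 mulN1r expr2 addNr.
split; first by exists (p 'X).
  move=> c; rewrite -[c]reprK; move: (repr c) => F; rewrite -/(p F).
  elim/poly_ind: F => [|F b [d [m dm]]].
    by exists 0, 0%N; rewrite rmorph0 mul0r rmorph0.
  exists (d + b * s ^+ m.+1), m.+1.
  rewrite rmorphD rmorphM mulrDl rmorphD -dm -/(pi b) [in RHS]rmorphM rmorphXn exprS.
  congr (_ + _); rewrite -mulrA; rewrite [p 'X * _]mulrA pX mul1r. by [].
move=> b; rewrite p0; split=> [/asboolP [m sF]|[m Im]].
  case: m sF => [|m] sF.
    rewrite size_poly_leq0 polyC_eq0 in sF; rewrite (eqP sF); exists 0%N.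
    by rewrite mulr0.
  rewrite /hom big_ord_recl coefC /= subn0 big1 ?addr0 => [Ib|i _]; last first.
    by rewrite coefC /= mul0r.
  by exists m.+1; rewrite mulrC.
apply/asboolP; exists m.+1; first by rewrite (leq_trans (size_polyC_leq1 _)).
rewrite /hom big_ord_recl coefC /= subn0 big1 ?addr0 => [|i _]; last first.
  by rewrite coefC /= mul0r.
by rewrite mulrC exprS -mulrA; apply: IM.
Qed.

End LocQuot.

Lemma unitl_inj (A : comNzRingType) (u v x y : A) : v * u = 1 -> x * u = y * u -> x = y.
Proof.
by move=> vu xy; rewrite -[x]mulr1 -[y]mulr1 -vu ![v * u]mulrC !mulrA xy.
Qed.

Lemma unitlX (A : comNzRingType) (u v : A) m : v * u = 1 -> v ^+ m * u ^+ m = 1.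
Proof. by move=> vu; rewrite -exprMn vu expr1n. Qed.

Section LocqTheory.
Variables (B C : comNzRingType) (I : B -> Prop) (s : B) (pi : {rmorphism B -> C}).
Hypothesis hpi : is_locq I s pi.

Lemma locq_ker b : I b -> pi b = 0.
Proof. by case: hpi => _ _ -> Ib; exists 0%N; rewrite mul1r. Qed.

Lemma locq_hom_eq (D : comNzRingType) (f g : {rmorphism C -> D}) :
  (forall b, f (pi b) = g (pi b)) -> f =1 g.
Proof.
move=> fg c; have [[u us] /(_ c)[b [m cb]] _] := hpi.
have e : f c * f (pi s ^+ m) = g c * f (pi s ^+ m).
  by rewrite -rmorphM cb fg -cb rmorphM !rmorphXn fg.
apply: (@unitl_inj _ _ (f (u ^+ m))) e.
by rewrite -rmorphM (unitlX m us) rmorph1.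
Qed.

Lemma locq_lift (D : comNzRingType) (phi : {rmorphism B -> D}) :
  (forall b, I b -> phi b = 0) -> (exists v, v * phi s = 1) ->
  exists psi : {rmorphism C -> D}, forall b, psi (pi b) = phi b.
Proof.
move=> phiI [v vs]; have [[u us] frac ker] := hpi.
have phi0 b : pi b = 0 -> phi b = 0.
  move=> /ker [m /phiI]; rewrite rmorphM rmorphXn => e.
  by rewrite -[phi b]mul1r -(unitlX m vs) -mulrA e mulr0.
(* The value at [c] is required to fit every expression of [c] as a fraction, so that additivity and
   multiplicativity may use any of them. *)
have ex c : exists d, forall b m, c * pi s ^+ m = pi b -> d * phi s ^+ m = phi b.
  have [b [m cb]] := frac c; exists (v ^+ m * phi b) => b' m' cb'.
  have : phi (b * s ^+ m' - b' * s ^+ m) = 0.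
    apply: phi0; rewrite rmorphB !rmorphM !rmorphXn -cb -cb'.
    by rewrite -!mulrA [pi s ^+ m * _]mulrC subrr.
  rewrite rmorphB !rmorphM !rmorphXn => /eqP; rewrite subr_eq0 => /eqP e.
  by rewrite -mulrA e mulrCA (unitlX m vs) mulr1.
pose psi c := projT1 (cid (ex c)).
have psiP c b m : c * pi s ^+ m = pi b -> psi c * phi s ^+ m = phi b.
  by move=> /(projT2 (cid (ex c))).
have psi_pi b : psi (pi b) = phi b.
  by have := psiP (pi b) b 0%N; rewrite !mulr1; apply.
have psiE c : exists b m, c * pi s ^+ m = pi b /\ psi c * phi s ^+ m = phi b.
  by have [b [m e]] := frac c; exists b, m; split=> //; apply: psiP.
have psiB : zmod_morphism psi.
  move=> c d; have [b [m [cb pb]]] := psiE c; have [b' [m' [db pb']]] := psiE d.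
  apply: (@unitl_inj _ (phi s ^+ (m + m')) (v ^+ (m + m'))); first exact: unitlX.
  rewrite (psiP _ (b * s ^+ m' - b' * s ^+ m)); last first.
    rewrite rmorphB !rmorphM !rmorphXn -cb -db mulrBl exprD mulrA.
    by rewrite [pi s ^+ m * _]mulrC mulrA.
  rewrite rmorphB !rmorphM !rmorphXn -pb -pb' mulrBl exprD mulrA.
  by rewrite [phi s ^+ m * _]mulrC mulrA.
have psiM : monoid_morphism psi.
  split; first by rewrite -(rmorph1 pi) psi_pi rmorph1.
  move=> c d; have [b [m [cb pb]]] := psiE c; have [b' [m' [db pb']]] := psiE d.
  apply: (@unitl_inj _ (phi s ^+ (m + m')) (v ^+ (m + m'))); first exact: unitlX.
  rewrite (psiP _ (b * b')); last by rewrite rmorphM -cb -db exprD mulrACA.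
  by rewrite rmorphM -pb -pb' exprD mulrACA.
pose psi' : {rmorphism C -> D} := HB.pack psi
  (GRing.isZmodMorphism.Build _ _ psi psiB) (GRing.isMonoidMorphism.Build _ _ psi psiM).
by exists psi'.
Qed.

End LocqTheory.

Lemma ideal_eq0 (A : comNzRingType) : is_ideal (fun a : A => a = 0).
Proof.
by split=> [//|a b -> ->|a b ->]; rewrite ?addr0 ?mulr0.
Qed.

Lemma localizationP (A B : comNzRingType) (f : A) (g : {rmorphism A -> B}) :
  is_localization f g <-> is_locq (fun a => a = 0) f g.
Proof.
split=> -[[u uf] frac ker]; split; try by exists u.
- by [].
- move=> b; split=> [/ker //|[m mb]].
  rewrite -[g b]mul1r -(unitlX m uf) -mulrA -rmorphXn -rmorphM mb.
  by rewrite rmorph0 mulr0.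
- by [].
- by move=> a /ker.
Qed.

Lemma localization_exists (A : comNzRingType) (f : A) : (forall m, f ^+ m <> 0) ->
  exists (B : comNzRingType) (g : {rmorphism A -> B}), is_localization f g.
Proof.
move=> nf; have [B [g gP]] := locq_exists (ideal_eq0 A) nf.
by exists B, g; apply/localizationP.
Qed.

Lemma max_ideal_nonnil (A : comNzRingType) (M : A -> Prop) f :
  max_ideal M -> ~ M f -> forall m, f ^+ m <> 0.
Proof.
move=> mM nMf m f0; apply: nMf; apply: (max_ideal_exp mM (n := m)).
by rewrite f0; case: mM => [[]].
Qed.

Lemma quotient_exists (A : comNzRingType) (I : A -> Prop) : is_ideal I -> ~ I 1 ->
  exists (B : comNzRingType) (g : {rmorphism A -> B}),
    (forall b, exists a, g a = b) /\ forall a, g a = 0 <-> I a.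
Proof.
move=> idI nI1; have [|B [g [_ frac ker]]] := @locq_exists A I 1 idI.
  by move=> m; rewrite expr1n.
exists B, g; split=> [b|a].
  by have [a [m e]] := frac b; exists a; rewrite -e rmorph1 expr1n mulr1.
rewrite ker; split=> [[m]|Ia]; last exists 0%N; by rewrite expr1n mul1r.
Qed.

Lemma residue_field (A : comNzRingType) (M : A -> Prop) : max_ideal M ->
  exists (K : fieldType) (g : {rmorphism A -> K}),
    (forall b, exists a, g a = b) /\ forall a, g a = 0 <-> M a.
Proof.
move=> [idM nM1 mM]; have [B [g [gs gM]]] := quotient_exists idM nM1.
have ex (b : B) : exists c, b != 0 -> c * b = 1.
  have [a <-] := gs b; case: (EM (M a)) => [/gM ->|/mM [c Mc]].
    by exists 0; rewrite eqxx.
  exists (g c) => _; apply/eqP; rewrite -subr_eq0 -(rmorph1 g) -rmorphM -rmorphB.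
  exact/eqP/gM.
have [iv ivP] := choice ex.
pose inv b := if b == 0 then 0 else iv b.
have invP b : b != 0 -> inv b * b = 1.
  by move=> nb; rewrite /inv (negPf nb) ivP.
have inv0 : inv 0 = 0 by rewrite /inv eqxx.
pose K : fieldType := HB.pack (GRing.ComNzRing.sort B) (GRing.ComNzRing_isField.Build B invP inv0).
by exists K, g.
Qed.

(** * Extension of homogeneous ideals *)

(** R-linear combinations are enough to get J R[x] when J is an ideal, since the monomials are
    already defined over k; in this form the definition also applies to a mere subspace. *)
Definition ideal_ext (k R : comNzRingType) (phi : k -> R) n
    (J : {mpoly k[n]} -> Prop) (F : {mpoly R[n]}) : Prop :=
  exists m (c : 'I_m -> R) (f : 'I_m -> {mpoly k[n]}),
    (forall i, J (f i)) /\ F = \sum_i c i *: map_mpoly phi (f i).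

Section IdealExt.
Variables (k R : comNzRingType) (phi : {rmorphism k -> R}) (n : nat).
Implicit Types (J : {mpoly k[n]} -> Prop) (F G : {mpoly R[n]}).

Lemma ext_map J f : J f -> ideal_ext phi J (map_mpoly phi f).
Proof.
by move=> Jf; exists 1%N, (fun=> 1), (fun=> f); rewrite big_ord1 scale1r.
Qed.

Lemma ext0 J : ideal_ext phi J 0.
Proof. by exists 0%N, (fun=> 0), (fun=> 0); split=> [[]|]//; rewrite big_ord0. Qed.

Lemma extD J F G : ideal_ext phi J F -> ideal_ext phi J G -> ideal_ext phi J (F + G).
Proof.
move=> [m [c [f [Jf ->]]]] [m' [c' [f' [Jf' ->]]]].
exists (m + m')%N, (fun i => match split i with inl j => c j | inr j => c' j end),
  (fun i => match split i with inl j => f j | inr j => f' j end).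
split; first by move=> i; case: (split i).
rewrite big_split_ord /=; congr (_ + _); apply: eq_bigr => i _.
  by rewrite (unsplitK (inl i : 'I_m + 'I_m')).
by rewrite (unsplitK (inr i : 'I_m + 'I_m')).
Qed.

Lemma extZ J c F : ideal_ext phi J F -> ideal_ext phi J (c *: F).
Proof.
move=> [m [d [f [Jf ->]]]]; exists m, (fun i => c * d i), f; split=> //.
by rewrite scaler_sumr; apply: eq_bigr => i _; rewrite scalerA.
Qed.

Lemma ext_sub J J' F : (forall f, J f -> J' f) -> ideal_ext phi J F -> ideal_ext phi J' F.
Proof. by move=> sJ [m [c [f [Jf ->]]]]; exists m, c, f; split=> // i; apply: sJ. Qed.

Lemma ext_idealM J F G : (forall f g, J f -> J (f * g)) ->
  ideal_ext phi J F -> ideal_ext phi J (F * G).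
Proof.
move=> JM JF; rewrite [G]mpolyE big_distrr /= big_seq.
apply: (big_ind (ideal_ext phi J)); first exact: ext0.
  exact: extD.
move=> m _; rewrite -scalerAr; apply: extZ.
case: JF => [l [c [f [Jf ->]]]]; exists l, c, (fun i => f i * 'X_[m]); split.
  by move=> i; apply: JM.
rewrite mulr_suml; apply: eq_bigr => i _.
by rewrite rmorphM /= map_mpolyX scalerAl.
Qed.

Lemma ext_is_ideal J : (forall f g, J f -> J (f * g)) -> is_ideal (ideal_ext phi J).
Proof.
move=> JM; split; first exact: ext0.
  exact: extD.
by move=> F G JG; rewrite mulrC; apply: ext_idealM.
Qed.

Lemma map_mpolyK (f : {mpoly k[n]}) : map_mpoly idfun f = f.
Proof. by apply/mpolyP => m; rewrite mcoeff_map_mpoly. Qed.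

End IdealExt.

(** * Flatness of R[x] over k[x] *)

Section Flat.
Variables (k : fieldType) (R : comNzRingType) (phi : {rmorphism k -> R}) (n : nat).
Implicit Types (J W : {mpoly k[n]} -> Prop) (F G : {mpoly R[n]}).

Definition subspace J :=
  [/\ J 0, forall f g, J f -> J g -> J (f + g) & forall c f, J f -> J (c *: f)].

Definition indep_mod J m (f : 'I_m -> {mpoly k[n]}) :=
  forall a : 'I_m -> k, J (\sum_i a i *: f i) -> forall i, a i = 0.

Lemma subspace_sum J m (a : 'I_m -> k) (f : 'I_m -> {mpoly k[n]}) :
  subspace J -> (forall i, J (f i)) -> J (\sum_i a i *: f i).
Proof.
by move=> [J0 JD JZ] Jf; elim/big_ind: _ => // i _; apply: JZ.
Qed.

(** Let [F] and [H] be the coefficient matrices of the [f i] and [h i], and C the cokernel of [H].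
    Independence modulo J makes F C row free; its right inverse over k maps to one over R, whereas
    the relation over R is killed by C. *)
Lemma indep_mod_ext J m (f : 'I_m -> {mpoly k[n]}) (r : 'I_m -> R) :
  subspace J -> indep_mod J f ->
  ideal_ext phi J (\sum_i r i *: map_mpoly phi (f i)) -> forall i, r i = 0.
Proof.
move=> spJ inf [l [d [h [Jh e]]]].
pose S := flatten [seq msupp (f i) | i <- enum 'I_m] ++
          flatten [seq msupp (h i) | i <- enum 'I_l].
pose F : 'M[k]_(m, size S) := \matrix_(i, j) (f i)@_(tnth (in_tuple S) j).
pose H : 'M[k]_(l, size S) := \matrix_(i, j) (h i)@_(tnth (in_tuple S) j).
have FH (x : 'rV_m) (y : 'rV_l) : x *m F = y *m H ->
    \sum_i x 0 i *: f i = \sum_i y 0 i *: h i.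
  move=> xy; apply/mpolyP => u; rewrite !raddf_sum /=.
  case: (boolP (u \in S)) => uS.
    have [j ->] := tnthP (in_tuple S) u uS.
    have := congr1 (fun M : 'rV_(size S) => M 0 j) xy; rewrite !mxE => xyj.
    transitivity (\sum_j0 x 0 j0 * F j0 j).
      by apply: eq_bigr => i _; rewrite mcoeffZ mxE.
    by rewrite xyj; apply: eq_bigr => i _; rewrite mcoeffZ mxE.
  move: uS; rewrite mem_cat negb_or => /andP[uf uh].
  rewrite !big1 // => i _; rewrite mcoeffZ memN_msupp_eq0 ?mulr0 //.
    apply: contra uh => ui; apply/flattenP; exists (msupp (h i)) => //.
    by apply/mapP; exists i; rewrite // mem_enum.
  apply: contra uf => ui; apply/flattenP; exists (msupp (f i)) => //.
  by apply/mapP; exists i; rewrite // mem_enum.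
have rf : row_free (F *m cokermx H).
  apply: inj_row_free => v; rewrite mulmxA => /eqP; rewrite -submxE => /submxP [y vy].
  apply/rowP => i; rewrite mxE; apply: (inf (fun i => v 0 i)).
  by rewrite (FH _ _ vy); apply: subspace_sum.
pose rr : 'rV[R]_m := \row_i r i; pose dd : 'rV[R]_l := \row_i d i.
have eM : rr *m map_mx phi F = dd *m map_mx phi H.
  apply/rowP => j; rewrite !mxE.
  have := congr1 (fun p : {mpoly R[n]} => p@_(tnth (in_tuple S) j)) e.
  rewrite !raddf_sum /= => ej.
  transitivity (\sum_i (r i *: map_mpoly phi (f i))@_(tnth (in_tuple S) j)).
    by apply: eq_bigr => i _; rewrite !mxE mcoeffZ mcoeff_map_mpoly.
  by rewrite ej; apply: eq_bigr => i _; rewrite !mxE mcoeffZ mcoeff_map_mpoly.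
move=> i; have -> : r i = rr 0 i by rewrite mxE.
have [Q FQ] := row_freeP rf.
move: (mulmx_coker H) Q FQ {rf}; move: (cokermx H) => C HC Q FQ.
have HQ : map_mx phi H *m map_mx phi C = 0 by rewrite -map_mxM HC map_mx0.
rewrite -[rr]mulmx1 -(map_mx1 phi) -FQ !map_mxM !mulmxA eM -(mulmxA dd) HQ.
rewrite mulmx0 mul0mx.
by rewrite mxE.
Qed.

(** A relation modulo J among the [f i] expresses one of them through the others and an element of J
    that is still in W. Induction on their number removes all relations. *)
Lemma ext_indep_decomp J W F : subspace J -> subspace W -> ideal_ext phi W F ->
  exists m (r : 'I_m -> R) (f : 'I_m -> {mpoly k[n]}) G,
    [/\ forall i, W (f i), indep_mod J f,
        ideal_ext phi (fun f => J f /\ W f) G &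
        F = \sum_i r i *: map_mpoly phi (f i) + G].
Proof.
move=> spJ spW [m [r [f [Wf ->]]]] {F}.
elim: m r f Wf => [|m IHm] r f Wf.
  by exists 0%N, r, f, 0; split=> //; [move=> a _ []|apply: ext0|rewrite addr0].
case: (EM (indep_mod J f)) => [inf|].
  by exists m.+1, r, f, 0; split=> //; [apply: ext0|rewrite addr0].
rewrite /indep_mod -existsNE => -[a /not_implyP[Ja]].
rewrite -existsNE => -[i0 /eqP ai0].
pose g := (a i0)^-1 *: \sum_i a i *: f i.
have [[_ _ JZ] [_ _ WZ]] := (spJ, spW).
have Jg : J g by apply: JZ.
have Wg : W g by apply: WZ; apply: subspace_sum.
have ef : f i0 = g - \sum_i ((a i0)^-1 * a (lift i0 i)) *: f (lift i0 i).
  rewrite /g (bigD1_ord i0) //= scalerDr scalerA mulVf // scale1r.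
  rewrite scaler_sumr -addrA -sumrB big1 ?addr0 // => i _.
  by rewrite scalerA subrr.
have [|m' [r' [f' [G [Wf' inf' JG e]]]]] :=
  IHm (fun i => r (lift i0 i) - r i0 * phi ((a i0)^-1 * a (lift i0 i)))
    (fun i => f (lift i0 i)).
  by move=> i; apply: Wf.
exists m', r', f', (G + r i0 *: map_mpoly phi g); split=> //.
  by apply: extD => //; apply: extZ; apply: ext_map.
rewrite addrA -e (bigD1_ord i0) //= {1}ef addrC rmorphB /= scalerBr.
rewrite [_ *: map_mpoly phi g - _]addrC addrA; congr (_ + _).
rewrite rmorph_sum /= scaler_sumr -sumrB; apply: eq_bigr => i _.
by rewrite map_mpolyZ scalerA -scalerBl.
Qed.

Lemma ext_setT F : ideal_ext phi (fun=> True) F.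
Proof.
rewrite [F]mpolyE big_tnth; exists (size (msupp F)), (fun i => F@_(tnth (in_tuple (msupp F)) i)),
  (fun i => 'X_[tnth (in_tuple (msupp F)) i]); split=> //.
by apply: eq_bigr => i _; rewrite map_mpolyX.
Qed.

Lemma subspaceT : subspace (fun=> True). Proof. by []. Qed.

(** As J is prime, multiplication by [g] preserves independence modulo J. By [indep_mod_ext] the
    coefficients of [F] on vectors independent modulo J then vanish, which leaves [F] in the
    extended ideal. *)
Lemma ext_nzd J g F : subspace J -> (forall f g, J f -> J (f * g)) ->
  (forall f g, J (f * g) -> J f \/ J g) -> ~ J g ->
  ideal_ext phi J (map_mpoly phi g * F) -> ideal_ext phi J F.
Proof.
move=> spJ JM Jpr nJg.
have [m [r [f [G [_ inf JG ->]]]]] := ext_indep_decomp spJ subspaceT (ext_setT F).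
have {}JG : ideal_ext phi J G by apply: ext_sub JG => h [].
rewrite mulrDr => JF.
suff r0 i : r i = 0.
  by rewrite big1 ?add0r // => i _; rewrite r0 scale0r.
have infg : indep_mod J (fun i => g * f i).
  move=> a Ja; apply: inf.
  have : J (g * \sum_i a i *: f i).
    by rewrite mulr_sumr; under eq_bigr => j _ do rewrite -scalerAr.
  by move=> /Jpr [].
apply: (indep_mod_ext spJ infg).
have -> : \sum_i r i *: map_mpoly phi (g * f i) =
    map_mpoly phi g * (\sum_i r i *: map_mpoly phi (f i)) + map_mpoly phi g * G
    + (-1) *: (G * map_mpoly phi g).
  rewrite scaleN1r [G * _]mulrC addrK mulr_sumr; apply: eq_bigr => j _.
  by rewrite rmorphM /= scalerAr.
by apply: extD => //; apply: extZ; apply: ext_idealM.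
Qed.

(** Extension of scalars commutes with intersections: in the decomposition of an element of W R[x]
    relative to J, the part independent modulo J has zero coefficients once the element also lies in
    J R[x]. *)
Lemma ext_inter J W F : subspace J -> subspace W ->
  ideal_ext phi J F -> ideal_ext phi W F -> ideal_ext phi (fun f => J f /\ W f) F.
Proof.
move=> spJ spW JF WF.
have [m [r [f [G [_ inf JG e]]]]] := ext_indep_decomp spJ spW WF.
suff r0 i : r i = 0 by rewrite e big1 ?add0r // => i _; rewrite r0 scale0r.
apply: (indep_mod_ext spJ inf).
have -> : \sum_i r i *: map_mpoly phi (f i) = F + (-1) *: G.
  by rewrite e scaleN1r addrK.
by apply: extD => //; apply: extZ; apply: ext_sub JG => h [].
Qed.

End Flat.

(** * Frames, charts and sections *)

Section Upow.
Variables (A : comNzRingType).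
Implicit Types (x y u v : A) (m : int).

Lemma uinv_eq x u v : x * u = 1 -> x * v = 1 -> u = v.
Proof. by move=> xu xv; rewrite -[u]mulr1 -xv mulrCA mulrA xu mul1r. Qed.

Lemma upowM x u y v m : upow (x * y) (u * v) m = upow x u m * upow y v m.
Proof. by case: m => m /=; rewrite exprMn. Qed.

Lemma upow1 m : upow (1 : A) 1 m = 1.
Proof. by case: m => m /=; rewrite expr1n. Qed.

Lemma upow_unit x u m : x * u = 1 -> upow x u m * upow u x m = 1.
Proof. by move=> xu; rewrite -upowM [u * x]mulrC xu upow1. Qed.

Lemma upowS x u m : x * u = 1 -> upow x u (m + 1) = x * upow x u m.
Proof.
move=> xu; case: m => [m|[|m]].
- by rewrite -PoszD addn1 /= exprS.
- by rewrite /= expr0 expr1 xu.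
- have -> : Negz m.+1 + 1 = Negz m by rewrite !NegzE -addn1 PoszD opprD addrNK.
  by rewrite /= [_ ^+ m.+2]exprS mulrA xu mul1r.
Qed.

Lemma upowB x u m : x * u = 1 -> upow x u (m - 1) = u * upow x u m.
Proof.
by move=> xu; rewrite -{2}[m](subrK 1) upowS // mulrA [u * x]mulrC xu mul1r.
Qed.

End Upow.

Lemma upow_morph (A B : comNzRingType) (f : {rmorphism A -> B}) x u m :
  f (upow x u m) = upow (f x) (f u) m.
Proof. by case: m => m /=; rewrite rmorphXn. Qed.

Section Frames.
Variables (A : comNzRingType) (M : lmodType A) (e : frame M).

Lemma coordD x y : coord e (x + y) = coord e x + coord e y.
Proof. by rewrite -[x in LHS](coordK e) -[y in LHS](coordK e) -scalerDl genK. Qed.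

Lemma coordZ a x : coord e (a *: x) = a * coord e x.
Proof. by rewrite -[x in LHS](coordK e) scalerA genK. Qed.

Lemma coord_gen : coord e e = 1.
Proof. by rewrite -[gen e]scale1r genK. Qed.

End Frames.

(** * Charts, their localizations, and the universal charts of the cone *)

Section Charts.
Variables (k : closedFieldType) (n : nat) (J : {mpoly k[n.+1]} -> Prop).

Lemma same_point_refl (A : comNzRingType) (v : 'rV[A]_n.+1) : same_point v v.
Proof. by exists 1, 1; rewrite mul1r scale1r. Qed.

Lemma same_point_trans (A : comNzRingType) (u v w : 'rV[A]_n.+1) :
  same_point u v -> same_point v w -> same_point u w.
Proof.
move=> [a [a' [aa ->]]] [b [b' [bb ->]]]; exists (b * a), (b' * a').
by rewrite mulrACA aa bb mulr1 scalerA.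
Qed.

Lemma same_point_sym (A : comNzRingType) (v w : 'rV[A]_n.+1) :
  same_point v w -> same_point w v.
Proof.
move=> [a [a' [aa ->]]]; exists a', a; rewrite mulrC aa; split=> //.
by rewrite scalerA mulrC aa scale1r.
Qed.

Lemma same_point_map (A B : comNzRingType) (f : {rmorphism A -> B}) (v w : 'rV[A]_n.+1) :
  same_point v w -> same_point (map_mx f v) (map_mx f w).
Proof.
move=> [a [a' [aa ->]]]; exists (f a), (f a').
by rewrite -rmorphM aa rmorph1 map_mxZ.
Qed.

Section FixR.
Variable R : kalg k.
Implicit Types (p q r : chart J R).

Lemma idchom_vec p : same_point (map_mx idfun (cvec (ckc p))) (cvec (ckc p)).
Proof. by rewrite map_mx_id; [apply: same_point_refl|]. Qed.

Definition idchom p : chom p p :=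
  @CHom _ _ J R p p (@KHom _ (cring p) (cring p) idfun (fun=> erefl))
    (fun=> erefl) (idchom_vec p).

Lemma chcomp_vec p q r (h : chom p q) (h' : chom q r) :
  same_point (map_mx (kcomp h' h) (cvec (ckc p))) (cvec (ckc r)).
Proof.
rewrite map_mx_comp; apply: same_point_trans (cmap_vec h').
exact/same_point_map/cmap_vec.
Qed.

Lemma chcomp_str p q r (h : chom p q) (h' : chom q r) a :
  kcomp h' h (cstr p a) = cstr r a.
Proof. by rewrite /= !cmap_str. Qed.

Definition chcomp p q r (h : chom p q) (h' : chom q r) : chom p r :=
  @CHom _ _ J R p r (kcomp h' h) (chcomp_str h h') (chcomp_vec h h').

Lemma mk_chom p q (h : {rmorphism cring p -> cring q}) :
  (forall a, h (cstr p a) = cstr q a) ->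
  same_point (map_mx h (cvec (ckc p))) (cvec (ckc q)) ->
  exists h' : chom p q, h' =1 h.
Proof.
move=> hs hv.
have hk a : h (kstr (cring p) a) = kstr (cring q) a.
  by rewrite -(kmapK (cstr p)) -(kmapK (cstr q)) hs.
by exists (@CHom _ _ J R p q (@KHom _ (cring p) (cring q) h hk) hs hv).
Qed.

Definition ev p : {rmorphism {mpoly R[n.+1]} -> cring p} :=
  meval (fun i => cvec (ckc p) 0 i) \o map_mpoly (cstr p).

Arguments ev : simpl never.

Lemma ev_map p (f : {mpoly k[n.+1]}) :
  ev p (map_mpoly (kstr R) f) =
  (map_mpoly (kstr (cring p)) f).@[fun i => cvec (ckc p) 0 i].
Proof.
rewrite /ev /=; congr (_.@[_]); apply/mpolyP => m.
by rewrite !mcoeff_map_mpoly /= kmapK.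
Qed.

Lemma evX p i : ev p 'X_i = cvec (ckc p) 0 i.
Proof. by rewrite /ev /= map_mpolyX mevalXU. Qed.

Lemma evC p c : ev p c%:MP = cstr p c.
Proof. by rewrite /ev /= map_mpolyC mevalC. Qed.

Lemma rmorph_mpoly_eq (B : comNzRingType) (f g : {rmorphism {mpoly R[n.+1]} -> B}) :
  (forall c, f c%:MP = g c%:MP) -> (forall i, f 'X_i = g 'X_i) -> f =1 g.
Proof.
move=> fgC fgX F; rewrite [F]mpolyE !rmorph_sum; apply: eq_bigr => m _.
rewrite -mul_mpolyC !rmorphM fgC; congr (_ * _).
by rewrite mpolyXE_id !rmorph_prod; apply: eq_bigr => i _; rewrite !rmorphXn fgX.
Qed.

Lemma ev_ext p F : ideal_ext (kstr R) J F -> ev p F = 0.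
Proof.
move=> [m [c [f [Jf ->]]]]; rewrite rmorph_sum big1 // => i _.
rewrite -mul_mpolyC rmorphM ev_map; have [_ ->] := con (ckc p) => //.
by rewrite mulr0.
Qed.

(** A morphism of charts matches the coordinates up to a unit only; evaluation of polynomials
    commutes with it when the unit is 1. *)
Definition strict p q (h : chom p q) := forall i, h (cvec (ckc p) 0 i) = cvec (ckc q) 0 i.

Lemma strict_ev p q (h : chom p q) F : strict h -> h (ev p F) = ev q F.
Proof.
move=> sh; have := @rmorph_mpoly_eq _ (h \o ev p) (ev q).
apply=> [c|i].
  exact: etrans (congr1 h (evC p c)) (etrans (cmap_str h c) (esym (evC q c))).
exact: etrans (congr1 h (evX p i)) (etrans (sh i) (esym (evX q i))).
Qed.

Section Push.
Variables (p : chart J R) (B : comNzRingType) (g : {rmorphism cring p -> B}).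

Definition push_kalg : kalg k := KAlg (g \o kstr (cring p)).

Definition push_khom : khom (cring p) push_kalg :=
  @KHom k (cring p) push_kalg g (fun=> erefl).

Lemma push_on_proj : @on_proj k n J push_kalg (map_mx g (cvec (ckc p))).
Proof.
have [[w w1] vJ] := con (ckc p); split.
  exists (map_mx g w).
  rewrite -(rmorph1 g) -w1 rmorph_sum; apply: eq_bigr => i _.
  by rewrite !mxE rmorphM.
move=> f /vJ; rewrite -ev_map => /(congr1 g); rewrite rmorph0 => <-.
pose d : chart J R := p.
transitivity ((g \o ev p) (map_mpoly (kstr R) f)); last by [].
pose e' : {rmorphism {mpoly R[n.+1]} -> B} :=
  meval (fun i => map_mx g (cvec (ckc p)) 0 i) \o map_mpoly (g \o cstr p).
transitivity (e' (map_mpoly (kstr R) f)).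
  rewrite /e' /=; congr (_.@[_]); apply/mpolyP => m.
  by rewrite !mcoeff_map_mpoly /= kmapK.
apply: rmorph_mpoly_eq => [c|i].
  by rewrite -[RHS]/(g (ev p c%:MP)) evC /e' /= map_mpolyC mevalC.
by rewrite -[RHS]/(g (ev p 'X_i)) evX /e' /= map_mpolyX mevalXU mxE.
Qed.

Definition pushc : chart J R :=
  @Chart _ _ J R (@KChart _ _ J push_kalg _ push_on_proj) (kcomp push_khom (cstr p)).

Definition pushh : chom p pushc :=
  @CHom _ _ J R p pushc push_khom (fun=> erefl) (same_point_refl _).

Lemma pushh_strict : strict pushh.
Proof. by move=> i; rewrite /= mxE. Qed.

End Push.

Lemma loc_chart p f : (forall m, f ^+ m <> 0) ->
  exists q (h : chom p q), is_localization f h /\ strict h.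
Proof.
move=> /localization_exists [B [g gP]]; exists (pushc g), (pushh g).
by split=> //; apply: pushh_strict.
Qed.

Lemma loc_chom p q r f (h : chom p q) (h' : chom p r) :
  is_localization f h -> (exists u, u * h' f = 1) ->
  exists2 g : chom q r, (forall a, g (h a) = h' a) & (strict h -> strict h' -> strict g).
Proof.
move=> /localizationP hL hf.
have [|g gh] := locq_lift hL (phi := kmap h') _ hf.
  by move=> b ->; apply: rmorph0.
have ge a : g (h a) = h' a by apply: gh.
have [||g' g'g] := @mk_chom q r g.
- by move=> a; rewrite -(cmap_str h) ge cmap_str.
- apply: same_point_trans (cmap_vec h').
  rewrite (_ : map_mx h' _ = map_mx g (map_mx h (cvec (ckc p)))).
    exact/same_point_map/same_point_sym/cmap_vec.
  by apply/rowP => i; rewrite !mxE -ge.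
exists g' => [a|sh sh' i]; first by rewrite g'g ge.
by rewrite g'g -sh ge sh'.
Qed.

Lemma res_chart p M : max_ideal M ->
  exists q (h : chom p q), [/\ strict h, forall a, h a = 0 <-> M a,
    forall b, exists a, h a = b & forall x : cring q, x <> 0 -> exists u, u * x = 1].
Proof.
move=> /residue_field [K [g [gs gM]]]; exists (pushc g), (pushh g).
split=> //; first exact: pushh_strict.
by move=> x /eqP x0; exists ((x : K)^-1); apply: mulVf.
Qed.

Lemma quot_chart p I : is_ideal I -> ~ I 1 ->
  exists q (h : chom p q), [/\ strict h, forall a, h a = 0 <-> I a &
    forall b, exists a, h a = b].
Proof.
move=> idI nI1; have [B [g [gs gI]]] := quotient_exists idI nI1.
by exists (pushc g), (pushh g); split=> //; apply: pushh_strict.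
Qed.

Lemma chart_unit p M : max_ideal M -> exists i, ~ M (cvec (ckc p) 0 i).
Proof. by have [[w w1] _] := con (ckc p); apply: unit_idealN; exists (fun i => w 0 i). Qed.

(* c is the basic open subset where s is invertible of the affine cone over
   V(J)_R, which maps to V(J)_R as soon as some x_i divides s. *)
Definition univ c (s : {mpoly R[n.+1]}) := is_locq (ideal_ext (kstr R) J) s (ev c).

Definition hasX (s : {mpoly R[n.+1]}) := exists i s', s = 'X_i * s'.

Hypothesis JM : forall f g, J f -> J (f * g).

(** Rings are nonzero, so a chart where [s] is invertible exists only if no power of [s] vanishes
    modulo the ideal. Several proofs below have to treat the nilpotent case apart for this
    reason. *)
Lemma univ_exists s : hasX s -> (forall m, ~ ideal_ext (kstr R) J (s ^+ m)) ->
  exists c, univ c s.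
Proof.
move=> [i [s' es]] ns.
have [C [pi piP]] := locq_exists (ext_is_ideal (kstr R) JM) ns.
pose A : kalg k := KAlg (pi \o @mpolyC n.+1 R \o kstr R).
pose v : 'rV[A]_n.+1 := \row_i pi 'X_i.
have evE F : (map_mpoly (pi \o @mpolyC n.+1 R) F).@[fun i => v 0 i] = pi F.
  apply: (@rmorph_mpoly_eq _ (meval (fun i => v 0 i) \o map_mpoly (pi \o @mpolyC n.+1 R)) pi).
    by move=> c; rewrite /= map_mpolyC mevalC.
  by move=> j; rewrite /= map_mpolyX mevalXU mxE.
have vP : on_proj J v.
  split.
    have [[u us] _ _] := piP; exists (\row_j (u * pi s' * (j == i)%:R)).
    rewrite (bigD1 i) //= big1 ?addr0 => [|j /negPf ji].
      by rewrite !mxE eqxx mulr1 -mulrA -rmorphM mulrC [s' * _]mulrC -es mulrC.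
    by rewrite !mxE ji mulr0 mul0r.
  move=> f Jf; rewrite -[RHS](locq_ker piP (ext_map (kstr R) Jf)) -evE.
  by congr (_.@[_]); apply/mpolyP => m; rewrite !mcoeff_map_mpoly.
pose st : khom R A := @KHom k R A (pi \o @mpolyC n.+1 R) (fun=> erefl).
exists (@Chart _ _ J R (KChart vP) st).
have evpi F : ev (@Chart _ _ J R (KChart vP) st) F = pi F by apply: evE.
case: piP => -[u us] frac ker; split.
- by exists u; rewrite evpi.
- by move=> c; have [b [m e]] := frac c; exists b, m; rewrite !evpi.
- by move=> b; rewrite evpi.
Qed.

Lemma univ_nonnil c s m : univ c s -> ~ ideal_ext (kstr R) J (s ^+ m).
Proof.
move=> [[u us] _ _] /(ev_ext c); rewrite rmorphXn => s0.
by have := unitlX m us; rewrite s0 mulr0 => /eqP; rewrite eq_sym oner_eq0.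
Qed.

Lemma nonnil_ext p s : (forall m, ev p s ^+ m <> 0) ->
  forall m, ~ ideal_ext (kstr R) J (s ^+ m).
Proof. by move=> nn m /(ev_ext p); rewrite rmorphXn; apply: nn. Qed.

Lemma unit_nonnil (A : comNzRingType) (x u : A) : u * x = 1 -> forall m, x ^+ m <> 0.
Proof.
move=> ux m x0; have := unitlX m ux.
by rewrite x0 mulr0 => /eqP; rewrite eq_sym oner_eq0.
Qed.

(** This explains the name [univ]: any chart on which [s] is invertible is pulled back from [c], so
    one chart for each [s] is enough to test sections. *)
Lemma univ_chom c s q : univ c s -> (exists u, u * ev q s = 1) ->
  exists h : chom c q, strict h.
Proof.
move=> cs qs.
have [|h hP] := locq_lift cs (phi := ev q) _ qs; first by move=> b; apply: ev_ext.
have hs i : h (cvec (ckc c) 0 i) = cvec (ckc q) 0 i by rewrite -!evX hP.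
have [||h' h'h] := @mk_chom c q h.
- by move=> a; rewrite -!evC hP.
- rewrite (_ : map_mx h _ = cvec (ckc q)); first exact: same_point_refl.
  by apply/rowP => i; rewrite mxE hs.
by exists h' => i; rewrite h'h hs.
Qed.

Section Sheaf.
Variable L : invertible J R.

Lemma resZD p q (h : chom p q) a (x y : L p) :
  res h (a *: x + y) = h a *: res h x + res h y.
Proof.
have [[b1 _] _] := sh_cart L h.
by have := b1 a x y 1; rewrite !scale1r.
Qed.

Lemma resD p q (h : chom p q) (x y : L p) : res h (x + y) = res h x + res h y.
Proof. by have := resZD h 1 x y; rewrite rmorph1 !scale1r. Qed.

Lemma res0 p q (h : chom p q) : res h (0 : L p) = 0.
Proof. by apply: (addrI (res h (0 : L p))); rewrite -resD !addr0. Qed.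

Lemma resZ p q (h : chom p q) a (x : L p) : res h (a *: x) = h a *: res h x.
Proof. by have := resZD h a x 0; rewrite res0 !addr0. Qed.

(** The coordinate on [L q] is induced, through the tensor product, by the coordinate on [L p]. That
    it reconstructs every element is the uniqueness clause, applied to it and to the identity. *)
Lemma fpush_ex p q (h : chom p q) (e : frame (L p)) :
  exists e' : frame (L q), gen e' = res h e.
Proof.
have [_ /(_ (cring q)^o (fun m c => c * h (coord e m)))] := sh_cart L h.
case.
  split=> [a m m' c|a m c c'].
    by rewrite coordD coordZ rmorphD rmorphM mulrDr mulrCA.
  by rewrite /GRing.scale /= mulrDl mulrA.
move=> l [llin lb _].
have lZ a x : l (a *: x) = a * l x.
  have l0 : l 0 = 0 by have := llin (-1) 0 0; rewrite scaler0 addr0 scaleN1r addNr.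
  by have := llin a x 0; rewrite !addr0 l0 addr0.
have lres x : l (res h x) = h (coord e x) by have := lb x 1; rewrite scale1r mul1r.
have [_ /(_ (L q) (fun m c => c *: res h m))] := sh_cart L h.
case; first exact: (proj1 (sh_cart L h)).
move=> l1 [_ _ uniq].
have e1 : (fun x : L q => l x *: res h e) =1 l1.
  apply: uniq => [a x y|m c]; first by rewrite llin scalerDl scalerA.
  by rewrite lZ lres -scalerA -resZ coordK.
have e2 : (fun x : L q => x) =1 l1 by apply: uniq.
have cK x : l x *: res h e = x by rewrite e1 -e2.
have gK a : l (a *: res h e) = a by rewrite lZ lres coord_gen rmorph1 mulr1.
by exists (@Frame _ _ (res h e) l cK gK).
Qed.

Definition fpush p q (h : chom p q) (e : frame (L p)) : frame (L q) :=
  projT1 (cid (fpush_ex h e)).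

Lemma fpushE p q (h : chom p q) (e : frame (L p)) : gen (fpush h e) = res h e.
Proof. exact: projT2 (cid (fpush_ex h e)). Qed.

Lemma res_eq p q (h h' : chom p q) (x : L p) : h =1 h' -> res h x = res h' x.
Proof.
move=> hh; have := res_comp (i := L) (h := h') (h' := idchom q) (h'' := h) hh x.
by rewrite /= (@res_id _ _ J R L _ (idchom q)).
Qed.

Definition framed (s : {mpoly R[n.+1]}) :=
  hasX s /\ forall c, univ c s -> inhabited (frame (L c)).

Lemma framed_mul s g : framed s -> framed (s * g).
Proof.
move=> [[i [s' es]] sf]; split; first by exists i, (s' * g); rewrite es mulrA.
move=> c csg.
have [[u us] _ _] := csg.
have [c' c's] : exists c', univ c' s.
  apply: univ_exists; first by exists i, s'.
  apply: (@nonnil_ext c); apply: (@unit_nonnil _ _ (u * ev c g)).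
  by rewrite -mulrA -rmorphM [g * s]mulrC.
have [|h _] := univ_chom (q := c) c's.
  by exists (u * ev c g); rewrite -mulrA -rmorphM [g * s]mulrC.
by have [e] := sf _ c's; constructor; apply: fpush h e.
Qed.

(** On the cone chart of each x_j the sheaf is free over the basic opens of some functions; the
    numerators [b i] of these functions give the polynomials x_j b_i. The resulting finite list
    serves all charts at once. *)
Lemma framed_cover : exists S : seq {mpoly R[n.+1]},
  (forall s, s \in S -> framed s) /\
  forall p M, max_ideal M -> exists2 s, s \in S & ~ M (ev p s).
Proof.
have H j : exists S : seq {mpoly R[n.+1]}, (forall s, s \in S -> framed s) /\
    forall p M, max_ideal M -> ~ M (cvec (ckc p) 0 j) -> exists2 s, s \in S & ~ M (ev p s).
  case: (EM (forall m, ~ ideal_ext (kstr R) J ('X_j ^+ m))) => [nn|]; last first.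
    rewrite -existsNE => -[m /contrapT xm]; exists [::]; split=> // p M mM.
    case; apply: (max_ideal_exp mM (n := m)).
    by rewrite -evX -rmorphXn (ev_ext p xm); case: mM => [[]].
  have [C CX] : exists C, univ C 'X_j.
    by apply: univ_exists => //; exists j, 1; rewrite mulr1.
  have [N [f [f1 fL]]] := sh_inv L C.
  have [_ frac _] := CX.
  have [b Hb] := choice (fun i => frac (f i)).
  have [m fb] := choice Hb.
  exists [seq 'X_j * b i | i <- enum 'I_N]; split.
    move=> _ /mapP [i _ ->]; split; first by exists j, (b i).
    move=> c cs; have [[u us] _ _] := cs.
    have Xu : exists u, u * ev c 'X_j = 1.
      by exists (u * ev c (b i)); rewrite -mulrA -rmorphM [b i * _]mulrC.
    have [h sh] := univ_chom CX Xu.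
    have fu : exists v, v * h (f i) = 1.
      exists (u * ev c 'X_j * h (ev C 'X_j) ^+ m i).
      rewrite -!mulrA -rmorphXn -rmorphM [_ * f i]mulrC fb strict_ev //.
      by rewrite -rmorphM.
    have [v vf] := fu.
    have [|q [h1 [h1L _]]] := @loc_chart C (f i).
      move=> l fl; have := unit_nonnil vf (m := l).
      by rewrite -rmorphXn fl rmorph0.
    have [e] := fL i q h1 h1L.
    have [g _ _] := loc_chom h1L fu.
    by constructor; apply: fpush g e.
  move=> p M mM nMj.
  (* On the residue field of [M] the cone chart of x_j maps to [q], and some [f i] is nonzero there
     because they generate the unit ideal. *)
  have [q [h [sh hM _ hu]]] := @res_chart p M mM.
  have [|h' sh'] := univ_chom (q := q) CX.
    by apply: hu => x0; apply: nMj; apply/hM; rewrite sh -evX.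
  have [i nfi] : exists i, h' (f i) <> 0.
    apply: contrapT; rewrite -forallNE => f0.
    case: f1 => w /(congr1 h'); rewrite rmorph_sum rmorph1 big1.
      by move=> /eqP; rewrite eq_sym oner_eq0.
    by move=> i _; rewrite rmorphM (contrapT (f0 i)) mulr0.
  exists ('X_j * b i); first by apply: map_f; rewrite mem_enum.
  move=> /hM; rewrite strict_ev // => e.
  have [v vf] := hu _ nfi.
  have [w wX] : exists w, w * ev q 'X_j = 1.
    by apply: hu => x0; apply: nMj; apply/hM; rewrite sh -evX.
  have /(congr1 h') := fb i; rewrite rmorphM rmorphXn /= !strict_ev // => e2.
  have : ev q ('X_j * b i) * (v * w ^+ (m i).+1) = 1.
    rewrite rmorphM -e2 -[RHS](unitlX (m i).+1 wX) -[RHS]mul1r -vf !exprS.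
    by move: (h' (f i)) (ev q 'X_j) => y x; ring.
  by rewrite e mul0r => /eqP; rewrite eq_sym oner_eq0.
have [S HS] := choice H.
exists (flatten [seq S j | j <- enum 'I_n.+1]); split.
  by by move=> s /flatten_mapP [j _]; have [HS1 _] := HS j; apply: HS1.
move=> p M mM; have [j nMj] := chart_unit mM.
have [_ HS2] := HS j; have [s sS nMs] := HS2 p M mM nMj.
by exists s => //; apply/flatten_mapP; exists j; rewrite // mem_enum.
Qed.

End Sheaf.
End FixR.
End Charts.

(** * Transition functions and sections of I (x) T^m *)

Section Transition.
Variables (k : closedFieldType) (n : nat) (J : {mpoly k[n.+1]} -> Prop) (R : kalg k).
Variable L : invertible J R.
Implicit Types (p q r : chart J R).

Definition tr p q (h : chom p q) (e : frame (L p)) (e' : frame (L q)) : cring q :=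
  coord e' (res h e).

Definition trI p q (h : chom p q) (e : frame (L p)) (e' : frame (L q)) : cring q :=
  coord (fpush h e) e'.

Lemma trK p q (h : chom p q) e e' : tr h e e' * trI h e e' = 1.
Proof. by rewrite /trI -coordZ /tr coordK -fpushE coord_gen. Qed.

Lemma tr_fpush p q (h : chom p q) e : tr h e (fpush h e) = 1.
Proof. by rewrite /tr -fpushE coord_gen. Qed.

Lemma trI_fpush p q (h : chom p q) e : trI h e (fpush h e) = 1.
Proof. by rewrite /trI coord_gen. Qed.

Lemma tr_comp p q r (h : chom p q) (h' : chom q r) (h'' : chom p r) e e' e'' :
  h'' =1 h' \o h -> tr h'' e e'' = h' (tr h e e') * tr h' e' e''.
Proof.
move=> hh; rewrite /tr (res_comp (i := L) hh) /=.
by rewrite -[res h e](coordK e') resZ coordZ coordK.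
Qed.

End Transition.

Section Kap.
Variables (k : closedFieldType) (n : nat) (J : {mpoly k[n.+1]} -> Prop) (R : kalg k).
Variables I T : invertible J R.
Implicit Types (p q r : chart J R).

(** The transition factor of I (x) T^m from the frame e (x) t^m to the frame e' (x) t'^m. *)
Definition kap m p q (h : chom p q) (e : frame (I p)) (t : frame (T p))
    (e' : frame (I q)) (t' : frame (T q)) : cring q :=
  tr h e e' * upow (tr h t t') (trI h t t') m.

Lemma kap_fpush m p q (h : chom p q) e t : kap m h e t (fpush h e) (fpush h t) = 1.
Proof. by rewrite /kap !tr_fpush trI_fpush upow1 mulr1. Qed.

Lemma kap_unit m p q (h : chom p q) e t e' t' : exists u, u * kap m h e t e' t' = 1.
Proof.
exists (trI h e e' * upow (trI h t t') (tr h t t') m).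
by rewrite mulrACA [trI _ _ _ * _]mulrC trK [upow (trI _ _ _) _ _ * _]mulrC upow_unit ?mulr1 ?trK.
Qed.

Lemma kap_comp m p q r (h : chom p q) (h' : chom q r) (h'' : chom p r)
    e t e' t' e'' t'' : h'' =1 h' \o h ->
  kap m h'' e t e'' t'' = h' (kap m h e t e' t') * kap m h' e' t' e'' t''.
Proof.
move=> hh; rewrite /kap (tr_comp (h := h) (h' := h') e e' e'' hh).
rewrite (tr_comp (h := h) (h' := h') t t' t'' hh).
rewrite (_ : trI h'' t t'' = h' (trI h t t') * trI h' t' t''); last first.
  apply: (@uinv_eq _ (tr h'' t t'')); first exact: trK.
  rewrite (tr_comp (h := h) (h' := h') t t' t'' hh) mulrACA trK mulr1.
  by rewrite -rmorphM trK rmorph1.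
by rewrite upowM rmorphM upow_morph; ring.
Qed.

Lemma secP m (s : presec I T) : is_section m s <->
  forall p q (h : chom p q) e t e' t', s q e' t' = h (s p e t) * kap m h e t e' t'.
Proof.
split=> sP p q h e t e' t'.
  by rewrite /kap mulrA; apply: sP; apply: trK.
move=> u' tu; rewrite (sP _ _ h e t) /kap mulrA.
by rewrite (uinv_eq (trK h t t') tu).
Qed.

Lemma sec_push m (s : presec I T) p q (h : chom p q) e t : is_section m s ->
  s q (fpush h e) (fpush h t) = h (s p e t).
Proof. by move=> /secP sP; rewrite (sP _ _ h e t) kap_fpush mulr1. Qed.

Lemma sec_eq0 m (s : presec I T) p q (h : chom p q) e t e' t' : is_section m s ->
  h (s p e t) = 0 <-> s q e' t' = 0.
Proof.
move=> /secP sP; rewrite (sP _ _ h e t); split=> [->|e0]; first by rewrite mul0r.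
have [u uk] := kap_unit m h e t e' t'.
by apply: (unitl_inj uk); rewrite mul0r.
Qed.

Lemma lincomb_section m N (c : 'I_N -> R) (s : 'I_N -> presec I T) :
  (forall j, is_section m (s j)) -> is_section m (lincomb c s).
Proof.
move=> ss; apply/secP => p q h e t e' t'; rewrite /lincomb rmorph_sum mulr_suml.
apply: eq_bigr => j _; rewrite rmorphM cmap_str -mulrA.
by congr (_ * _); have /secP := ss j; apply.
Qed.

Definition scalesec (a : R) (s : presec I T) : presec I T :=
  fun p e t => cstr p a * s p e t.

Lemma scale_section m a (s : presec I T) : is_section m s -> is_section m (scalesec a s).
Proof.
move=> /secP ss; apply/secP => p q h e t e' t'.
by rewrite /scalesec rmorphM cmap_str -mulrA -ss.
Qed.

Definition subsec (s s' : presec I T) : presec I T := fun p e t => s p e t - s' p e t.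

Lemma sub_section m (s s' : presec I T) :
  is_section m s -> is_section m s' -> is_section m (subsec s s').
Proof.
move=> /secP ss /secP ss'; apply/secP => p q h e t e' t'.
by rewrite /subsec rmorphB mulrBl -ss -ss'.
Qed.

Lemma zero_section m : is_section m (zerosec I T).
Proof. by apply/secP => p q h e t e' t'; rewrite /zerosec rmorph0 mul0r. Qed.

Lemma eqsec_section m (s s' : presec I T) : eqsec s s' -> is_section m s -> is_section m s'.
Proof. by move=> ss /secP sP; apply/secP => p q h e t e' t'; rewrite -!ss; apply: sP. Qed.

Lemma sec_loc0 m (s : presec I T) p e t : is_section m s ->
  (forall M : cring p -> Prop, max_ideal M -> exists g, ~ M g /\
     forall q (h : chom p q), is_localization g h -> strict h ->
     exists e' t', s q e' t' = 0) ->
  s p e t = 0.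
Proof.
move=> sP H; apply: ann0 => M mM; have [g [nMg Hg]] := H M mM.
have [q [h [hL sh]]] := loc_chart (max_ideal_nonnil mM nMg).
have [e' [t' /(sec_eq0 h e t e' t' sP)]] := Hg q h hL sh.
case: hL => _ _ /[apply] -[l gl]; exists (g ^+ l) => //.
by move=> /(max_ideal_exp mM).
Qed.

Hypothesis JM : forall f g, J f -> J (f * g).

Lemma framed_cover2 : exists S : seq {mpoly R[n.+1]},
  (forall s, s \in S -> framed I s /\ framed T s) /\
  forall p (M : cring p -> Prop), max_ideal M -> exists2 s, s \in S & ~ M (ev p s).
Proof.
have [S [SI Sc]] := framed_cover JM I; have [S' [ST Sc']] := framed_cover JM T.
exists [seq s * s' | s <- S, s' <- S']; split.
  move=> _ /allpairsP [[s s'] /= [sS sS' ->]]; split.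
    by apply: framed_mul => //; apply: SI.
  by rewrite mulrC; apply: framed_mul => //; apply: ST.
move=> p M mM; have [s sS nMs] := Sc p M mM; have [s' sS' nMs'] := Sc' p M mM.
exists (s * s'); first by apply/allpairsP; exists (s, s').
by rewrite rmorphM; apply: max_ideal_mulN.
Qed.

Lemma univ_at p (M : cring p -> Prop) s : hasX s -> max_ideal M -> ~ M (ev p s) ->
  exists c : chart J R, univ c s /\ forall q (h : chom p q), strict h -> is_localization (ev p s) h ->
    forall c : chart J R, univ c s -> exists h' : chom c q, strict h'.
Proof.
move=> sX mM nMs.
have [|c cs] := univ_exists JM (s := s) sX.
  by apply: (@nonnil_ext _ _ _ _ p); apply: max_ideal_nonnil mM nMs.
exists c; split=> // q h sh hL c' c's; apply: univ_chom c's _.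
by case: hL => -[u us] _ _; exists u; rewrite -(strict_ev s sh).
Qed.

(** Near each of its points a chart receives a morphism from one of the universal charts, and the
    section is pulled back along it. *)
Lemma sec_univ0 m (s : presec I T) (S : seq {mpoly R[n.+1]}) : is_section m s ->
  (forall u, u \in S -> hasX u) ->
  (forall p (M : cring p -> Prop), max_ideal M -> exists2 u, u \in S & ~ M (ev p u)) ->
  (forall u, u \in S -> (exists c : chart J R, univ c u) ->
     exists c e t, univ (R := R) c u /\ s c e t = 0) ->
  eqsec s (zerosec I T).
Proof.
move=> sP SX Sc S0 p e t; apply: (sec_loc0 e t sP) => M mM.
have [u uS nMu] := Sc p M mM; exists (ev p u); split=> // q h hL sh.
have [c0 [c0u Hc]] := univ_at (SX u uS) mM nMu.
have [c [ec [tc [cu s0]]]] := S0 u uS (ex_intro _ c0 c0u).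
have [h' _] := Hc q h sh hL c cu.
by exists (fpush h' ec), (fpush h' tc); rewrite (sec_push _ _ _ sP) s0 rmorph0.
Qed.

(** On each universal chart of a finite cover some power of [f] kills the section; the largest
    exponent works on all charts. *)
Lemma sec_torsion m (s : presec I T) (f : R) : is_section m s ->
  (forall q, (exists u, u * cstr q f = 1) -> forall e t, s q e t = 0) ->
  exists N, eqsec (scalesec (f ^+ N) s) (zerosec I T).
Proof.
move=> sP sf; have [S [SF Sc]] := framed_cover2.
have H u : exists N, u \in S -> (exists c : chart J R, univ c u) ->
     exists c e t, univ c u /\ cstr c f ^+ N * s c e t = 0.
  case: (boolP (u \in S)) => [uS|]; last by exists 0%N.
  case: (EM (exists c : chart J R, univ c u)) => [[c cu]|nc]; last by exists 0%N.
  have [[_ /(_ c cu) [e]] [_ /(_ c cu) [t]]] := SF u uS.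
  suff [N sN] : exists N, cstr c f ^+ N * s c e t = 0.
    by exists N => _ _; exists c, e, t.
  case: (EM (forall N, cstr c f ^+ N <> 0)) => [nn|]; last first.
    by rewrite -existsNE => -[N /contrapT fN]; exists N; rewrite fN mul0r.
  have [q [h [hL _]]] := loc_chart nn.
  have : h (s c e t) = 0.
    rewrite -(sec_push _ _ _ sP); apply: sf.
    by case: hL => -[v vf] _ _; exists v; rewrite -(cmap_str h).
  by case: hL => _ _ /[apply].
have [N HN] := choice H.
exists (\max_(u <- S) N u)%N.
apply: (sec_univ0 (S := S) (scale_section _ sP)) => //.
  by move=> u /SF [[]].
move=> u uS cu; have [c [e [t [cu' s0]]]] := HN u uS cu.
exists c, e, t; split=> //; rewrite /scalesec rmorphXn.
have uN : (N u <= \max_(u <- S) N u)%N by apply: leq_bigmax_seq.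
by rewrite -(subnK uN) exprD -mulrA s0 mulr0.
Qed.

End Kap.

(** * Sections that vanish on two closed subschemes with union V(J) *)

Section JointlyInjective.
Variables (k : closedFieldType) (n : nat) (J J1 J2 : {mpoly k[n.+1]} -> Prop).
Hypotheses (sJ1 : forall f, J f -> J1 f) (sJ2 : forall f, J f -> J2 f).
Hypothesis JI : forall f, J1 f -> J2 f -> J f.
Hypotheses (spJ1 : subspace J1) (spJ2 : subspace J2).
Hypotheses (JM : forall f g, J f -> J (f * g)) (JM1 : forall f g, J1 f -> J1 (f * g))
  (JM2 : forall f g, J2 f -> J2 (f * g)).
Variables (R : kalg k) (I T : invertible J R) (m : int) (s : presec I T).
Hypothesis sP : is_section m s.

Arguments s : clear implicits.

(** The numerator [b] of the section on a cone chart is tested on the cone over J'. If [u] is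
    nilpotent modulo J' there is no such chart, but a power of [u] is then already in the extended
    ideal. *)
Lemma sec_incl_num (J' : {mpoly k[n.+1]} -> Prop) (sJ' : forall f, J f -> J' f)
    (JM' : forall f g, J' f -> J' (f * g))
    (c : chart J R) u e t b l : univ c u -> hasX u -> s c e t * ev c u ^+ l = ev c b ->
  (forall p e t, s (incl sJ' p) e t = 0) -> exists N, ideal_ext (kstr R) J' (u ^+ N * b).
Proof.
move=> cu uX sb s0.
case: (EM (forall N, ~ ideal_ext (kstr R) J' (u ^+ N))) => [nn|]; last first.
  by rewrite -existsNE => -[N /contrapT uN]; exists N; apply: ext_idealM.
have [c1 c1u] := univ_exists JM' uX nn.
have c1u' : is_locq (ideal_ext (kstr R) J') u (ev (incl sJ' c1)) := c1u.
have [|h sh] := univ_chom (q := incl sJ' c1) cu.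
  by case: c1u' => -[v vu] _ _; exists v.
have := s0 c1 (fpush h e) (fpush h t); rewrite (sec_push _ _ _ sP) => se0.
case: c1u' => _ _ /(_ b) [+ _]; apply.
by rewrite -(strict_ev b sh) -sb rmorphM se0 mul0r.
Qed.

(** Up to a power of [u] the numerator lies in the extensions of both J1 and J2, hence by
    [ext_inter] in the extension of their intersection, on which every chart vanishes. *)
Lemma sec_incl0 : (forall p e t, s (incl sJ1 p) e t = 0) ->
  (forall p e t, s (incl sJ2 p) e t = 0) -> eqsec s (zerosec I T).
Proof.
move=> s1 s2; have [S [SF Sc]] := framed_cover2 I T JM.
apply: (sec_univ0 JM (S := S) sP) => //; first by move=> u /SF [[]].
move=> u uS [c cu]; have [[uX /(_ c cu) [e]] [_ /(_ c cu) [t]]] := SF u uS.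
exists c, e, t; split=> //.
have [[v vu] frac _] := cu; have [b [l sb]] := frac (s c e t).
have [N1 b1] := sec_incl_num JM1 cu uX sb s1.
have [N2 b2] := sec_incl_num JM2 cu uX sb s2.
have bJ : ideal_ext (kstr R) J (u ^+ (N1 + N2) * b).
  apply: (@ext_sub _ _ _ _ (fun f => J1 f /\ J2 f)); first by move=> f []; apply: JI.
  apply: ext_inter => //.
    have [_ _ M1] := ext_is_ideal (kstr R) JM1.
    by rewrite addnC exprD -mulrA; apply: M1.
  have [_ _ M2] := ext_is_ideal (kstr R) JM2.
  by rewrite exprD -mulrA; apply: M2.
apply: (unitl_inj (unitlX l vu)); rewrite mul0r sb.
apply: (unitl_inj (unitlX (N1 + N2) vu)).
by rewrite mul0r -rmorphXn -rmorphM mulrC (ev_ext c bJ).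
Qed.

End JointlyInjective.

(** * The equation of a point *)

(* D is the section cutting out the point P: the canonical section of O(P),
   for epsilon = 1 and T = O(P), and for epsilon = -1 and T = O(-P). *)
Definition divisor (k : closedFieldType) (n : nat) (J : {mpoly k[n.+1]} -> Prop)
    (T : invertible J (kself k)) (P : 'rV[kself k]_n.+1) (epsilon : int)
    (D : forall p : chart J (kself k), frame (T p) -> cring p) : Prop :=
  (forall p q (h : chom p q) t t',
     D q t' = h (D p t) * upow (tr h t t') (trI h t t') epsilon) /\
  (forall p t, D p t = 0 <-> factors_through P p).

Section Divisor.
Variables (k : closedFieldType) (n : nat) (J : {mpoly k[n.+1]} -> Prop).
Hypotheses (prJ : proj_prime J) (dimJ : dimension1 J).

Let JM : forall f g, J f -> J (f * g). Proof. by case: prJ => -[_ _ JM _] _ _ _ f g; rewrite mulrC; apply: JM. Qed.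
Let JD : forall f g, J f -> J g -> J (f + g). Proof. by case: prJ => -[_ JD _ _] _ _ _; apply: JD. Qed.
Let J0 : J 0. Proof. by case: prJ => -[J0 _ _ _] _ _ _. Qed.
Let Jpr : forall f g, J (f * g) -> J f \/ J g. Proof. by case: prJ. Qed.

Lemma proj_prime_subspace (J' : {mpoly k[n.+1]} -> Prop) : proj_prime J' -> subspace J'.
Proof.
move=> [[J'0 J'D J'M _] _ _ _]; split=> // c f J'f.
by rewrite -mul_mpolyC; apply: J'M.
Qed.

Lemma proj_primeX (J' : {mpoly k[n.+1]} -> Prop) f m : proj_prime J' -> J' (f ^+ m) -> J' f.
Proof.
move=> [_ J'1 J'pr _]; elim: m => [|m IHm]; first by rewrite expr0.
by rewrite exprS => /J'pr [].
Qed.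

Lemma ext_kself F : ideal_ext (kstr (kself k)) J F -> J F.
Proof.
move=> [m [c [f [Jf ->]]]]; elim/big_ind: _ => // i _.
have [_ _ JZ] := proj_prime_subspace prJ.
by apply: JZ; rewrite map_mpolyK.
Qed.

(** The hypothesis places V(J) inside the single point with coordinates [b], so modulo J a form is
    determined by its value there. *)
Lemma homog_mod_point (b : 'I_n.+1 -> k) j d (g : {mpoly k[n.+1]}) :
  (forall i, J ('X_i - b i *: 'X_j)) -> g \is d.-homog ->
  J (g - g.@[b] *: 'X_j ^+ d).
Proof.
move=> Jb /dhomogP hg.
have idJ : is_ideal J by split=> // f f' Jf'; rewrite mulrC; apply: JM.
have [|Q [pi [_ piJ]]] := quotient_exists idJ; first by case: prJ.
have piX i : pi 'X_i = pi (b i)%:MP * pi 'X_j.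
  by apply/eqP; rewrite -rmorphM mul_mpolyC -subr_eq0 -rmorphB; apply/eqP/piJ.
apply/piJ; rewrite rmorphB -mul_mpolyC rmorphM rmorphXn; apply/eqP; rewrite subr_eq0.
apply/eqP; rewrite {1}[g]mpolyE rmorph_sum /= mevalE [X in pi X]rmorph_sum rmorph_sum.
rewrite mulr_suml big_seq [RHS]big_seq; apply: eq_bigr => m mg.
rewrite -mul_mpolyC !rmorphM /= -mulrA; congr (_ * _).
have <- : mdeg m = d := hg m mg.
rewrite mpolyXE_id !rmorph_prod mdegE -prodrXr -big_split /=.
by apply: eq_bigr => i _; rewrite !rmorphXn piX exprMn.
Qed.

Section FixT.
Variables (T : invertible J (kself k)) (P : 'rV[kself k]_n.+1) (epsilon : int).
Variable D : forall p : chart J (kself k), frame (T p) -> cring p.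
Hypotheses (PJ : on_proj J P) (divD : divisor P epsilon D).

(** Otherwise all x_i - b_i x_j would lie in J. A homogeneous prime q strictly above J contains a
    form outside J, which modulo J is a nonzero multiple of a power of x_j; so q would contain all
    the coordinates, although V(J) has dimension 1. *)
Lemma univ_not_point (c : chart J (kself k)) s : univ c s -> ~ factors_through P c.
Proof.
move=> cs [u [u' [uu cv]]].
have ns : ~ J s.
  move=> Js; case: (@univ_nonnil _ _ _ _ c s 1 cs); rewrite expr1.
  by rewrite -[s]map_mpolyK; apply: ext_map.
have [[w w1] _] := PJ.
have [j Pj] : exists j, P 0 j != 0.
  apply: contrapT; rewrite -forallNE => P0.
  move: w1; rewrite big1 => [|i _].
    by move=> /eqP; rewrite eq_sym oner_eq0.
  by move/negP: (P0 i); rewrite negbK => /eqP ->; rewrite mulr0.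
pose b i : k := (P 0 i : k) / (P 0 j : k).
have Jb i : J ('X_i - b i *: 'X_j).
  suff : ev c ('X_i - b i *: 'X_j) = 0.
    have [_ _ ker] := cs; move=> /ker [m /ext_kself /Jpr [|//]].
    by move=> /(proj_primeX prJ).
  rewrite rmorphB -mul_mpolyC rmorphM evC !evX cv !mxE.
  have -> : P 0 i = (b i : kself k) * P 0 j by rewrite /b divfK.
  by rewrite rmorphM mulrCA subrr.
have [[q [prq sJq [f qf nJf]]] _] := dimJ.
have [[q0 qD qM qH] q1 qpr [i0 qX]] := prq.
have idq : is_ideal q by [].
have [d nJd] : exists d, ~ J (pihomog mdeg d f).
  apply: contrapT; rewrite -forallNE => Jd; apply: nJf.
  rewrite (pihomog_partitionE (leqnn (mmeasure mdeg f))).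
  by elim/big_ind: _ => // d _; apply: contrapT; apply: Jd.
set g := pihomog mdeg d f in nJd.
have Jg : J (g - g.@[b] *: 'X_j ^+ d).
  by apply: homog_mod_point => //; apply: pihomogP.
have qXj : q 'X_j.
  apply: (@proj_primeX q _ d prq).
  have gb : g.@[b] != 0.
    by apply: contra_notN nJd => /eqP g0; move: Jg; rewrite g0 scale0r subr0.
  rewrite (_ : 'X_j ^+ d = (g.@[b])^-1 *: (g - (g - g.@[b] *: 'X_j ^+ d))); last first.
    by rewrite opprB addrC subrK scalerA mulVf // scale1r.
  have [_ _ qZ] := proj_prime_subspace prq.
  apply/qZ/qD; first exact: qH.
  exact/(ideal_opp idq)/sJq.
apply: qX; rewrite (_ : 'X_i0 = ('X_i0 - b i0 *: 'X_j) + b i0 *: 'X_j); last first.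
  by rewrite subrK.
apply: qD; first exact/sJq/Jb.
by have [_ _ qZ] := proj_prime_subspace prq; apply: qZ.
Qed.

Lemma divisor_push p q (h : chom p q) (t : frame (T p)) : D (fpush h t) = h (D t).
Proof.
by have [DS _] := divD; rewrite (DS _ _ h t) tr_fpush trI_fpush upow1 mulr1.
Qed.

Lemma divisor_change q (t t' : frame (T q)) (y : cring q) : D t * y = 0 -> D t' * y = 0.
Proof.
have [DS _] := divD; rewrite (DS _ _ (idchom q) t t') /= => Dy.
by rewrite mulrAC Dy mul0r.
Qed.

(** Near a point the equation of P is a fraction with numerator [G]. Here [G] is not in J, since
    otherwise the universal chart over k would factor through P; so [ext_nzd] cancels it. *)
Lemma divisor_nzd (R : kalg k) (c : chart J R) s (t : frame (T (cconst c))) x :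
  univ c s -> D t * x = 0 -> x = 0.
Proof.
move=> cs Dx; have [S [SF Sc]] := framed_cover JM T.
have c1 : ~ (fun a : cring c => a = 0) 1 by apply/eqP/oner_neq0.
(* One maximal ideal is enough: the factor s' ^ m G found near it is a polynomial over k outside J,
   hence a nonzerodivisor on the whole cone. *)
have [M mM _] := exists_max_ideal (ideal_eq0 (cring c)) c1.
have [s' s'S nMs] := Sc (cconst c) M mM.
have [sX sF] := SF s' s'S.
have [c' [c's' Hc]] := univ_at JM (p := cconst c) sX mM nMs.
have [q [h [hL sh]]] := @loc_chart _ _ _ _ (cconst c) (ev (cconst c) s') (max_ideal_nonnil mM nMs).
have [h' sh'] := Hc q h sh hL c' c's'.
have [t'] := sF c' c's'.
have DD : h' (D t') * h x = 0.
  rewrite -divisor_push; apply: (divisor_change (t := fpush h t)).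
  by rewrite divisor_push -rmorphM Dx rmorph0.
have [[u us'] frac' _] := c's'; have [G [l DG]] := frac' (D t').
have ns' : ~ J s'.
  move=> Js; case: (@univ_nonnil _ _ _ _ c' s' 1 c's'); rewrite expr1.
  by rewrite -[s']map_mpolyK; apply: ext_map.
have nG : ~ J G.
  move=> JG; have /(ev_ext c') : ideal_ext (kstr (kself k)) J G.
    by rewrite -[G]map_mpolyK; apply: ext_map.
  rewrite -DG => D'0; have /(proj2 divD) : D t' = 0.
    by apply: (unitl_inj (unitlX l us')); rewrite D'0 mul0r.
  exact: univ_not_point c's'.
have : h (ev (cconst c) G * x) = 0.
  rewrite rmorphM strict_ev // -(strict_ev G sh') -DG rmorphM rmorphXn.
  by rewrite mulrAC DD mul0r.
have [_ _ /[apply] -[m e]] := hL.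
have [[v vs] frac ker] := cs; have [b [l' xb]] := frac x.
have e' : ev c (map_mpoly (kstr R) (s' ^+ m * G) * b) = 0.
  rewrite rmorphM -xb -[ev c (map_mpoly _ _)]/(ev c (map_mpoly (kstr R) (s' ^+ m * G : {mpoly k[n.+1]}))).
  rewrite ev_map -[X in X * _]/(ev (cconst c) (s' ^+ m * G)) rmorphM rmorphXn.
  by rewrite mulrA -[X in X * _]mulrA e mul0r.
have nGs : ~ J (s' ^+ m * G) by move=> /Jpr [/(proj_primeX prJ)|].
have /ker [m' e2] := e'.
have : ideal_ext (kstr R) J (s ^+ m' * b).
  by apply: (ext_nzd (proj_prime_subspace prJ) JM Jpr nGs); rewrite mulrCA.
move=> e3; have /ker e4 : exists m, ideal_ext (kstr R) J (s ^+ m * b) by exists m'.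
by apply: (unitl_inj (unitlX l' vs)); rewrite mul0r xb.
Qed.

End FixT.
End Divisor.

(** * Gluing *)

Section Glue.
Variables (k : closedFieldType) (n : nat) (J : {mpoly k[n.+1]} -> Prop) (R : kalg k).
Variables (I T : invertible J R) (m : int).
(** [G p e t a] reads: the section to be constructed has coordinate [a] there. It is a partial
    function, defined near every point. *)
Variable G : forall p : chart J R, frame (I p) -> frame (T p) -> cring p -> Prop.
Arguments G : clear implicits.
Hypothesis G_push : forall p q (h : chom p q) e t e' t' a,
  G p e t a -> G q e' t' (h a * kap m h e t e' t').
Hypothesis G_fun : forall p e t a a', G p e t a -> G p e t a' -> a = a'.
Hypothesis G_loc : forall p (M : cring p -> Prop), max_ideal M -> exists g, ~ M g /\
  forall q (h : chom p q), is_localization g h -> strict h -> exists e t a, G q e t a.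

Lemma kap_id (p : chart J R) (e : frame (I p)) (t : frame (T p)) :
  kap m (idchom p) e t e t = 1.
Proof.
have tr1 (L : invertible J R) (f : frame (L p)) : tr (idchom p) f f = 1.
  by rewrite /tr (@res_id _ _ J R L _ (idchom p)) // coord_gen.
rewrite /kap !tr1 mul1r.
have -> : trI (idchom p) t t = 1.
  by apply: (uinv_eq (trK _ t t)); rewrite tr1 mul1r.
by rewrite upow1.
Qed.

Section FixP.
Variables (p : chart J R) (e : frame (I p)) (t : frame (T p)).

Let good b := forall q (h : chom p q) e' t' a,
  G q e' t' a -> a = h b * kap m h e t e' t'.

Lemma glue_uniq b b' : good b -> good b' -> b = b'.
Proof.
move=> gb gb'; apply/eqP; rewrite -subr_eq0; apply/eqP; apply: ann0 => M mM.
have [g [nMg Hg]] := G_loc mM.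
have [q [h [hL sh]]] := loc_chart (max_ideal_nonnil mM nMg).
have [e' [t' [a Ga]]] := Hg q h hL sh.
have [u uk] := kap_unit m h e t e' t'.
have /eqP : h b = h b' by apply: (unitl_inj uk); rewrite -(gb _ _ _ _ _ Ga) -(gb' _ _ _ _ _ Ga).
rewrite -subr_eq0 -rmorphB => /eqP.
case: hL => _ _ /[apply] -[l gl]; exists (g ^+ l) => //.
by move=> /(max_ideal_exp mM).
Qed.

(** Where [f] is invertible, the section has coordinate a / f ^ l with respect to [e] and [t]. *)
Let has_value f a l := forall q (h : chom p q), (exists u, u * h f = 1) ->
  (exists e' t' b, G q e' t' b) /\
  forall e' t' b, G q e' t' b -> h a * kap m h e t e' t' = b * h f ^+ l.

Lemma glue_local_value (M : cring p -> Prop) : max_ideal M ->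
  exists2 f, exists a l, has_value f a l & ~ M f.
Proof.
move=> mM; have [f [nMf Hf]] := G_loc mM; exists f => //.
have [q0 [h0 [hL sh]]] := loc_chart (max_ideal_nonnil mM nMf).
have [e0 [t0 [b0 Gb0]]] := Hf q0 h0 hL sh.
have /(G_push (idchom q0) (fpush h0 e) (fpush h0 t)) := Gb0.
set b1 := _ * _ => Gb1.
have [_ /(_ b1) [a [l al]] _] := hL.
exists a, l => q h hf; have [g gh _] := loc_chom hL hf.
have Gg e' t' := G_push g e' t' Gb1.
split; first by exists (fpush h e), (fpush h t); eexists; apply: Gg.
move=> e' t' b Gb; rewrite (G_fun Gb (Gg e' t')).
rewrite (@kap_comp _ _ _ _ _ _ m _ _ _ h0 g h e t (fpush h0 e) (fpush h0 t)); last first.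
  by move=> x; rewrite /= gh.
rewrite kap_fpush rmorph1 mul1r -(gh a) -al -(gh f) rmorphM rmorphXn.
by rewrite mulrAC.
Qed.

Lemma has_value_widen f a l N : has_value f a l -> has_value f (a * f ^+ N) (l + N).
Proof.
move=> H q h hf; have [ex Hb] := H q h hf; split=> // e' t' b /Hb e1.
by rewrite rmorphM rmorphXn mulrAC e1 exprD mulrA.
Qed.

(** The sheaf property on the spectrum of the chart ring: the local values are brought to a common
    exponent, the torsion on overlaps is absorbed into a higher power of the [f i], and a partition
    of unity patches them. *)
Lemma glue_ex : exists b, good b.
Proof.
have [N [f [Hf gf]]] := max_ideal_finite glue_local_value.
have [a Ha] := choice Hf; have [l Hl] := choice Ha.
pose l0 := (\max_i l i)%N; pose a1 i := a i * f i ^+ (l0 - l i).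
have H1 i : has_value (f i) (a1 i) l0.
  have il : (l i <= l0)%N by apply: leq_bigmax.
  by have := has_value_widen (l0 - l i) (Hl i); rewrite subnKC.
(* On the overlap the values agree up to a power of f_i f_j. If this product is nilpotent the
   overlap is empty, and one of its powers is zero. *)
have ov ij : exists N, (f ij.1 * f ij.2) ^+ N *
    (a1 ij.1 * f ij.2 ^+ l0 - a1 ij.2 * f ij.1 ^+ l0) = 0.
  case: ij => i j /=.
  case: (EM (forall N, (f i * f j) ^+ N <> 0)) => [nn|]; last first.
    by rewrite -existsNE => -[M /contrapT e0]; exists M; rewrite e0 mul0r.
  have [q [h [hL sh]]] := loc_chart nn.
  have [[u uf] _ ker] := hL; apply: ker.
  have ui : exists u, u * h (f i) = 1.
    by exists (u * h (f j)); rewrite -mulrA -rmorphM [f j * _]mulrC.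
  have uj : exists u, u * h (f j) = 1 by exists (u * h (f i)); rewrite -mulrA -rmorphM.
  have [[e' [t' [b Gb]]] Hi] := H1 i q h ui; have [_ Hj] := H1 j q h uj.
  have [v vk] := kap_unit m h e t e' t'; apply: (unitl_inj vk).
  rewrite mul0r rmorphB (rmorphM h (a1 i)) (rmorphM h (a1 j)) mulrBl.
  rewrite [X in X - _]mulrAC (Hi _ _ _ Gb) [X in _ - X]mulrAC (Hj _ _ _ Gb).
  by rewrite !rmorphXn mulrAC subrr.
have [n0 Hn] := choice ov; pose n1 := (\max_ij n0 ij)%N.
pose a2 i := a1 i * f i ^+ n1.
have H2 i : has_value (f i) (a2 i) (l0 + n1) by apply: has_value_widen.
have ov2 i j : a2 i * f j ^+ (l0 + n1) = a2 j * f i ^+ (l0 + n1).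
  apply/eqP; rewrite -subr_eq0; apply/eqP.
  have ijn : (n0 (i, j) <= n1)%N by apply: (leq_bigmax (i, j)).
  have := congr1 (fun x => (f i * f j) ^+ (n1 - n0 (i, j)) * x) (Hn (i, j)).
  rewrite /= mulr0 mulrA -exprD subnK // => <-.
  by rewrite /a2 exprMn !exprD; ring.
have [z z1] := unit_ideal_exp (l0 + n1) gf.
pose b := \sum_j z j * a2 j.
have fb i : f i ^+ (l0 + n1) * b = a2 i.
  rewrite mulr_sumr -[RHS]mulr1 -z1 mulr_sumr; apply: eq_bigr => j _.
  by rewrite mulrCA [_ * a2 j]mulrC -ov2; ring.
exists b => q h e' t' c Gc; apply/eqP; rewrite -subr_eq0; apply/eqP.
apply: ann0 => M mM; have [i nMi] := max_ideal_preim h gf mM.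
have [q' [h' [hL sh]]] := loc_chart (max_ideal_nonnil mM nMi).
have Gc' := G_push h' (fpush h' e') (fpush h' t') Gc.
have [[u uf] _ ker] := hL.
have [|_ Hi] := H2 i q' (chcomp h h'); first by exists u.
have := Hi _ _ _ Gc'.
rewrite (@kap_comp _ _ _ _ _ _ m _ _ _ h h' _ e t e' t') //.
rewrite kap_fpush !mulr1 -fb /= => e1.
have : h' (c - h b * kap m h e t e' t') = 0.
  apply: (unitl_inj (unitlX (l0 + n1) uf)); rewrite mul0r rmorphB mulrBl -e1.
  by rewrite !rmorphM !rmorphXn; ring.
move=> /ker [d e2]; exists (h (f i) ^+ d) => //.
by move=> /(max_ideal_exp mM).
Qed.

End FixP.

Lemma glue : exists s : presec I T, is_section m s /\
  forall p e t a, G p e t a -> s p e t = a.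
Proof.
pose s : presec I T := fun p e t => projT1 (cid (glue_ex e t)).
have sP p e t : forall q (h : chom p q) e' t' a,
  G q e' t' a -> a = h (s p e t) * kap m h e t e' t' := projT2 (cid (glue_ex e t)).
exists s; split=> [|p e t a Ga]; last first.
  by rewrite (sP _ e t _ (idchom p) _ _ _ Ga) kap_id mulr1.
apply/secP => p q h e t e' t'; apply: (glue_uniq (sP q e' t')).
move=> r h' e'' t'' a Ga.
rewrite (sP _ e t _ (chcomp h h') _ _ _ Ga).
by rewrite (@kap_comp _ _ _ _ _ _ m _ _ _ h h' _ e t e' t') // rmorphM mulrA.
Qed.

End Glue.

(** * Rescaling of homogeneous coordinates *)

Section Scaled.
Variables (k : closedFieldType) (n : nat) (J : {mpoly k[n.+1]} -> Prop) (R : kalg k).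
Hypothesis homJ : homogeneous_ideal J.

Lemma homog_ideal_scale (A : kalg k) (v : 'rV[A]_n.+1) (a : A) f :
  (forall f, J f -> (map_mpoly (kstr A) f).@[fun i => v 0 i] = 0) -> J f ->
  (map_mpoly (kstr A) f).@[fun i => (a *: v) 0 i] = 0.
Proof.
have [_ _ _ JH] := homJ => Jv Jf.
pose phi : {rmorphism {mpoly k[n.+1]} -> A} :=
  meval (fun i => (a *: v) 0 i) \o map_mpoly (kstr A).
rewrite -[LHS]/(phi f) (pihomog_partitionE (leqnn (mmeasure mdeg f))).
rewrite (rmorph_sum phi) big1 // => d _; rewrite {}/phi /=.
have := Jv _ (JH f d Jf); have /dhomogP := pihomogP mdeg d f.
set g := pihomog _ _ _ => hg gv.
rewrite -[RHS](mulr0 (a ^+ d)) -gv !mevalE mulr_sumr.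
rewrite big_seq [RHS]big_seq; apply: eq_bigr => m mg.
rewrite mulrCA; congr (_ * _).
case: (boolP (m \in msupp g)) => [mg'|]; last first.
  move=> mg'; have : (map_mpoly (kstr A) g)@_m = 0.
    by rewrite mcoeff_map_mpoly (memN_msupp_eq0 mg') raddf0.
  by move=> /eqP; rewrite mcoeff_eq0 mg.
have <- : mdeg m = d := hg m mg'.
rewrite mdegE -prodrXr -big_split /=.
by apply: eq_bigr => i _; rewrite mxE exprMn.
Qed.

Section Scale.
Variables (q : chart J R) (a a' : cring q).
Hypothesis aa : a * a' = 1.

Lemma scalec_on_proj : on_proj J (a *: cvec (ckc q)).
Proof.
have [[w w1] vJ] := con (ckc q); split; last by move=> f Jf; apply: homog_ideal_scale.
exists (a' *: w); rewrite -w1; apply: eq_bigr => i _.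
by rewrite !mxE mulrACA [a' * a]mulrC aa mul1r.
Qed.

Definition scalec : chart J R := @Chart _ _ J R (KChart scalec_on_proj) (cstr q).

Lemma scaleh_vec : same_point (map_mx idfun (cvec (ckc scalec))) (cvec (ckc q)).
Proof.
exists a', a; rewrite mulrC aa map_mx_id //; split=> //.
by rewrite scalerA mulrC aa scale1r.
Qed.

Definition scaleh : chom scalec q :=
  @CHom _ _ J R scalec q (@KHom _ (cring q) (cring q) idfun (fun=> erefl))
    (fun=> erefl) scaleh_vec.

End Scale.

Lemma univ_chom_scaled (c : chart J R) s (q : chart J R) (a a' : cring q) (aa : a * a' = 1) :
  univ c s -> (exists u, u * ev (scalec aa) s = 1) ->
  exists h : chom c q, forall i, h (cvec (ckc c) 0 i) = a * cvec (ckc q) 0 i.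
Proof.
move=> cs us; have [h sh] := univ_chom cs us.
by exists (chcomp h (scaleh aa)) => i; rewrite /= sh mxE.
Qed.

Lemma univ_hom_eq (c : chart J R) s (B : comNzRingType) (f g : {rmorphism cring c -> B}) : univ c s ->
  (forall a : R, f (cstr c a) = g (cstr c a)) ->
  (forall i, f (cvec (ckc c) 0 i) = g (cvec (ckc c) 0 i)) -> f =1 g.
Proof.
move=> cs fgR fgX; apply: (locq_hom_eq cs) => b.
have := @rmorph_mpoly_eq _ _ R _ (f \o ev c) (g \o ev c).
apply=> [a|i].
  exact: etrans (congr1 f (evC c a)) (etrans (fgR a) (esym (congr1 g (evC c a)))).
exact: etrans (congr1 f (evX c i)) (etrans (fgX i) (esym (congr1 g (evX c i)))).
Qed.

(* Two charts mapping from the cone over p to c1 and c2, with different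
   normalizations of the coordinates, are compared on a third one, defined
   over the coordinate ring of p, to make room for the scaling factors. *)
Lemma univ_join (p c1 c2 : chart J R) s1 s2 (h1 : chom c1 p) (h2 : chom c2 p) :
  hasX s1 -> univ c1 s1 -> univ c2 s2 ->
  exists (c : chart J (cring p)) s (g1 : chom c1 (cbase (cstr p) c))
    (g2 : chom c2 (cbase (cstr p) c)) (g : chom (cbase (cstr p) c) p),
  [/\ univ c s, h1 =1 g \o g1 & h2 =1 g \o g2].
Proof.
move=> s1X c1s c2s.
have [u1 [u1' [uu1 e1]]] := cmap_vec h1; have [u2 [u2' [uu2 e2]]] := cmap_vec h2.
have uu1' : u1' * u1 = 1 by rewrite mulrC.
have uu2' : u2' * u2 = 1 by rewrite mulrC.
have hx (ci : chart J R) (hi : chom ci p) u u' : u' * u = 1 -> cvec (ckc p) = u *: map_mx hi (cvec (ckc ci)) ->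
    forall i, hi (cvec (ckc ci) 0 i) = u' * cvec (ckc p) 0 i.
  by move=> uu -> i; rewrite !mxE mulrA uu mul1r.
pose A := cring p.
have [theta [thetaC thetaX]] : exists theta : A -> {rmorphism {mpoly R[n.+1]} -> {mpoly A[n.+1]}},
    (forall u a, theta u a%:MP = (cstr p a)%:MP) /\ forall u i, theta u 'X_i = u *: 'X_i.
  exists (fun u => meval (fun i => u *: 'X_i) \o map_mpoly (@mpolyC n.+1 A \o cstr p)).
  split=> [u a|u i]; first by rewrite /= map_mpolyC mevalC.
  by rewrite /= map_mpolyX mevalXU.
have evtheta (q : chart J A) u (w w' : cring (cbase (cstr p) q)) (ww : w * w' = 1) :
    w = cstr q u -> forall F, ev (scalec ww) F = ev q (theta u F).
  move=> wu; have := @rmorph_mpoly_eq _ _ R (cring q) (ev (scalec ww)) (ev q \o theta u).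
  apply=> [a|i].
    by rewrite -[RHS]/(ev q (theta u a%:MP)) thetaC [RHS]evC; exact: (evC (scalec ww) a).
  rewrite -[RHS]/(ev q (theta u 'X_i)) thetaX -mul_mpolyC [RHS]rmorphM evC [X in _ * X]evX -wu.
  by apply: (etrans (evX (scalec ww) i)); rewrite mxE.
(* Where this [s] is invertible, [s1] and [s2] are both invertible after the coordinates have been
   scaled by u1' and u2' respectively. *)
have [s sE] : exists s, s = theta u1' s1 * theta u2' s2 by exists (theta u1' s1 * theta u2' s2).
pose p' : chart J A := @Chart _ _ J A (ckc p) (@KHom _ A A idfun (fun=> erefl)).
have evp' (ci : chart J R) (hi : chom ci p) u u' : u' * u = 1 -> cvec (ckc p) = u *: map_mx hi (cvec (ckc ci)) ->
    forall F, ev p' (theta u' F) = hi (ev ci F).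
  move=> uu ei; apply: (@rmorph_mpoly_eq _ _ R _ (ev p' \o theta u') (hi \o ev ci)) => [a|i].
    by rewrite -[LHS]/(ev p' (theta u' a%:MP)) thetaC -[RHS]/(hi (ev ci a%:MP)) !evC cmap_str.
  rewrite -[LHS]/(ev p' (theta u' 'X_i)) thetaX -mul_mpolyC rmorphM evC evX.
  by rewrite -[RHS]/(hi (ev ci 'X_i)) evX (hx _ _ _ _ uu ei).
have [[v1 vs1] _ _] := c1s; have [[v2 vs2] _ _] := c2s.
have p's : (h1 v1 * h2 v2) * ev p' s = 1.
  rewrite sE rmorphM (evp' _ _ _ _ uu1' e1) (evp' _ _ _ _ uu2' e2) mulrACA -!rmorphM.
  by rewrite vs1 vs2 !rmorph1 mulr1.
have JM f g : J f -> J (f * g).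
  by case: homJ => _ _ JM _ Jf; rewrite mulrC; apply: JM.
have [|c cs] := univ_exists JM (R := A) (s := s) _ (@nonnil_ext _ _ _ _ p' s (unit_nonnil p's)).
  have [i [s' es]] := s1X; exists i, (u1'%:MP * theta u1' s' * theta u2' s2).
  by rewrite sE es rmorphM thetaX -mul_mpolyC !mulrA [_%:MP * 'X_i]mulrC.
have [[v vs] _ _] := cs.
have c_u1 : exists u, u * ev c (theta u1' s1) = 1.
  by exists (v * ev c (theta u2' s2)); rewrite -mulrA -rmorphM [theta u2' _ * _]mulrC -sE.
have c_u2 : exists u, u * ev c (theta u2' s2) = 1.
  by exists (v * ev c (theta u1' s1)); rewrite -mulrA -rmorphM -sE.
have w1 : (cstr c u1' : cring (cbase (cstr p) c)) * cstr c u1 = 1.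
  by rewrite -rmorphM uu1' rmorph1.
have w2 : (cstr c u2' : cring (cbase (cstr p) c)) * cstr c u2 = 1.
  by rewrite -rmorphM uu2' rmorph1.
have [|g1 g1x] := univ_chom_scaled (aa := w1) c1s.
  by have [w ww] := c_u1; exists w; rewrite (evtheta c u1').
have [|g2 g2x] := univ_chom_scaled (aa := w2) c2s.
  by have [w ww] := c_u2; exists w; rewrite (evtheta c u2').
have [|g' sg'] := univ_chom (q := p') cs; first by exists (h1 v1 * h2 v2).
have gs a : g' (cstr (cbase (cstr p) c) a) = cstr p a by rewrite /= (cmap_str g').
have [|g gg'] := @mk_chom _ _ J R (cbase (cstr p) c) p (kmap g') gs.
  exact: cmap_vec g'.
exists c, s, g1, g2, g; split=> //.
  apply: (@univ_hom_eq c1 s1 _ (kmap h1) (kmap g \o kmap g1) c1s) => [a|i] /=.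
    by rewrite !cmap_str.
  rewrite g1x rmorphM (hx _ _ _ _ uu1' e1) !gg'.
  by rewrite (cmap_str g') sg'.
apply: (@univ_hom_eq c2 s2 _ (kmap h2) (kmap g \o kmap g2) c2s) => [a|i] /=.
  by rewrite !cmap_str.
rewrite g2x rmorphM (hx _ _ _ _ uu2' e2) !gg'.
by rewrite (cmap_str g') sg'.
Qed.

End Scaled.

(** * Cancelling and dividing out the equation of P *)

Section DivisorSections.
Variables (k : closedFieldType) (n : nat) (J : {mpoly k[n.+1]} -> Prop).
Hypotheses (prJ : proj_prime J) (dimJ : dimension1 J).
Variables (T : invertible J (kself k)) (P : 'rV[kself k]_n.+1) (epsilon : int).
Variable D : forall p : chart J (kself k), frame (T p) -> cring p.
Arguments D : clear implicits.
Hypotheses (PJ : on_proj J P) (divD : divisor P epsilon D).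
Hypothesis epsilon1 : epsilon = 1 \/ epsilon = -1.

Let JM : forall f g, J f -> J (f * g).
Proof. by case: prJ => -[_ _ JM _] _ _ _ f g; rewrite mulrC; apply: JM. Qed.
Let homJ : homogeneous_ideal J. Proof. by case: prJ. Qed.

Variables (R : kalg k) (I : invertible J R) (m : int).
Local Notation TT := (const_sheaf R T).
Implicit Types (p q r : chart J R).

Definition atD p (t : frame (TT p)) : cring p := D (cconst p) t.

Lemma atD_tr p q (h : chom p q) (t : frame (TT p)) (t' : frame (TT q)) :
  atD t' = h (atD t) * upow (tr h t t') (trI h t t') epsilon.
Proof.
have [DS _] := divD; rewrite /atD (DS _ _ (cconst_hom h) t t').
have e : trI (L := T) (cconst_hom h) t t' = trI h t t'.
  have e1 := trK (L := T) (cconst_hom h) t t'; have e2 := trK h t t'.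
  exact: (@uinv_eq (cring q) (tr h t t') _ _ e1 e2).
by rewrite e.
Qed.

Lemma atD_push p q (h : chom p q) (t : frame (TT p)) : atD (fpush h t) = h (atD t).
Proof. by rewrite (atD_tr h t) tr_fpush trI_fpush upow1 mulr1. Qed.

Lemma atD_nzd p s (t : frame (TT p)) x : univ p s -> atD t * x = 0 -> x = 0.
Proof. exact: (divisor_nzd prJ dimJ PJ divD). Qed.

Lemma upow_epsilon (A : comNzRingType) (x u : A) : x * u = 1 ->
  upow x u m = upow x u epsilon * upow x u (m - epsilon).
Proof.
move=> xu; case: epsilon1 => ->.
  by rewrite -[m in LHS](subrK 1) upowS //= expr1.
by rewrite -[m in LHS](addrK 1) opprK upowB.
Qed.

Lemma div_push (s : presec I TT) p q (h : chom p q) e t e' t' a : is_section m s ->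
  s p e t = atD t * a ->
  s q e' t' = atD t' * (h a * kap (m - epsilon) h e t e' t').
Proof.
move=> /secP sP sa; rewrite (sP _ _ h e t) sa rmorphM (atD_tr h t t') /kap.
by rewrite upow_epsilon ?trK //; ring.
Qed.

(** The equation of P can be a zero divisor on a given chart, but not on the cone charts, and a
    section is determined by its values there. *)
Lemma section_mul_inj (s : presec I TT) : is_section m s ->
  (forall p e t, atD t * s p e t = 0) -> eqsec s (zerosec I TT).
Proof.
move=> sP Ds; have [S [SF Sc]] := framed_cover2 I TT JM.
apply: (sec_univ0 JM (S := S) sP) => //; first by move=> u /SF [[]].
move=> u uS [c cu]; have [[_ /(_ c cu) [e]] [_ /(_ c cu) [t]]] := SF u uS.
by exists c, e, t; split=> //; apply: (atD_nzd cu (Ds c e t)).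
Qed.

Section Divide.
Variable s : presec I TT.
Hypothesis sP : is_section m s.
Hypothesis s0 : forall p e t, factors_through P (cconst p) -> s e t = 0 :> cring p.
Arguments s : clear implicits.

(** Modulo the equation of P the chart factors through P, where [s] vanishes. *)
Lemma div_ex p e t : exists a, s p e t = atD t * a.
Proof.
pose Ix (b : cring p) := exists a, b = atD t * a.
have idI : is_ideal Ix.
  split; first by exists 0; rewrite mulr0.
    by move=> x y [a ->] [b ->]; exists (a + b); rewrite mulrDr.
  by move=> x y [a ->]; exists (x * a); rewrite mulrCA.
case: (EM (Ix 1)) => [[a a1]|nI].
  by exists (a * s p e t); rewrite mulrA -a1 mul1r.
have [q [h [sh hI _]]] := quot_chart idI nI.
apply/hI; rewrite -(sec_push h e t sP); apply: s0.
have [_ H0] := divD; have [+ _] := H0 (cconst q) (fpush h t); apply.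
by rewrite -/(atD (fpush h t)) atD_push; apply/hI; exists 1; rewrite mulr1.
Qed.

(** A quotient by the equation of P is not unique on an arbitrary chart, so it is defined as the
    pullback of a quotient on a cone chart. *)
Let quot p e t a := exists c u e0 t0 a0 (h : chom c p),
  [/\ univ (R := R) c u, hasX u, s c e0 t0 = atD t0 * a0 &
      a = h a0 * kap (m - epsilon) h e0 t0 e t].

Lemma quot_push p q (h : chom p q) e t e' t' a :
  quot e t a -> quot e' t' (h a * kap (m - epsilon) h e t e' t').
Proof.
move=> [c [u [e0 [t0 [a0 [g [cu uX sa ->]]]]]]].
exists c, u, e0, t0, a0, (chcomp g h); split=> //.
by rewrite (@kap_comp _ _ _ _ _ _ _ _ _ _ g h _ e0 t0 e t) // rmorphM mulrA.
Qed.

(** Two cone charts mapping to [p] are compared on the chart given by [univ_join], a cone chart over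
    the ring of [p], where the equation of P cancels again. *)
Lemma quot_fun p (e : frame (I p)) (t : frame (TT p)) a a' :
  quot e t a -> quot e t a' -> a = a'.
Proof.
move=> [c1 [u1 [e1 [t1 [a1 [h1 [cu1 uX1 sa1 ->]]]]]]].
move=> [c2 [u2 [e2 [t2 [a2 [h2 [cu2 uX2 sa2 ->]]]]]]].
have [c [v [g1 [g2 [g [cv hg1 hg2]]]]]] := univ_join homJ h1 h2 uX1 cu1 cu2.
set e3 := fpush g1 e1; set t3 := fpush g1 t1.
have b1 := div_push g1 e3 t3 sP sa1; have b2 := div_push g2 e3 t3 sP sa2.
have /eqP : g1 a1 * kap (m - epsilon) g1 e1 t1 e3 t3 =
            g2 a2 * kap (m - epsilon) g2 e2 t2 e3 t3.
  apply/eqP; rewrite -subr_eq0; apply/eqP.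
  apply: (divisor_nzd prJ dimJ PJ divD (R := cring p) (c := c) (t := t3) cv).
  by rewrite mulrBr -[X in X - _]b1 -[X in _ - X]b2 subrr.
move=> /eqP e12.
rewrite (@kap_comp _ _ _ _ _ _ _ _ _ _ g1 g _ e1 t1 e3 t3 e t hg1).
rewrite (@kap_comp _ _ _ _ _ _ _ _ _ _ g2 g _ e2 t2 e3 t3 e t hg2).
by rewrite (hg1 a1) (hg2 a2) /= !mulrA -!rmorphM e12.
Qed.

Lemma quot_loc p (M : cring p -> Prop) : max_ideal M -> exists g, ~ M g /\
  forall q (h : chom p q), is_localization g h -> strict h -> exists e t a, @quot q e t a.
Proof.
move=> mM; have [S [SF Sc]] := framed_cover2 I TT JM.
have [u uS nMu] := Sc p M mM; exists (ev p u); split=> // q h hL sh.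
have [[uX Fe] [_ Ft]] := SF u uS.
have [c [cu /(_ q h sh hL c cu) [h' _]]] := univ_at JM uX mM nMu.
have [e0] := Fe c cu; have [t0] := Ft c cu.
have [a0 sa0] := div_ex e0 t0.
exists (fpush h' e0), (fpush h' t0), (h' a0 * kap (m - epsilon) h' e0 t0 (fpush h' e0) (fpush h' t0)).
by exists c, u, e0, t0, a0, h'.
Qed.

Lemma section_divide : exists a : presec I TT, is_section (m - epsilon) a /\
  forall p e t, s p e t = atD t * a p e t.
Proof.
have [a [aP aQ]] := glue quot_push quot_fun quot_loc.
exists a; split=> // p e t; apply/eqP; rewrite -subr_eq0; apply/eqP.
pose b : presec I TT := fun p e t => s p e t - atD t * a p e t.
have bP : is_section m b.
  apply/secP => q r h e0 t0 e1 t1; rewrite /b rmorphB mulrBl.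
  have /secP sP' := sP; have /secP aP' := aP.
  rewrite (sP' _ _ h e0 t0) (aP' _ _ h e0 t0) (atD_tr h t0 t1) rmorphM /kap.
  by rewrite upow_epsilon ?trK //; ring.
apply: (sec_loc0 (s := b) e t bP) => M mM.
have [g [nMg Hg]] := quot_loc mM; exists g; split=> // q h hL sh.
have [e' [t' [c Qc]]] := Hg q h hL sh; exists e', t'.
rewrite /b (aQ _ _ _ _ Qc).
have [d [u [e0 [t0 [a0 [h0 [_ _ sa ->]]]]]]] := Qc.
by rewrite (div_push h0 e' t' sP sa) subrr.
Qed.

End Divide.
End DivisorSections.

(** * Twisting by line bundles of the base *)

Section Twisted.
Variables (k : closedFieldType) (n : nat) (J : {mpoly k[n.+1]} -> Prop) (R : kalg k).
Variables (I I' T : invertible J R) (Lambda : lmodType R).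
Variable b : forall p : chart J R, Lambda -> I' p -> I p.
Hypothesis bT : forall p, is_tensor (cstr p) (@b p).
Hypothesis bN : forall p q (h : chom p q) lambda s,
  b lambda (res h s) = res h (b lambda s).
Arguments b : clear implicits.
Variables (m : int) (lambda : Lambda) (s : presec I' T).
Arguments s : clear implicits.
Hypothesis sP : is_section m s.

Lemma frame_near (L : invertible J R) (p : chart J R) (M : cring p -> Prop) : max_ideal M ->
  exists2 f, ~ M f & forall q (h : chom p q), (exists u, u * h f = 1) -> inhabited (frame (L q)).
Proof.
move=> mM; have [N [f [f1 fL]]] := sh_inv L p.
have [i nMi] := unit_idealN f1 mM; exists (f i) => // q h hf.
have [r [g [gL _]]] := loc_chart (max_ideal_nonnil mM nMi).
have [e] := fL i r g gL; have [h' _ _] := loc_chom gL hf.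
by constructor; apply: fpush h' e.
Qed.

Lemma tensorZ p a x : b p lambda (a *: x) = a *: b p lambda x.
Proof.
have [[_ b2] _] := bT p.
have b0 : b p lambda 0 = 0.
  by have := b2 (-1) lambda 0 0; rewrite scaler0 addr0 scaleN1r addNr.
by have := b2 a lambda x 0; rewrite b0 !addr0.
Qed.

Lemma twisted_frame p (e : frame (I p)) (e' e'' : frame (I' p)) t :
  coord e (b p lambda e') * s p e' t = coord e (b p lambda e'') * s p e'' t.
Proof.
have /secP sP' := sP; rewrite (sP' _ _ (idchom p) e' t e'' t) /=.
have trid (L : invertible J R) (f f' : frame (L p)) : tr (idchom p) f f' = coord f' f.
  by rewrite /tr (@res_id _ _ J R L _ (idchom p)).
rewrite /kap !trid coord_gen.
have -> : trI (idchom p) t t = 1.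
  by apply: (uinv_eq (trK _ t t)); rewrite trid coord_gen mulr1.
by rewrite upow1 mulr1 -{1}(coordK e'' e') tensorZ coordZ; ring.
Qed.

Lemma twisted_exists : exists s' : presec I T, is_section m s' /\ twisted b lambda s s'.
Proof.
pose G p e t a := exists e' : frame (I' p), a = coord e (b p lambda e') * s p e' t.
have [|||s' [s'P s'G]] := @glue _ _ J R I T m G.
- move=> p q h e t e1 t1 a [e' ->]; exists (fpush h e').
  have /secP sP' := sP; rewrite (sP' _ _ h e' t) fpushE bN.
  rewrite -[b p lambda e' in RHS](coordK e) resZ coordZ rmorphM.
  by rewrite /kap tr_fpush /tr; ring.
- by move=> p e t a a' [e' ->] [e'' ->]; apply: twisted_frame.
- move=> p M mM.
  have [f1 nM1 H1] := frame_near I mM; have [f2 nM2 H2] := frame_near I' mM.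
  have [f3 nM3 H3] := frame_near T mM.
  exists (f1 * f2 * f3); split; first by do 2?apply: max_ideal_mulN.
  move=> q h [[u uf] _ _] _.
  have [|e] := H1 q h.
    by exists (u * h (f2 * f3)); rewrite -mulrA -rmorphM mulrC -mulrA mulrC -uf; congr (_ * h _); ring.
  have [|e'] := H2 q h.
    by exists (u * h (f1 * f3)); rewrite -mulrA -rmorphM -uf; congr (_ * h _); ring.
  have [|t] := H3 q h; first by exists (u * h (f1 * f2)); rewrite -mulrA -rmorphM.
  by exists e, t; eexists; exists e'.
by exists s'; split=> // p e' e t; apply: s'G; exists e'.
Qed.

End Twisted.

(** Frames and sections are indexed by charts, which contain their structure map as a bundled
    morphism; composites with the same values must be equal before one can be rewritten into the
    other. *)
Lemma rmorph_eq (A B : pzSemiRingType) (f g : {rmorphism A -> B}) : f =1 g -> f = g.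
Proof.
case: f => f cf; case: g => g cg /= fg.
have {}fg : f = g by apply: funext.
move: cg; rewrite -fg => cg; congr GRing.RMorphism.Pack.
case: cf cg => [[a] [[b c]]] [[a'] [[b' c']]].
by rewrite (Prop_irrelevance a a') (Prop_irrelevance b b') (Prop_irrelevance c c').
Qed.

Lemma khom_eq (k : comNzRingType) (A B : kalg k) (f g : khom A B) : f =1 g -> f = g.
Proof.
case: f => f fK; case: g => g gK /= /rmorph_eq fg.
by move: fK gK; rewrite fg => fK gK; rewrite (Prop_irrelevance fK gK).
Qed.

(** * Base change of sections *)

Section Transport.
Variables (k : closedFieldType) (n : nat) (J : {mpoly k[n.+1]} -> Prop).
Variables (R R' R'' : kalg k) (g : khom R R') (h : khom R' R'') (gh : khom R R'').
Hypothesis ghE : gh =1 h \o g.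
Variables (I T : invertible J R).

Lemma lincomb_base_comp N (c : 'I_N -> R'') (s : 'I_N -> presec I T) :
  eqsec (lincomb c (fun j => presec_base h (presec_base g (s j)))) (zerosec _ _) <->
  eqsec (lincomb c (fun j => presec_base gh (s j))) (zerosec _ _).
Proof.
(* The types of the frames depend on the structure map; abstracting over it allows rewriting by
   [E]. *)
pose Pr (p : chart J R'') (f : khom R (calg (ckc p))) :=
  forall (e : frame (I (@Chart _ _ J R (ckc p) f))) (t : frame (T (@Chart _ _ J R (ckc p) f))),
  \sum_j cstr p (c j) * s j (@Chart _ _ J R (ckc p) f) e t = 0.
have E (p : chart J R'') : kcomp (kcomp (cstr p) h) g = kcomp (cstr p) gh.
  by apply: khom_eq => x /=; rewrite ghE.
split=> H p.
  have Hp : Pr p (kcomp (kcomp (cstr p) h) g) by apply: H.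
  by rewrite E in Hp; apply: Hp.
have Hp : Pr p (kcomp (cstr p) gh) by apply: H.
by rewrite -E in Hp; apply: Hp.
Qed.

End Transport.

(** A chart over R on which [f] is invertible is a chart over R_f. *)
Lemma eqsec0_lift (k : closedFieldType) (n : nat) (J : {mpoly k[n.+1]} -> Prop)
    (R R' : kalg k) (g : khom R R') (I T : invertible J R) (f : R) (s : presec I T) :
  is_localization f g -> eqsec (presec_base g s) (zerosec _ _) ->
  forall q, (exists u, u * cstr q f = 1) -> forall e t, s q e t = 0.
Proof.
move=> /localizationP gL s0 [q f'] /= hf.
have [|h hg] := locq_lift gL (phi := kmap f') _ hf.
  by move=> b ->; apply: rmorph0.
have hK a : h (kstr R' a) = kstr (calg q) a by rewrite -(kmapK g) hg kmapK.
pose h' : khom R' (calg q) := KHom hK.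
have <- : kcomp h' g = f' by apply: khom_eq => x /=; rewrite hg.
by move=> e t; apply: (s0 (@Chart _ _ J R' q h')).
Qed.

Section BaseSections.
Variables (k : closedFieldType) (n : nat) (J J' : {mpoly k[n.+1]} -> Prop).
Variables (R R' : kalg k) (g : khom R R').
Variables (I : invertible J R) (T : invertible J (kself k)) (m : int).

Lemma base_section (s : presec I (const_sheaf R T)) : is_section m s ->
  @is_section _ _ J R' (base_change g I) (const_sheaf R' T) m (presec_base g s).
Proof.
move=> sP p q h e t e' t' u' tu.
have E : res (i := T) (cconst_hom h) t = res (i := T) (cconst_hom (cbase_hom g h)) t.
  exact: res_eq.
have := sP (cbase g p) (cbase g q) (cbase_hom g h) e t e' t' u'.
move: tu; rewrite /presec_base /= E => tu /(_ tu) ->.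
by [].
Qed.

Variable sJ : forall f, J f -> J' f.

Lemma restr_base_section (s : presec (restr sJ I) (restr sJ (const_sheaf R T))) :
  is_section m s ->
  @is_section _ _ J' R' (restr sJ (base_change g I)) (restr sJ (const_sheaf R' T)) m
    (presec_base g s).
Proof.
move=> sP p q h e t e' t' u' tu.
have E : res (i := T) (cconst_hom (incl_hom sJ h)) t =
         res (i := T) (cconst_hom (incl_hom sJ (cbase_hom g h))) t.
  exact: res_eq.
have E' : res (i := I) (cbase_hom g (incl_hom sJ h)) e =
          res (i := I) (incl_hom sJ (cbase_hom g h)) e.
  exact: res_eq.
have := sP (cbase g p) (cbase g q) (cbase_hom g h) e t e' t' u'.
move: tu; rewrite /presec_base /= E E' => tu /(_ tu) ->.
by [].
Qed.

(** Restricting to V(J') and extending scalars to R, in either order, gives the same modules, but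
    restriction maps along morphisms that differ in their proof components. The lemmas on divisors
    use the second order. *)
Lemma restr_const_section (s : presec (restr sJ I) (restr sJ (const_sheaf R T))) :
  is_section m s <->
  @is_section _ _ J' R (restr sJ I) (const_sheaf R (restr sJ T)) m s.
Proof.
split=> sP p q h e t e' t' u' tu.
  have E : res (i := T) (incl_hom sJ (cconst_hom h)) t = res (i := T) (cconst_hom (incl_hom sJ h)) t.
    exact: res_eq.
  have := sP p q h e t e' t' u'; move: tu; rewrite /= E => tu /(_ tu) ->.
  by [].
have E : res (i := T) (incl_hom sJ (cconst_hom h)) t = res (i := T) (cconst_hom (incl_hom sJ h)) t.
  exact: res_eq.
have := sP p q h e t e' t' u'; move: tu; rewrite /= -E => tu /(_ tu) ->.
by [].
Qed.

Lemma restr_section (s : presec I (const_sheaf R T)) : is_section m s ->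
  @is_section _ _ J' R (restr sJ I) (restr sJ (const_sheaf R T)) m
    (fun p e t => s (incl sJ p) e t).
Proof.
move=> sP p q h e t e' t' u' tu.
exact: (sP (incl sJ p) (incl sJ q) (incl_hom sJ h) e t e' t' u' tu).
Qed.

End BaseSections.

(** * Sections of the twists *)

Lemma divz_unique (d : nat) (x q : int) : (0 < d)%N ->
  q * d%:Z <= x -> x < (q + 1) * d%:Z -> (x %/ d)%Z = q.
Proof.
move=> d0 qx xq; have d0' : d%:Z != 0 by rewrite eqz_nat -lt0n.
rewrite -[x](subrKC (q * d%:Z)) divzMDl // divz_small ?addr0 //.
by rewrite subr_ge0 qx /= ltrBlDl -[X in _ + X]mul1r -mulrDl.
Qed.

(** The ceiling of (m + 1)/d is the floor of m/d plus 1. The passage of the floor from m to m + 1 is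
    deduced from this. *)
Lemma divzN1 (d : nat) (m : int) : (0 < d)%N -> (- (m + 1) %/ d)%Z = - (m %/ d)%Z - 1.
Proof.
move=> d0; apply: divz_unique => //.
  rewrite -opprD mulNr lerN2 lezD1; exact: ltz_ceil.
by rewrite subrK mulNr ltrN2 ltzD1 lez_floor // eqz_nat -lt0n.
Qed.

Lemma divzN_dvd (d : nat) (m : int) : (0 < d)%N -> (d %| m)%Z -> (- m %/ d)%Z = - (m %/ d)%Z.
Proof.
move=> d0 /dvdzP [q ->]; rewrite -mulNr !mulzK //; by rewrite eqz_nat -lt0n.
Qed.

Lemma divzN_ndvd (d : nat) (m : int) : (0 < d)%N -> (d %| m)%Z = false ->
  (- m %/ d)%Z = - (m %/ d)%Z - 1.
Proof.
move=> d0 dm; apply: divz_unique => //.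
  by rewrite -opprD mulNr lerN2; apply/ltW/ltz_ceil.
rewrite subrK mulNr ltrN2 lt_neqAle lez_floor ?eqz_nat ?andbT -?lt0n //.
by apply/eqP => e; move: dm; rewrite -e dvdz_mull.
Qed.

Lemma divzS_dvd (d : nat) (m : int) : (0 < d)%N -> (d %| m + 1)%Z ->
  ((m + 1) %/ d)%Z = (m %/ d)%Z + 1.
Proof.
by move=> d0 dm; have := divzN1 m d0; rewrite divzN_dvd // -opprD => /oppr_inj.
Qed.

Lemma divzS_ndvd (d : nat) (m : int) : (0 < d)%N -> (d %| m + 1)%Z = false ->
  ((m + 1) %/ d)%Z = (m %/ d)%Z.
Proof.
by move=> d0 dm; have := divzN1 m d0; rewrite divzN_ndvd // => /addIr/oppr_inj.
Qed.

Lemma shmapZ (k : closedFieldType) (n : nat) (J : {mpoly k[n.+1]} -> Prop) (R : kalg k)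
    (L L' : invertible J R) (j : sheaf_hom L L') p a (u : L p) :
  j p (a *: u) = a *: j p u.
Proof.
have jl := shmap_lin j (p := p).
have j0 : j p 0 = 0 by have := jl (-1) 0 0; rewrite scaler0 addr0 scaleN1r addNr.
by have := jl a u 0; rewrite !addr0 j0 addr0.
Qed.

Section Curve.
Variables (k : closedFieldType) (n : nat) (X : two_component_curve k n) (T : twister X).

Local Notation onY L := (restr (@idXY k n X) L).
Local Notation onZ L := (restr (@idXZ k n X) L).
Local Notation TT R := (const_sheaf R T).

Lemma proj_primeM (J : {mpoly k[n.+1]} -> Prop) : proj_prime J -> forall f g, J f -> J (f * g).
Proof. by move=> [[_ _ JM _] _ _ _] f g Jf; rewrite mulrC; apply: JM. Qed.

Lemma idX_mul f g : idX X f -> idX X (f * g).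
Proof.
by case=> fY fZ; split; apply: proj_primeM => //; [apply: idY_prime|apply: idZ_prime].
Qed.

(** On Y the sheaf T is O(-P), and the equation of P is the image of a frame in O; on Z it is O(P),
    and the equation is the coordinate of the section 1. Hence the opposite signs here and in
    [divisorZ]. *)
Lemma divisorY : divisor (T := onY T) (ptP X) (-1) (fun p => twY T p).
Proof.
split=> [p q h t t'|p t].
  have e := shmap_nat (twY T) h t.
  rewrite -[twY T q t']mulr1 -(trK h t t') /= mulrA expr1; congr (_ * _).
  by rewrite -[RHS]e -[res h t in RHS](coordK t') shmapZ [LHS]mulrC.
have [_ /(_ p) <-] := twY_zero T; split=> [t0 s|]; last by apply.
by rewrite -(coordK t s) shmapZ t0 scaler0.
Qed.

Lemma divisorZ : divisor (T := onZ T) (ptP X) 1 (fun p t => coord t (twZ T p 1)).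
Proof.
split=> [p q h t t'|p t].
  have e := shmap_nat (twZ T) h 1.
  rewrite /= expr1 -[in LHS](rmorph1 h)
    -[LHS]/(coord t' (twZ T q (res h (1 : osheaf (idZ X) (kself k) p)))).
  rewrite e -[twZ T p 1 in LHS](coordK t) (resZ (L := onZ T) h) coordZ.
  by [].
have [_ /(_ p) <-] := twZ_zero T; split=> [t0 s|z0].
  by rewrite -[s]mulr1 -[s * 1]/(s *: (1 : osheaf (idZ X) (kself k) p)) shmapZ
      -(coordK t (twZ T p 1)) t0 scale0r scaler0.
by rewrite z0 -(scale0r (gen t)) genK.
Qed.

Section FixR.
Variable R : kalg k.

(** [fY] and [fZ] are the inclusions of L_(i+1) in L_i and of M_i in M_(i+1) in coordinates, that is
    the factors occurring in [phi_down] and [phi_up]. *)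
Definition fY (delta : nat) (i : int) (p : chart (idY X) R) (tau : frame (onY (TT R) p)) : cring p :=
  if (delta %| i)%Z then twY T (cconst p) tau else 1.

Definition fZ (delta : nat) (i : int) (p : chart (idZ X) R) (tau : frame (onZ (TT R) p)) : cring p :=
  if (delta %| i + 1)%Z then coord tau (twZ T (cconst p) 1) else 1.

Variable I : invertible (idX X) R.
Variable delta : nat.
Hypothesis delta_gt0 : (0 < delta)%N.

Lemma fY_inj i m (s : presec (onY I) (onY (TT R))) : is_section m s ->
  (forall p e tau, fY delta i tau * s p e tau = 0) -> eqsec s (zerosec _ _).
Proof.
rewrite /fY => /restr_const_section sP fs.
case: (boolP (delta %| i)%Z) fs => _ fs; last by move=> p e t; rewrite -[LHS]mul1r fs.
exact: (section_mul_inj (idY_prime X) (idY_dim X) (ptP_Y X) divisorY sP fs).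
Qed.

Lemma fZ_inj i m (s : presec (onZ I) (onZ (TT R))) : is_section m s ->
  (forall p e tau, fZ delta i tau * s p e tau = 0) -> eqsec s (zerosec _ _).
Proof.
rewrite /fZ => /restr_const_section sP fs.
case: (boolP (delta %| i + 1)%Z) fs => _ fs; last by move=> p e t; rewrite -[LHS]mul1r fs.
exact: (section_mul_inj (idZ_prime X) (idZ_dim X) (ptP_Z X) divisorZ sP fs).
Qed.

(** The exponents of T in L_m and M_m. The first is the ceiling of m/delta, as T restricts to
    O_Y(-P). *)
Definition lexp m : int := - (- m %/ delta)%Z.
Definition mexp m : int := (m %/ delta)%Z.

Lemma tsecY m (s : tsec T I) : is_tsec delta m s -> is_section (lexp m) (tY s).
Proof. by case. Qed.

Lemma tsecZ m (s : tsec T I) : is_tsec delta m s -> is_section (mexp m) (tZ s).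
Proof. by case. Qed.

(** If delta divides m, the component over X is determined by its restrictions to Y and Z, by
    [sec_incl0]; otherwise it is zero by convention. *)
Lemma tsec_ext m (s s' : tsec T I) : is_tsec delta m s -> is_tsec delta m s' ->
  eqsec (tY s) (tY s') -> eqsec (tZ s) (tZ s') -> eqt s s'.
Proof.
move=> [_ _ sX] [_ _ sX'] eY eZ; split=> //.
case: ifP sX sX' => _; last by move=> sX sX' p e t; rewrite sX sX'.
move=> [sX sXY sXZ] [sX' sXY' sXZ'].
have s0 : eqsec (subsec (tX s) (tX s')) (zerosec _ _).
  have JI f : idY X f -> idZ X f -> idX X f by [].
  apply: (sec_incl0 (sJ1 := @idXY k n X) (sJ2 := @idXZ k n X) JI
    (proj_prime_subspace (idY_prime X)) (proj_prime_subspace (idZ_prime X)) idX_mul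
    (proj_primeM (idY_prime X)) (proj_primeM (idZ_prime X)) (sub_section sX sX')) => p e t.
    by rewrite /subsec -sXY -sXY' eY subrr.
  by rewrite /subsec -sXZ -sXZ' eZ subrr.
by move=> p e t; apply/eqP; rewrite -subr_eq0; apply/eqP; apply: s0.
Qed.

Lemma lincombt_is_tsec m N (c : 'I_N -> R) (s : 'I_N -> tsec T I) :
  (forall j, is_tsec delta m (s j)) -> is_tsec delta m (lincombt c s).
Proof.
move=> sP; split.
- by apply: lincomb_section => j; apply: tsecY.
- by apply: lincomb_section => j; apply: tsecZ.
case: ifP => dm.
  have sP' j := let: And3 _ _ x := sP j in x.
  split=> [|p e t|p e t].
  - by apply: lincomb_section => j; have := sP' j; rewrite dm => -[].
  - by apply: eq_bigr => j _; have := sP' j; rewrite dm => -[_ -> _].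
  - by apply: eq_bigr => j _; have := sP' j; rewrite dm => -[_ _ ->].
move=> p e t; rewrite /= /lincomb big1 // => j _.
by have [_ _] := sP j; rewrite dm => ->; rewrite mulr0.
Qed.

Lemma zerot_is_tsec m : is_tsec delta m (zerot T I).
Proof.
split; try exact: zero_section.
by case: ifP => // _; split=> //; apply: zero_section.
Qed.

Lemma eqt_refl (s : tsec T I) : eqt s s. Proof. by []. Qed.

Lemma eqt_sym (s s' : tsec T I) : eqt s s' -> eqt s' s.
Proof. by case=> a b c; split=> p e t; rewrite ?a ?b ?c. Qed.

Lemma eqt_trans (s s' s'' : tsec T I) : eqt s s' -> eqt s' s'' -> eqt s s''.
Proof. by case=> a b c [a' b' c']; split=> p e t; rewrite ?a ?b ?c. Qed.

Lemma eqt_is_tsec m (s s' : tsec T I) : eqt s s' -> is_tsec delta m s -> is_tsec delta m s'.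
Proof.
move=> [eX eY eZ] [sY sZ sX]; split.
- exact: eqsec_section eY sY.
- exact: eqsec_section eZ sZ.
case: ifP sX => _; last by move=> sX p e t; rewrite -eX sX.
move=> [sX XY XZ]; split; first exact: eqsec_section eX sX.
  by move=> p e t; rewrite -eX -eY XY.
by move=> p e t; rewrite -eX -eZ XZ.
Qed.

(** A chart of Y that factors through P is also a chart of Z, because P lies on Z; so the vanishing
    on Z applies to it. *)
Lemma incl_eq0 m (s : presec I (TT R)) (p : chart (idY X) R) (e : frame (I (incl (@idXY k n X) p)))
    (t : frame (TT R (incl (@idXY k n X) p))) : is_section m s ->
  (forall q e t, s (incl (@idXZ k n X) q) e t = 0) ->
  factors_through (ptP X) (cconst p) -> s (incl (@idXY k n X) p) e t = 0.
Proof.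
move=> sP sZ [u [u' [uu pu]]].
pose PZ := @Chart _ _ (idZ X) (kself k) (KChart (ptP_Z X))
  (@KHom _ (kself k) (kself k) idfun (fun=> erefl)).
have pZ : on_proj (idZ X) (cvec (ckc p)).
  have [[w w1] _] := con (ckc p); split; first by exists w.
  have homZ : homogeneous_ideal (idZ X) by case: (idZ_prime X).
  move=> f Zf; rewrite pu; apply: (homog_ideal_scale homZ) => // {}f {}Zf.
  by have [_ H] := @push_on_proj _ _ _ _ PZ _ (kstr (cring p)); apply: H.
pose q := @Chart _ _ (idZ X) R (KChart pZ) (cstr p).
have [h _] := @mk_chom _ _ (idX X) R (incl (@idXY k n X) p) (incl (@idXZ k n X) q)
  idfun (fun=> erefl) (idchom_vec (incl (@idXY k n X) p)).
have [h' h'E] := @mk_chom _ _ (idX X) R (incl (@idXZ k n X) q) (incl (@idXY k n X) p)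
  idfun (fun=> erefl) (idchom_vec (incl (@idXY k n X) p)).
apply/(sec_eq0 h' (fpush h e) (fpush h t) e t sP).
by rewrite (sZ q) rmorph0.
Qed.

Lemma incl_eq0' m (s : presec I (TT R)) (p : chart (idZ X) R) (e : frame (I (incl (@idXZ k n X) p)))
    (t : frame (TT R (incl (@idXZ k n X) p))) : is_section m s ->
  (forall q e t, s (incl (@idXY k n X) q) e t = 0) ->
  factors_through (ptP X) (cconst p) -> s (incl (@idXZ k n X) p) e t = 0.
Proof.
move=> sP sY [u [u' [uu pu]]].
pose PY := @Chart _ _ (idY X) (kself k) (KChart (ptP_Y X))
  (@KHom _ (kself k) (kself k) idfun (fun=> erefl)).
have pY : on_proj (idY X) (cvec (ckc p)).
  have [[w w1] _] := con (ckc p); split; first by exists w.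
  have homY : homogeneous_ideal (idY X) by case: (idY_prime X).
  move=> f Yf; rewrite pu; apply: (homog_ideal_scale homY) => // {}f {}Yf.
  by have [_ H] := @push_on_proj _ _ _ _ PY _ (kstr (cring p)); apply: H.
pose q := @Chart _ _ (idY X) R (KChart pY) (cstr p).
have [h _] := @mk_chom _ _ (idX X) R (incl (@idXZ k n X) p) (incl (@idXY k n X) q)
  idfun (fun=> erefl) (idchom_vec (incl (@idXZ k n X) p)).
have [h' h'E] := @mk_chom _ _ (idX X) R (incl (@idXY k n X) q) (incl (@idXZ k n X) p)
  idfun (fun=> erefl) (idchom_vec (incl (@idXZ k n X) p)).
apply/(sec_eq0 h' (fpush h e) (fpush h t) e t sP).
by rewrite (sY q) rmorph0.
Qed.

Lemma lexpS m : lexp (m + 1) = mexp m + 1.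
Proof. by rewrite /lexp divzN1 // opprB addrC opprK. Qed.

Lemma lexp_dvd m : (delta %| m)%Z -> lexp m = mexp m.
Proof. by move=> dm; rewrite /lexp divzN_dvd // opprK. Qed.

Lemma lexp_ndvd m : (delta %| m)%Z = false -> lexp m = lexp (m + 1).
Proof. by move=> dm; rewrite /lexp divzN_ndvd // divzN1. Qed.

(** The kernel of the restriction to Z is L_(m+1). If delta divides m the section comes from X, so
    vanishing on Z forces it to vanish at P on Y, and the equation of P can be divided out. *)
Lemma tsec_divY m (s : tsec T I) : is_tsec delta m s -> eqsec (tZ s) (zerosec _ _) ->
  exists a : presec (onY I) (onY (TT R)), is_section (lexp (m + 1)) a /\
    forall p e tau, tY s p e tau = fY delta m tau * a p e tau.
Proof.
move=> sP sZ; case: (boolP (delta %| m)%Z) => dm; last first.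
  exists (tY s); split; first by rewrite -lexp_ndvd ?(negPf dm) //; apply: tsecY.
  by move=> p e tau; rewrite /fY (negPf dm) mul1r.
have [sY _] := sP; rewrite dm => -[sX sXY sXZ].
have [||a [aP aE]] := section_divide (idY_prime X) (idY_dim X) (ptP_Y X) divisorY _
  (proj1 (restr_const_section _ _) (tsecY sP)).
- by right.
- move=> p e t pP; rewrite sXY; apply: (incl_eq0 _ _ sX _ pP) => q e' t'.
  by rewrite -sXZ sZ.
exists a; split.
  by apply/restr_const_section; move: aP; rewrite opprK lexp_dvd // lexpS.
by move=> p e tau; rewrite aE /fY dm.
Qed.

Lemma tsec_divZ m (s : tsec T I) : is_tsec delta (m + 1) s -> eqsec (tY s) (zerosec _ _) ->
  exists a : presec (onZ I) (onZ (TT R)), is_section (mexp m) a /\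
    forall p e tau, tZ s p e tau = fZ delta m tau * a p e tau.
Proof.
move=> sP sY; case: (boolP (delta %| m + 1)%Z) => dm; last first.
  exists (tZ s); split; first by rewrite -[mexp m]divzS_ndvd ?(negPf dm) //; apply: tsecZ.
  by move=> p e tau; rewrite /fZ (negPf dm) mul1r.
have [_ sZ] := sP; rewrite dm => -[sX sXY sXZ].
have [||a [aP aE]] := section_divide (idZ_prime X) (idZ_dim X) (ptP_Z X) divisorZ _
  (proj1 (restr_const_section _ _) (tsecZ sP)).
- by left.
- move=> p e t pP; rewrite sXZ; apply: (incl_eq0' _ _ sX _ pP) => q e' t'.
  by rewrite -sXY sY.
exists a; split.
  by apply/restr_const_section; move: aP; rewrite /mexp divzS_dvd // addrK.
by move=> p e tau; rewrite aE /fZ dm.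
Qed.

Lemma tsec_torsion m (s : tsec T I) (f : R) (R' : kalg k) (g : khom R R') :
  is_tsec delta m s -> is_localization f g ->
  eqt (tsec_base g s) (zerot T _) -> exists N, eqt (lincombt (fun _ : 'I_1 => f ^+ N) (fun=> s)) (zerot T I).
Proof.
move=> sP gL [s0X s0Y s0Z].
have [N1 s1] := sec_torsion (proj_primeM (idY_prime X)) (tsecY sP) (eqsec0_lift (s := tY s) gL s0Y).
have [N2 s2] := sec_torsion (proj_primeM (idZ_prime X)) (tsecZ sP) (eqsec0_lift (s := tZ s) gL s0Z).
exists (N1 + N2)%N; apply: (@tsec_ext m); first by apply: lincombt_is_tsec.
- exact: zerot_is_tsec.
- move=> p e t; rewrite /= /lincomb big_ord1 exprD rmorphM mulrAC.
  by have := s1 p e t; rewrite /scalesec => ->; rewrite mul0r.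
move=> p e t; rewrite /= /lincomb big_ord1 exprD rmorphM -mulrA.
by have := s2 p e t; rewrite /scalesec => ->; rewrite mulr0.
Qed.

End FixR.

Lemma tsec_base_is_tsec delta m (R R' : kalg k) (g : khom R R') (I : invertible (idX X) R)
    (s : tsec T I) : is_tsec delta m s -> is_tsec delta m (tsec_base g s).
Proof.
move=> [sY sZ sX]; split; [exact: restr_base_section sY|exact: restr_base_section sZ|].
case: ifP sX => _; last by move=> sX p e t; exact: (sX (cbase g p) e t).
move=> [sX sXY sXZ]; split; first exact: base_section.
  by move=> p e t; apply: (sXY (cbase g p)).
by move=> p e t; apply: (sXZ (cbase g p)).
Qed.

Lemma lincombt_base_comp N (R R' R'' : kalg k) (g : khom R R') (h : khom R' R'')
    (gh : khom R R'') (I : invertible (idX X) R) (c : 'I_N -> R'') (s : 'I_N -> tsec T I) :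
  gh =1 h \o g ->
  eqt (lincombt c (fun j => tsec_base h (tsec_base g (s j)))) (zerot T _) <->
  eqt (lincombt c (fun j => tsec_base gh (s j))) (zerot T _).
Proof.
move=> ghE; split=> -[eX eY eZ]; split.
- exact: (proj1 (lincomb_base_comp ghE c (fun j => tX (s j))) eX).
- exact: (proj1 (lincomb_base_comp ghE c (fun j => tY (s j))) eY).
- exact: (proj1 (lincomb_base_comp ghE c (fun j => tZ (s j))) eZ).
- exact: (proj2 (lincomb_base_comp ghE c (fun j => tX (s j))) eX).
- exact: (proj2 (lincomb_base_comp ghE c (fun j => tY (s j))) eY).
- exact: (proj2 (lincomb_base_comp ghE c (fun j => tZ (s j))) eZ).
Qed.

End Curve.

(** * Linear algebra of sections *)

Section LocMatrix.
Variables (A B : comNzRingType) (f : A) (g : {rmorphism A -> B}).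
Hypothesis gL : is_localization f g.

Lemma loc_mx_torsion m n (c : 'M[A]_(m, n)) : map_mx g c = 0 -> exists M, f ^+ M *: c = 0.
Proof.
move=> c0; have H ij : exists M, f ^+ M * c ij.1 ij.2 = 0.
  by case: gL => _ _; apply; have := congr1 (fun x : 'M_(m, n) => x ij.1 ij.2) c0; rewrite !mxE.
have [M HM] := choice H; exists (\max_ij M ij)%N.
apply/matrixP => i j; rewrite !mxE.
have le : (M (i, j) <= \max_ij M ij)%N by apply: (leq_bigmax (i, j)).
by rewrite -(subnK le) exprD -mulrA (HM (i, j)) mulr0.
Qed.

Lemma loc_mx_clear m n (c : 'M[B]_(m, n)) : exists M a, g f ^+ M *: c = map_mx g a.
Proof.
have H ij : exists aM : A * nat, c ij.1 ij.2 * g f ^+ aM.2 = g aM.1.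
  by case: gL => _ /(_ (c ij.1 ij.2)) [a [M e]] _; exists (a, M).
have [aM HM] := choice H; pose M0 := (\max_ij (aM ij).2)%N.
exists M0, (\matrix_(i, j) ((aM (i, j)).1 * f ^+ (M0 - (aM (i, j)).2))).
apply/matrixP => i j; rewrite !mxE.
have le : ((aM (i, j)).2 <= M0)%N by apply: (leq_bigmax (i, j)).
by rewrite rmorphM rmorphXn -(HM (i, j)) -mulrA -exprD addnC subnK // mulrC.
Qed.

End LocMatrix.

Lemma loc_kalg (k : comNzRingType) (R : kalg k) (f : R) : (forall m, f ^+ m <> 0) ->
  exists (Rf : kalg k) (g : khom R Rf), is_localization f g.
Proof.
move=> /localization_exists [B [g gL]].
by exists (KAlg (g \o kstr R)), (@KHom k R (KAlg (g \o kstr R)) g (fun=> erefl)).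
Qed.

Lemma loc_khom (k : comNzRingType) (R Rf R' : kalg k) (f : R) (g : khom R Rf) (h : khom R R') :
  is_localization f g -> (exists u, u * h f = 1) -> exists h' : khom Rf R', h =1 h' \o g.
Proof.
move=> /localizationP gL hf.
have [|h' hg] := locq_lift gL (phi := kmap h) _ hf; first by move=> b ->; apply: rmorph0.
have hK a : h' (kstr Rf a) = kstr R' a by rewrite -(kmapK g) hg kmapK.
by exists (KHom hK) => x /=; rewrite hg.
Qed.

Section Values.
Variables (k : closedFieldType) (n : nat) (X : two_component_curve k n) (T : twister X).

Local Notation onY L := (restr (@idXY k n X) L).
Local Notation onZ L := (restr (@idXZ k n X) L).
Local Notation TT R := (const_sheaf R T).

(** Evaluation at all charts of X, Y and Z with frames turns an identity between sections, which
    have three components, into a single identity of ring elements. *)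
Inductive pt (R : kalg k) (I : invertible (idX X) R) : Type :=
| ptX (p : chart (idX X) R) (e : frame (I p)) (t : frame (TT R p))
| ptY (p : chart (idY X) R) (e : frame (onY I p)) (t : frame (onY (TT R) p))
| ptZ (p : chart (idZ X) R) (e : frame (onZ I p)) (t : frame (onZ (TT R) p)).

Section FixI.
Variables (R : kalg k) (I : invertible (idX X) R).
Implicit Types (x : pt I) (s : tsec T I).

Definition ptc x : kalg k :=
  match x with ptX p _ _ => cring p | ptY p _ _ => cring p | ptZ p _ _ => cring p end.

Definition pts x : khom R (ptc x) :=
  match x with ptX p _ _ => cstr p | ptY p _ _ => cstr p | ptZ p _ _ => cstr p end.

Definition ptval x s : ptc x :=
  match x with
  | ptX p e t => tX s p e t | ptY p e t => tY s p e t | ptZ p e t => tZ s p e t end.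

Lemma eqtP s s' : eqt s s' <-> forall x, ptval x s = ptval x s'.
Proof.
split=> [[eX eY eZ] [] p e t|H]; [exact: eX|exact: eY|exact: eZ|].
split=> p e t; [exact: (H (ptX e t))|exact: (H (ptY e t))|exact: (H (ptZ e t))].
Qed.

Lemma val_lincombt x N (c : 'I_N -> R) (s : 'I_N -> tsec T I) :
  ptval x (lincombt c s) = \sum_j pts x (c j) * ptval x (s j).
Proof. by case: x. Qed.

Lemma val_zerot x : ptval x (zerot T I) = 0.
Proof. by case: x. Qed.

(** This and the next operations are instances of [lincombt], under which a [submodule] is closed by
    definition. *)
Definition comb N (c : 'rV[R]_N) (v : 'I_N -> tsec T I) : tsec T I :=
  lincombt (fun j => c 0 j) v.

Definition scalet (a : R) s : tsec T I := lincombt (fun _ : 'I_1 => a) (fun=> s).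

Definition subt s s' : tsec T I :=
  lincombt (fun j : 'I_2 => if j == 0 then 1 else -1) (fun j => if j == 0 then s else s').

Definition addt s s' : tsec T I :=
  lincombt (fun j : 'I_2 => 1) (fun j => if j == 0 then s else s').

Lemma val_comb x N (c : 'rV[R]_N) (v : 'I_N -> tsec T I) :
  ptval x (comb c v) = \sum_j pts x (c 0 j) * ptval x (v j).
Proof. exact: val_lincombt. Qed.

Lemma val_scalet x a s : ptval x (scalet a s) = pts x a * ptval x s.
Proof. by rewrite val_lincombt big_ord1. Qed.

Lemma val_subt x s s' : ptval x (subt s s') = ptval x s - ptval x s'.
Proof. by rewrite val_lincombt !big_ord_recl big_ord0 /= rmorph1 rmorphN1 mul1r mulN1r addr0. Qed.

Lemma val_addt x s s' : ptval x (addt s s') = ptval x s + ptval x s'.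
Proof. by rewrite val_lincombt !big_ord_recl big_ord0 /= rmorph1 !mul1r addr0. Qed.

Lemma val_comb_mulmx x N M (c : 'rV[R]_N) (A : 'M[R]_(N, M)) (w : 'I_M -> tsec T I) :
  ptval x (comb (c *m A) w) = \sum_j pts x (c 0 j) * ptval x (comb (row j A) w).
Proof.
rewrite val_comb; under eq_bigr => l _ do rewrite mxE rmorph_sum mulr_suml.
rewrite exchange_big; apply: eq_bigr => j _; rewrite val_comb mulr_sumr.
by apply: eq_bigr => l _; rewrite mxE rmorphM mulrA.
Qed.

Lemma val_combZ x N a (c : 'rV[R]_N) (w : 'I_N -> tsec T I) :
  ptval x (comb (a *: c) w) = pts x a * ptval x (comb c w).
Proof.
by rewrite !val_comb mulr_sumr; apply: eq_bigr => l _; rewrite mxE rmorphM mulrA.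
Qed.

Lemma val_combD x N (c d : 'rV[R]_N) (w : 'I_N -> tsec T I) :
  ptval x (comb (c + d) w) = ptval x (comb c w) + ptval x (comb d w).
Proof.
by rewrite !val_comb -big_split; apply: eq_bigr => l _; rewrite mxE rmorphD mulrDl.
Qed.

Lemma val_combB x N (c d : 'rV[R]_N) (w : 'I_N -> tsec T I) :
  ptval x (comb (c - d) w) = ptval x (comb c w) - ptval x (comb d w).
Proof.
by rewrite !val_comb -sumrB; apply: eq_bigr => l _; rewrite !mxE rmorphB mulrBl.
Qed.

Lemma val_comb0 x N (w : 'I_N -> tsec T I) : ptval x (comb 0 w) = 0.
Proof. by rewrite val_comb big1 // => l _; rewrite mxE rmorph0 mul0r. Qed.

Lemma val_comb_delta x N j (w : 'I_N -> tsec T I) : ptval x (comb (delta_mx 0 j) w) = ptval x (w j).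
Proof.
rewrite val_comb (bigD1 j) //= big1 => [|l /negPf lj].
  by rewrite mxE !eqxx rmorph1 mul1r addr0.
by rewrite mxE lj andbF rmorph0 mul0r.
Qed.

Section Submodule.
Variable V : tsec T I -> Prop.
Hypothesis smV : submodule V.

Lemma submod_comb N (c : 'rV[R]_N) v : (forall j, V (v j)) -> V (comb c v).
Proof. by move=> Vv; apply: smV (eqt_refl _). Qed.

Lemma submod_scale a s : V s -> V (scalet a s).
Proof. by move=> Vs; apply: smV (eqt_refl _). Qed.

Lemma submod_sub s s' : V s -> V s' -> V (subt s s').
Proof. by move=> Vs Vs'; apply: smV (eqt_refl _) => j; case: eqP. Qed.

Lemma submod_add s s' : V s -> V s' -> V (addt s s').
Proof. by move=> Vs Vs'; apply: smV (eqt_refl _) => j; case: eqP. Qed.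

Lemma submod_eqt s s' : eqt s s' -> V s -> V s'.
Proof.
move=> ss Vs; apply: (smV (N := 1) (c := fun=> 1) (s := fun=> s)) => //.
apply/eqtP => x; move/eqtP: ss => <-.
by rewrite val_lincombt big_ord1 rmorph1 mul1r.
Qed.

Lemma submod_zero : V (zerot T I).
Proof.
apply: (smV (N := 0) (c := fun=> 0) (s := fun=> zerot T I)); first by case.
by apply/eqtP => x; rewrite val_lincombt big_ord0 val_zerot.
Qed.

(** The scalars that carry [s] into [V] form an ideal, and this ideal lies in no maximal ideal. *)
Lemma submod_local s : (forall M : R -> Prop, max_ideal M ->
  exists2 f, V (scalet f s) & ~ M f) -> V s.
Proof.
pose Ix a := V (scalet a s) => H.
suff V1 : Ix 1.
  by apply: submod_eqt V1; apply/eqtP => x; rewrite val_scalet rmorph1 mul1r.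
apply: ideal1P => //; split.
- apply: submod_eqt submod_zero; apply/eqtP => x.
  by rewrite val_scalet val_zerot rmorph0 mul0r.
- move=> a b Va Vb; apply: submod_eqt (submod_add Va Vb); apply/eqtP => x.
  by rewrite val_addt !val_scalet rmorphD mulrDl.
- move=> a b Vb; apply: submod_eqt (submod_scale a Vb); apply/eqtP => x.
  by rewrite !val_scalet rmorphM mulrA.
Qed.

End Submodule.
End FixI.

Section Base.
Variables (R R' : kalg k) (g : khom R R') (I : invertible (idX X) R).

Lemma base_eqt (s s' : tsec T I) : eqt s s' -> eqt (tsec_base g s) (tsec_base g s').
Proof.
move=> [eX eY eZ]; split=> p e t.
- exact: (eX (cbase g p) e t).
- exact: (eY (cbase g p) e t).
- exact: (eZ (cbase g p) e t).
Qed.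

Lemma base_lincombt N (c : 'I_N -> R) (s : 'I_N -> tsec T I) :
  eqt (tsec_base g (lincombt c s)) (lincombt (fun j => g (c j)) (fun j => tsec_base g (s j))).
Proof. by []. Qed.

Lemma val_base_comb (x : pt (base_change g I)) N (c : 'rV[R]_N) (v : 'I_N -> tsec T I) :
  ptval x (tsec_base g (comb c v)) = ptval x (comb (map_mx g c) (fun j => tsec_base g (v j))).
Proof.
move/eqtP: (base_lincombt (fun j => c 0 j) v) => ->.
by rewrite val_comb val_lincombt; apply: eq_bigr => j _; rewrite mxE.
Qed.

Lemma val_base_scalet (x : pt (base_change g I)) a (s : tsec T I) :
  ptval x (tsec_base g (scalet a s)) = pts x (g a) * ptval x (tsec_base g s).
Proof. by move/eqtP: (base_lincombt (fun _ : 'I_1 => a) (fun=> s)) => ->; rewrite val_lincombt big_ord1. Qed.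

Lemma span_base_submodule (V : tsec T I -> Prop) : submodule (span_base g V).
Proof.
move=> N c s t Vs /eqtP ts.
have Vs' j : exists z : {d : nat & ('I_d -> R') * ('I_d -> tsec T I)}%type,
    (forall i, V ((tagged z).2 i)) /\
    eqt (s j) (lincombt (tagged z).1 (fun i => tsec_base g ((tagged z).2 i))).
  have [d [e [w [Vw sw]]]] := Vs j.
  by exists (Tagged (fun d => ('I_d -> R') * ('I_d -> tsec T I))%type (e, w)).
have [z Hz] := choice Vs'.
pose d j := tag (z j); pose e j := (tagged (z j)).1; pose w j := (tagged (z j)).2.
(* A combination of combinations is indexed by the pairs (j, i), which are then enumerated. *)
pose U : finType := {j : 'I_N & 'I_(d j)}.
pose C (u : U) := c (tag u) * e (tag u) (tagged u).
pose W (u : U) := w (tag u) (tagged u).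
exists #|[pred u : U | true]|, (fun i => C (enum_val i)), (fun i => W (enum_val i)).
split; first by move=> i; rewrite /W; have [Vw _] := Hz (tag (enum_val i)); apply: Vw.
apply/eqtP => x; rewrite ts !val_lincombt.
transitivity (\sum_j \sum_(i : 'I_(d j)) pts x (c j) * (pts x (e j i) * ptval x (tsec_base g (w j i)))).
  apply: eq_bigr => j _; have [_ /eqtP ->] := Hz j.
  by rewrite val_lincombt mulr_sumr.
rewrite (sig_big_dep predT (fun _ => predT)
  (fun j (i : 'I_(d j)) => pts x (c j) * (pts x (e j i) * ptval x (tsec_base g (w j i))))) /=.
rewrite -(big_enum_val (A := [pred u : U | true])
  (fun u => pts x (C u) * ptval x (tsec_base g (W u)))) /=.
by apply: eq_bigr => u _; rewrite /C rmorphM mulrA.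
Qed.

End Base.
End Values.

(** * Local bases *)

Section LocBasis.
Variables (k : closedFieldType) (n : nat) (X : two_component_curve k n) (T : twister X).

(* Over Spec R_f, the sections v restrict to a basis of the restriction of V,
   and remain independent over every R_f-algebra. *)
Definition loc_basis (R : kalg k) (I : invertible (idX X) R) (V : tsec T I -> Prop) (f : R)
    N (v : 'I_N -> tsec T I) : Prop :=
  [/\ forall j, V (v j),
      forall t, V t -> exists M (c : 'rV[R]_N), eqt (scalet (f ^+ M) t) (comb c v) &
      forall (R' : kalg k) (g : khom R R') (c : 'rV[R']_N), (exists u, u * g f = 1) ->
        eqt (comb c (fun j => tsec_base g (v j))) (zerot T _) -> c = 0].

Section FixR.
Variables (R : kalg k) (I : invertible (idX X) R) (V : tsec T I -> Prop).
Implicit Types (f : R) (s t : tsec T I).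

Lemma loc_basis_indep f N (v : 'I_N -> tsec T I) (c : 'rV[R]_N) : loc_basis V f v ->
  eqt (comb c v) (zerot T I) -> exists M, f ^+ M *: c = 0.
Proof.
move=> [_ _ indep] c0; case: (EM (forall M, f ^+ M <> 0)) => [/loc_kalg [Rf [g gL]]|]; last first.
  by rewrite -existsNE => -[M /contrapT fM]; exists M; rewrite fM scale0r.
apply: (loc_mx_torsion gL); apply: (indep Rf g); first by case: gL.
apply/eqtP => x; rewrite -val_base_comb; move/(base_eqt g)/eqtP: c0 => ->.
by case: x.
Qed.

Lemma loc_basis_mul f a N (v : 'I_N -> tsec T I) : loc_basis V f v -> loc_basis V (f * a) v.
Proof.
move=> [Vv sp indep]; split=> // [t /sp [M [c /eqtP tc]]|R' g c [u ug]].
  exists M, (a ^+ M *: c); apply/eqtP => x.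
  by rewrite val_combZ val_scalet -tc val_scalet exprMn rmorphM mulrCA mulrA.
apply: indep; exists (u * g a); by rewrite -ug rmorphM mulrAC mulrA.
Qed.

Lemma loc_basis_unit f N (v : 'I_N -> tsec T I) : loc_basis V f v ->
  (exists u, u * f = 1) -> forall t, V t -> exists c, eqt t (comb c v).
Proof.
move=> [_ sp _] [u uf] t /sp [M [c /eqtP tc]]; exists (u ^+ M *: c); apply/eqtP => x.
rewrite val_combZ -tc val_scalet mulrA -rmorphM unitlX //.
by rewrite rmorph1 mul1r.
Qed.

Lemma loc_basis_base f N (v : 'I_N -> tsec T I) (R' : kalg k) (g : khom R R') :
  loc_basis V f v -> loc_basis (span_base g V) (g f) (fun j => tsec_base g (v j)).
Proof.
move=> [Vv sp indep]; split.
- move=> j; exists 1%N, (fun=> 1), (fun=> v j); split=> //; apply/eqtP => x.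
  by rewrite val_lincombt big_ord1 rmorph1 mul1r.
- move=> t [N' [d [s [Vs /eqtP ts]]]].
  have H j : exists Mc : nat * 'rV[R]_N, eqt (scalet (f ^+ Mc.1) (s j)) (comb Mc.2 v).
    by have [M [c e]] := sp _ (Vs j); exists (M, c).
  have [Mc HM] := choice H; pose M := (\max_j (Mc j).1)%N.
  exists M, (\sum_j d j *: map_mx g (f ^+ (M - (Mc j).1) *: (Mc j).2)).
  have cE x : ptval x (comb (\sum_j d j *: map_mx g (f ^+ (M - (Mc j).1) *: (Mc j).2))
       (fun j => tsec_base g (v j))) =
     \sum_j pts x (d j) * ptval x (comb (map_mx g (f ^+ (M - (Mc j).1) *: (Mc j).2))
       (fun j => tsec_base g (v j))).
    elim/big_rec2: _ => [|j y c _ e]; first exact: val_comb0.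
    by rewrite val_combD val_combZ e.
  apply/eqtP => x; rewrite cE val_scalet ts val_lincombt mulr_sumr; apply: eq_bigr => j _.
  rewrite -val_base_comb mulrCA; congr (_ * _).
  have /(base_eqt g)/eqtP/(_ x) := HM j; rewrite val_base_scalet => e.
  have le : ((Mc j).1 <= M)%N by apply: leq_bigmax.
  rewrite -[in LHS](subnK le) -rmorphXn exprD !rmorphM -mulrA e.
  by rewrite !val_base_comb map_mxZ val_combZ.
- move=> R'' h c [u uf] c0.
  apply: (indep R'' (kcomp h g) c); first by exists u.
  by apply/(lincombt_base_comp (g := g) (h := h) (gh := kcomp h g)).
Qed.

Hypothesis smV : submodule V.
Variables (delta : nat) (i : int).
Hypothesis Vtsec : forall s, V s -> is_tsec delta i s.

Lemma span_clear f (Rf : kalg k) (g : khom R Rf) (t : tsec T (base_change g I)) :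
  is_localization f g -> span_base g V t ->
  exists M t0, V t0 /\ eqt (scalet (g f ^+ M) t) (tsec_base g t0).
Proof.
move=> gL [N [c [s [Vs /eqtP ts]]]].
have [M [a ca]] := loc_mx_clear gL (\row_j c j).
exists M, (comb a s); split; first exact: submod_comb.
apply/eqtP => x; rewrite val_base_comb -ca val_combZ val_scalet ts; congr (_ * _).
by rewrite val_lincombt val_comb; apply: eq_bigr => j _; rewrite mxE.
Qed.

(** A power of [f l] clears the denominators of a basis over R_f, and identities between sections
    over R_f hold over R after multiplication by a further power, by [tsec_torsion]. *)
Lemma locally_free_cover r : locally_free_subsheaf r V ->
  exists N : nat, N%:Z = r + 1 /\ exists M (f : 'I_M -> R), generates_unit_ideal f /\
    forall l, exists v : 'I_N -> tsec T I, loc_basis V (f l) v.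
Proof.
move=> [N Nr [M0 [f [f1 H]]]]; exists N; split=> //; exists M0, f; split=> // l.
case: (EM (forall M, f l ^+ M <> 0)) => [/loc_kalg [Rf [g gL]]|]; last first.
  (* If [f l] is nilpotent the open subset is empty, and zero sections serve as a basis. *)
  rewrite -existsNE => -[M /contrapT fM]; exists (fun=> zerot T I); split.
  - by move=> j; apply: submod_zero.
  - move=> t _; exists M, 0; apply/eqtP => x.
    by rewrite val_comb0 fM val_scalet rmorph0 mul0r.
  move=> R' g c [u ug]; have := unit_nonnil ug (m := M).
  by rewrite -rmorphXn fM rmorph0.
have [s [spanP indP]] := H l Rf g gL; have [[uf ufE] _ _] := gL.
have ss j : span_base g V (s j).
  apply/spanP; exists (fun m => (delta_mx 0 j : 'rV_N) 0 m); apply/eqtP => x.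
  by rewrite -(val_comb_delta x j s).
have Hs j : exists Mt : nat * tsec T I,
    V Mt.2 /\ eqt (scalet (g (f l) ^+ Mt.1) (s j)) (tsec_base g Mt.2).
  by have [M [t0 H0]] := span_clear gL (ss j); exists (M, t0).
have [Mt HM] := choice Hs; pose M := (\max_j (Mt j).1)%N.
pose v j := scalet (f l ^+ (M - (Mt j).1)) (Mt j).2.
have vE x j : ptval x (tsec_base g (v j)) = pts x (g (f l) ^+ M) * ptval x (s j).
  rewrite val_base_scalet; have [_ /eqtP/(_ x) <-] := HM j.
  have le : ((Mt j).1 <= M)%N by apply: leq_bigmax.
  by rewrite val_scalet mulrA -rmorphM rmorphXn -exprD subnK.
have gVv j : V (v j) by apply: submod_scale => //; have [] := HM j.
exists v; split=> //.
  move=> t Vt; have /spanP [c /eqtP tc] : span_base g V (tsec_base g t).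
    exists 1%N, (fun=> 1), (fun=> t); split=> //; apply/eqtP => x.
    by rewrite val_lincombt big_ord1 rmorph1 mul1r.
  have [K [a ca]] := loc_mx_clear gL (\row_j c j).
  have e0 : eqt (tsec_base g (subt (scalet (f l ^+ (M + K)) t) (comb a v))) (zerot T _).
    apply/eqtP => x; have /eqtP -> : eqt (tsec_base g (subt (scalet (f l ^+ (M + K)) t) (comb a v)))
       (subt (tsec_base g (scalet (f l ^+ (M + K)) t)) (tsec_base g (comb a v))).
      apply/eqtP => y; rewrite val_subt.
      move/eqtP: (base_lincombt g (fun j : 'I_2 => if j == 0 then 1 else -1)
        (fun j => if j == 0 then scalet (f l ^+ (M + K)) t else comb a v)) => /(_ y) ->.
      rewrite val_lincombt !big_ord_recl big_ord0 /=.
      by rewrite rmorph1 rmorph1 rmorphN1 rmorphN1 mul1r mulN1r addr0.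
    rewrite val_subt val_zerot val_base_scalet tc val_base_comb -ca val_combZ.
    have -> : ptval x (comb (\row_j c j) (fun j => tsec_base g (v j))) =
        pts x (g (f l) ^+ M) * ptval x (lincombt c s).
      rewrite val_comb val_lincombt mulr_sumr; apply: eq_bigr => j _.
      by rewrite mxE vE mulrCA.
    by rewrite mulrA -rmorphM -exprD addnC rmorphXn subrr.
  have [|K' /eqtP e1] := tsec_torsion (delta := delta) (m := i) _ gL e0.
    by apply: Vtsec; apply: submod_sub => //; [apply: submod_scale|apply: submod_comb].
  exists (K' + (M + K))%N, (f l ^+ K' *: a); apply/eqtP => x.
  have /eqP := e1 x; rewrite val_lincombt big_ord1 val_subt val_zerot mulrBr subr_eq0 => /eqP.
  by rewrite val_combZ !val_scalet => <-; rewrite [f l ^+ (K' + _)]exprD rmorphM -mulrA.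
move=> R' g' c gf c0.
have [h hg] := loc_khom gL gf.
have c0' : eqt (lincombt (fun j => c 0 j * h (g (f l) ^+ M)) (fun j => tsec_base h (s j))) (zerot T _).
  have /eqtP c1 : eqt (comb c (fun j => tsec_base h (tsec_base g (v j)))) (zerot T _).
    by apply/(lincombt_base_comp _ _ hg).
  apply/eqtP => x; rewrite -(c1 x) val_comb val_lincombt; apply: eq_bigr => j _.
  rewrite rmorphM -mulrA; congr (_ * _).
  have sE : eqt (tsec_base g (v j)) (scalet (g (f l) ^+ M) (s j)).
    by apply/eqtP => y; rewrite vE val_scalet.
  by move/(base_eqt h)/eqtP: sE => ->; rewrite val_base_scalet.
have c2 := indP R' h _ c0'; apply/rowP => j; rewrite mxE.
apply: (unitl_inj (u := h (g (f l) ^+ M)) (v := h (uf ^+ M))).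
  by rewrite -rmorphM unitlX // rmorph1.
by rewrite c2 mul0r.
Qed.

End FixR.

Lemma cover_locally_free (R : kalg k) (I : invertible (idX X) R) (V : tsec T I -> Prop)
    (r : int) N M (f : 'I_M -> R) : N%:Z = r + 1 -> generates_unit_ideal f ->
  (forall l, exists v : 'I_N -> tsec T I, loc_basis V (f l) v) -> locally_free_subsheaf r V.
Proof.
move=> Nr f1 H; exists N => //; exists M, f; split=> // l Rf g gL.
have [v vb] := H l; have [gf _ _] := gL.
have vb' := loc_basis_base g vb.
exists (fun j => tsec_base g (v j)); split.
  move=> t; split=> [Vt|[c tc]]; last first.
    by exists N, c, v; split=> //; case: vb.
  by have [c tc] := loc_basis_unit vb' gf Vt; exists (fun j => c 0 j).
move=> R' h c c0 j; have [_ _ indep] := vb'.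
have [u uf] := gf.
have : (\row_j c j : 'rV_N) = 0.
  apply: (indep R' h); first by exists (h u); rewrite -rmorphM uf rmorph1.
  apply/eqtP => x; move/eqtP: c0 => /(_ x) <-; rewrite val_comb val_lincombt.
  by apply: eq_bigr => l' _; rewrite mxE.
by move=> /rowP/(_ j); rewrite !mxE.
Qed.

End LocBasis.

(** * Exactness and splittings *)

Section MatrixSplit.

(** By exactness the rows of 1 - A G lie in the row space of B, which gives (1 - A G) H B = 1 - A G,
    and symmetrically for 1 - B H. In the products A S and B U the correction terms of [S] and [U]
    disappear since A B = B A = 0. *)
Lemma field_split (K : fieldType) N (A B : 'M[K]_N) : A *m B = 0 -> B *m A = 0 ->
  (kermx A <= B)%MS -> (kermx B <= A)%MS ->
  exists S U : 'M[K]_N, A *m S + U *m B = 1%:M /\ B *m U + S *m A = 1%:M.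
Proof.
move=> AB BA kA kB; pose G := pinvmx A; pose H := pinvmx B.
have AGA : A *m G *m A = A by apply: mulmxKpV.
have BHB : B *m H *m B = B by apply: mulmxKpV.
have e1 : (1%:M - A *m G) *m H *m B = 1%:M - A *m G.
  apply: mulmxKpV; apply: submx_trans kA; apply/sub_kermxP.
  by rewrite mulmxBl mul1mx AGA subrr.
have e2 : (1%:M - B *m H) *m G *m A = 1%:M - B *m H.
  apply: mulmxKpV; apply: submx_trans kB; apply/sub_kermxP.
  by rewrite mulmxBl mul1mx BHB subrr.
exists ((1%:M - B *m H) *m G), ((1%:M - A *m G) *m H); rewrite e1 e2.
rewrite !mulmxA !mulmxBr !mulmx1 !mulmxA AB BA !mul0mx !subr0.
by rewrite ![_ + (1%:M - _)]addrC !subrK.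
Qed.

(** D and D' form an endomorphism of the complex, homotopic to zero through S and U. Composing the
    homotopy with an inverse of it would give a contraction; adjugates replace the inverse at the
    price of the determinants. *)
Lemma lift_split (R : comNzRingType) N (A B S U : 'M[R]_N) : A *m B = 0 -> B *m A = 0 ->
  let D := A *m S + U *m B in let D' := B *m U + S *m A in
  exists S1 U1 : 'M[R]_N, A *m S1 + U1 *m B = (\det D * \det D')%:M /\
    B *m U1 + S1 *m A = (\det D * \det D')%:M.
Proof.
move=> AB BA D D'.
have DA : D *m A = A *m D'.
  by rewrite mulmxDl mulmxDr -(mulmxA U) BA mulmx0 addr0 !mulmxA AB mul0mx add0r.
have DB : D' *m B = B *m D.
  by rewrite mulmxDl mulmxDr -(mulmxA S) AB mulmx0 addr0 !mulmxA BA mul0mx add0r.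
have eB : \det D' *: (B *m \adj D) = \det D *: (\adj D' *m B).
  rewrite -mul_scalar_mx -mul_adj_mx -!mulmxA [D' *m _]mulmxA DB -[B *m D *m _]mulmxA.
  by rewrite mul_mx_adj mul_mx_scalar -scalemxAr.
have eA : \det D' *: (\adj D *m A) = \det D *: (A *m \adj D').
  rewrite -[RHS]mul_scalar_mx -mul_adj_mx -[RHS]mulmxA [D *m _]mulmxA DA -[A *m D' *m _]mulmxA.
  by rewrite mul_mx_adj mul_mx_scalar -scalemxAr.
exists (\det D' *: (S *m \adj D)), (\det D *: (U *m \adj D')); split.
  rewrite -scalemxAr -scalemxAl -[U *m _ *m B]mulmxA [X in _ + X]scalemxAr -eB -scalemxAr.
  by rewrite !mulmxA -scalerDr -mulmxDl mul_mx_adj scale_scalar_mx mulrC.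
rewrite -scalemxAr -scalemxAl -[S *m _ *m A]mulmxA [X in _ + X]scalemxAr eA -scalemxAr.
by rewrite !mulmxA -scalerDr -mulmxDl mul_mx_adj scale_scalar_mx.
Qed.

End MatrixSplit.

(** * The maps between consecutive terms in coordinates *)

Section Phi.
Variables (k : closedFieldType) (n : nat) (X : two_component_curve k n) (T : twister X).
Variables (delta : nat) (i : int).
Hypothesis delta_gt0 : (0 < delta)%N.

Section FixR.
Variables (R : kalg k) (I : invertible (idX X) R).
Implicit Types (s t : tsec T I).

Lemma phi_up_lincomb N (c : 'I_N -> R) (s t : 'I_N -> tsec T I) :
  (forall j, phi_up delta i (s j) (t j)) -> phi_up delta i (lincombt c s) (lincombt c t).
Proof.
move=> st; split=> [p e tau|p e tau]; rewrite /= /lincomb.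
  by rewrite big1 // => j _; have [-> _] := st j; rewrite mulr0.
by rewrite mulr_sumr; apply: eq_bigr => j _; have [_ ->] := st j; rewrite mulrCA.
Qed.

Lemma phi_down_lincomb N (c : 'I_N -> R) (s t : 'I_N -> tsec T I) :
  (forall j, phi_down delta i (s j) (t j)) -> phi_down delta i (lincombt c s) (lincombt c t).
Proof.
move=> st; split=> [p e tau|p e tau]; rewrite /= /lincomb.
  by rewrite mulr_sumr; apply: eq_bigr => j _; have [-> _] := st j; rewrite mulrCA.
by rewrite big1 // => j _; have [_ ->] := st j; rewrite mulr0.
Qed.

Lemma phi_up_eqt s s' t t' : eqt s s' -> eqt t t' -> phi_up delta i s t -> phi_up delta i s' t'.
Proof.
move=> [_ _ sZ] [_ tY tZ] [h1 h2]; split=> p e tau; first by rewrite -tY h1.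
by rewrite -tZ h2 sZ.
Qed.

Lemma phi_down_eqt s s' t t' :
  eqt s s' -> eqt t t' -> phi_down delta i s t -> phi_down delta i s' t'.
Proof.
move=> [_ sY _] [_ tY tZ] [h1 h2]; split=> p e tau; last by rewrite -tZ h2.
by rewrite -tY h1 sY.
Qed.

Lemma phi_up_fun m s t t' : is_tsec delta m t -> is_tsec delta m t' ->
  phi_up delta i s t -> phi_up delta i s t' -> eqt t t'.
Proof.
move=> tP tP' [h1 h2] [h1' h2']; apply: tsec_ext tP tP' _ _ => p e tau.
  by rewrite h1 h1'.
by rewrite h2 h2'.
Qed.

Lemma phi_down_fun m s t t' : is_tsec delta m t -> is_tsec delta m t' ->
  phi_down delta i s t -> phi_down delta i s t' -> eqt t t'.
Proof.
move=> tP tP' [h1 h2] [h1' h2']; apply: tsec_ext tP tP' _ _ => p e tau.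
  by rewrite h1 h1'.
by rewrite h2 h2'.
Qed.

Lemma phi_up_down m s t t' : is_tsec delta m t' -> phi_up delta i s t ->
  phi_down delta i t t' -> eqt t' (zerot T I).
Proof.
move=> tP' [h1 _] [h1' h2']; apply: tsec_ext tP' (zerot_is_tsec _ _ _ _) _ _ => p e tau.
  by rewrite h1' h1 mulr0.
by rewrite h2'.
Qed.

Lemma phi_down_up m s t t' : is_tsec delta m t' -> phi_down delta i s t ->
  phi_up delta i t t' -> eqt t' (zerot T I).
Proof.
move=> tP' [_ h2] [h1' h2']; apply: tsec_ext tP' (zerot_is_tsec _ _ _ _) _ _ => p e tau.
  by rewrite h1'.
by rewrite h2' h2 mulr0.
Qed.

Lemma phi_up_scale a s t : phi_up delta i s t -> phi_up delta i (scalet a s) (scalet a t).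
Proof. by move=> st; apply: phi_up_lincomb. Qed.

Lemma phi_down_scale a s t : phi_down delta i s t -> phi_down delta i (scalet a s) (scalet a t).
Proof. by move=> st; apply: phi_down_lincomb. Qed.

Lemma phi_up0_unit a u s : u * a = 1 ->
  phi_up delta i (scalet a s) (zerot T I) -> phi_up delta i s (zerot T I).
Proof.
move=> ua [h1 h2]; split=> // p e tau; apply: (unitl_inj (u := cstr p a) (v := cstr p u)).
  by rewrite -rmorphM ua rmorph1.
have := h2 p e tau; rewrite /= /lincomb big_ord1 /zerosec => h.
by rewrite mul0r [LHS]h mulrCA mulrC.
Qed.

Lemma phi_down0_unit a u s : u * a = 1 ->
  phi_down delta i (scalet a s) (zerot T I) -> phi_down delta i s (zerot T I).
Proof.
move=> ua [h1 h2]; split=> // p e tau; apply: (unitl_inj (u := cstr p a) (v := cstr p u)).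
  by rewrite -rmorphM ua rmorph1.
have := h1 p e tau; rewrite /= /lincomb big_ord1 /zerosec => h.
by rewrite mul0r [LHS]h mulrCA mulrC.
Qed.

End FixR.

Lemma phi_up_base (R R' : kalg k) (g : khom R R') (I : invertible (idX X) R) (s t : tsec T I) :
  phi_up delta i s t -> phi_up delta i (tsec_base g s) (tsec_base g t).
Proof.
move=> [h1 h2]; split=> p e tau; first exact: (h1 (cbase g p) e tau).
exact: (h2 (cbase g p) e tau).
Qed.

Lemma phi_down_base (R R' : kalg k) (g : khom R R') (I : invertible (idX X) R) (s t : tsec T I) :
  phi_down delta i s t -> phi_down delta i (tsec_base g s) (tsec_base g t).
Proof.
move=> [h1 h2]; split=> p e tau; first exact: (h1 (cbase g p) e tau).
exact: (h2 (cbase g p) e tau).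
Qed.

Definition adjacent (R : kalg k) (I : invertible (idX X) R) (V W : tsec T I -> Prop) : Prop :=
  [/\ (forall s, V s -> is_tsec delta i s) /\ (forall s, W s -> is_tsec delta (i + 1) s),
      submodule V /\ submodule W,
      forall s, V s -> exists2 t, W t & phi_up delta i s t &
      forall s, W s -> exists2 t, V t & phi_down delta i s t].

Lemma span_base_tsec (R R' : kalg k) (g : khom R R') (I : invertible (idX X) R)
    (V : tsec T I -> Prop) m : (forall s, V s -> is_tsec delta m s) ->
  forall s, span_base g V s -> is_tsec delta m s.
Proof.
move=> Vt s [N [c [w [Vw sw]]]]; apply: eqt_is_tsec (eqt_sym sw) _.
by apply: lincombt_is_tsec => j; apply: tsec_base_is_tsec; apply: Vt.
Qed.

Lemma adjacent_base (R R' : kalg k) (g : khom R R') (I : invertible (idX X) R)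
    (V W : tsec T I -> Prop) :
  adjacent V W -> adjacent (span_base g V) (span_base g W).
Proof.
move=> [[Vt Wt] [smV smW] up down]; split.
- by split; apply: span_base_tsec.
- by split; apply: span_base_submodule.
- move=> s [N [c [w [Vw sw]]]]; have H j : exists t, W t /\ phi_up delta i (w j) t.
    by have [t Wt' ut] := up _ (Vw j); exists t.
  have [t Ht] := choice H.
  exists (lincombt c (fun j => tsec_base g (t j))).
    by exists N, c, t; split=> // j; have [] := Ht j.
  apply: phi_up_eqt (eqt_sym sw) (eqt_refl _) _.
  by apply: phi_up_lincomb => j; apply: phi_up_base; have [] := Ht j.
- move=> s [N [c [w [Vw sw]]]]; have H j : exists t, V t /\ phi_down delta i (w j) t.
    by have [t Wt' ut] := down _ (Vw j); exists t.
  have [t Ht] := choice H.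
  exists (lincombt c (fun j => tsec_base g (t j))).
    by exists N, c, t; split=> // j; have [] := Ht j.
  apply: phi_down_eqt (eqt_sym sw) (eqt_refl _) _.
  by apply: phi_down_lincomb => j; apply: phi_down_base; have [] := Ht j.
Qed.

(** Only kernels inside images are required; the opposite inclusions follow from the shape of
    [phi_up] and [phi_down]. *)
Definition exact_pair (R : kalg k) (I : invertible (idX X) R) (V W : tsec T I -> Prop) : Prop :=
  (forall t, W t -> phi_down delta i t (zerot T I) -> exists2 s, V s & phi_up delta i s t) /\
  (forall t, V t -> phi_up delta i t (zerot T I) -> exists2 s, W s & phi_down delta i s t).

Section Coordinates.
Variables (R : kalg k) (I : invertible (idX X) R) (V W : tsec T I -> Prop).
Hypothesis VW : adjacent V W.
Variables (N : nat).
Implicit Types (v w : 'I_N -> tsec T I) (f : R).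

(* The matrices, up to a power of f, of the maps between V and W. *)
Definition coords f M v w (A B : 'M[R]_N) : Prop :=
  [/\ forall j, phi_up delta i (scalet (f ^+ M) (v j)) (comb (row j A) w),
      forall j, phi_down delta i (scalet (f ^+ M) (w j)) (comb (row j B) v),
      A *m B = 0 & B *m A = 0].

Lemma coords_scale f M v w A B a M' b : a * f ^+ M = b ^+ M' -> coords f M v w A B ->
  coords b M' v w (a *: A) (a *: B).
Proof.
move=> ab [up down AB BA]; split.
- move=> j; apply: phi_up_eqt (phi_up_scale a (up j)); apply/eqtP => x.
    by rewrite !val_scalet -ab rmorphM mulrA.
  by rewrite val_scalet linearZ /= val_combZ.
- move=> j; apply: phi_down_eqt (phi_down_scale a (down j)); apply/eqtP => x.
    by rewrite !val_scalet -ab rmorphM mulrA.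
  by rewrite val_scalet linearZ /= val_combZ.
- by rewrite -scalemxAl -scalemxAr AB !scaler0.
- by rewrite -scalemxAl -scalemxAr BA !scaler0.
Qed.

Lemma coords_up f M v w A B (c : 'rV[R]_N) : coords f M v w A B ->
  phi_up delta i (scalet (f ^+ M) (comb c v)) (comb (c *m A) w).
Proof.
move=> [up _ _ _]; apply: phi_up_eqt (phi_up_lincomb (fun j => c 0 j) up).
  apply/eqtP => x; rewrite val_lincombt val_scalet val_comb mulr_sumr.
  by apply: eq_bigr => j _; rewrite val_scalet mulrCA.
by apply/eqtP => x; rewrite val_lincombt val_comb_mulmx.
Qed.

Lemma coords_down f M v w A B (c : 'rV[R]_N) : coords f M v w A B ->
  phi_down delta i (scalet (f ^+ M) (comb c w)) (comb (c *m B) v).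
Proof.
move=> [_ down _ _]; apply: phi_down_eqt (phi_down_lincomb (fun j => c 0 j) down).
  apply/eqtP => x; rewrite val_lincombt val_scalet val_comb mulr_sumr.
  by apply: eq_bigr => j _; rewrite val_scalet mulrCA.
by apply/eqtP => x; rewrite val_lincombt val_comb_mulmx.
Qed.

Lemma loc_basis_span_mx f (V' : tsec T I -> Prop) (v : 'I_N -> tsec T I) K (t : 'I_K -> tsec T I) :
  loc_basis V' f v -> (forall j, V' (t j)) ->
  exists M (A : 'M[R]_(K, N)), forall j, eqt (scalet (f ^+ M) (t j)) (comb (row j A) v).
Proof.
move=> [_ sp _] Vt.
have H j : exists Mc : nat * 'rV[R]_N, eqt (scalet (f ^+ Mc.1) (t j)) (comb Mc.2 v).
  by have [M [c e]] := sp _ (Vt j); exists (M, c).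
have [Mc HM] := choice H; pose M := (\max_j (Mc j).1)%N.
exists M, (\matrix_(j, l) (f ^+ (M - (Mc j).1) * (Mc j).2 0 l)) => j.
apply/eqtP => x; have le : ((Mc j).1 <= M)%N by apply: leq_bigmax.
have -> : row j (\matrix_(j, l) (f ^+ (M - (Mc j).1) * (Mc j).2 0 l)) =
    f ^+ (M - (Mc j).1) *: (Mc j).2 by apply/rowP => l; rewrite !mxE.
move/eqtP: (HM j) => /(_ x); rewrite val_combZ val_scalet => <-.
by rewrite val_scalet mulrA -rmorphM -exprD subnK.
Qed.

Lemma loc_basis_indep_mx f (V' : tsec T I -> Prop) (v : 'I_N -> tsec T I) K (A : 'M[R]_(K, N)) :
  loc_basis V' f v -> (forall j, eqt (comb (row j A) v) (zerot T I)) ->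
  exists M, f ^+ M *: A = 0.
Proof.
move=> Vv H.
have H' j : exists M, f ^+ M *: row j A = 0 by apply: loc_basis_indep Vv (H j).
have [M HM] := choice H'; exists (\max_j M j)%N; apply/row_matrixP => j.
have le : (M j <= \max_j M j)%N by apply: leq_bigmax.
by rewrite linearZ /= row0 -(subnK le) exprD -scalerA HM scaler0.
Qed.

Lemma coords_exist f v w : loc_basis V f v -> loc_basis W f w -> exists M A B, coords f M v w A B.
Proof.
move=> Vv Ww; have [[Vt Wt] [smV smW] up down] := VW.
have [Vv' _ _] := Vv; have [Ww' _ _] := Ww.
have H j : exists t, W t /\ phi_up delta i (v j) t by have [t ? ?] := up _ (Vv' j); exists t.
have [t Ht] := choice H.
have H' j : exists t, V t /\ phi_down delta i (w j) t by have [u ? ?] := down _ (Ww' j); exists u.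
have [u Hu] := choice H'.
have [M [A HA]] := loc_basis_span_mx Ww (fun j => proj1 (Ht j)).
have [M' [B HB]] := loc_basis_span_mx Vv (fun j => proj1 (Hu j)).
pose A1 := f ^+ M' *: A; pose B1 := f ^+ M *: B.
have up1 j : phi_up delta i (scalet (f ^+ (M + M')) (v j)) (comb (row j A1) w).
  apply: phi_up_eqt (phi_up_scale (f ^+ (M + M')) (proj2 (Ht j))); first exact: eqt_refl.
  apply/eqtP => x; rewrite linearZ /= val_combZ; move/eqtP: (HA j) => <-.
  by rewrite !val_scalet mulrA -rmorphM -exprD addnC.
have down1 j : phi_down delta i (scalet (f ^+ (M + M')) (w j)) (comb (row j B1) v).
  apply: phi_down_eqt (phi_down_scale (f ^+ (M + M')) (proj2 (Hu j))); first exact: eqt_refl.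
  apply/eqtP => x; rewrite linearZ /= val_combZ; move/eqtP: (HB j) => <-.
  by rewrite !val_scalet mulrA -rmorphM -exprD.
have lup (c : 'rV[R]_N) : phi_up delta i (scalet (f ^+ (M + M')) (comb c v)) (comb (c *m A1) w).
  apply: phi_up_eqt (phi_up_lincomb (fun j => c 0 j) up1).
    apply/eqtP => x; rewrite val_lincombt val_scalet val_comb mulr_sumr.
    by apply: eq_bigr => j _; rewrite val_scalet mulrCA.
  by apply/eqtP => x; rewrite val_lincombt val_comb_mulmx.
have ldown (c : 'rV[R]_N) : phi_down delta i (scalet (f ^+ (M + M')) (comb c w)) (comb (c *m B1) v).
  apply: phi_down_eqt (phi_down_lincomb (fun j => c 0 j) down1).
    apply/eqtP => x; rewrite val_lincombt val_scalet val_comb mulr_sumr.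
    by apply: eq_bigr => j _; rewrite val_scalet mulrCA.
  by apply/eqtP => x; rewrite val_lincombt val_comb_mulmx.
(* The composites vanish on sections, but coordinates are determined only up to torsion. The powers
   found here and for [BA] are absorbed into the matrices. *)
have [K1 AB] : exists M, f ^+ M *: (A1 *m B1) = 0.
  apply: loc_basis_indep_mx Vv _ => j; rewrite row_mul.
  apply: (phi_up_down (m := i) _ (phi_up_scale (f ^+ (M + M')) (up1 j)) (ldown _)).
  by apply: Vt; apply: submod_comb.
have [K2 BA] : exists M, f ^+ M *: (B1 *m A1) = 0.
  apply: loc_basis_indep_mx Ww _ => j; rewrite row_mul.
  apply: (phi_down_up (m := i + 1) _ (phi_down_scale (f ^+ (M + M')) (down1 j)) (lup _)).
  by apply: Wt; apply: submod_comb.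
pose a := f ^+ (K1 + K2).
exists (K1 + K2 + (M + M'))%N, (a *: A1), (a *: B1); split.
- move=> j; apply: phi_up_eqt (phi_up_scale a (up1 j)); apply/eqtP => x.
    by rewrite !val_scalet [in RHS]exprD [in RHS]rmorphM mulrA.
  by rewrite val_scalet [in RHS]linearZ /= val_combZ.
- move=> j; apply: phi_down_eqt (phi_down_scale a (down1 j)); apply/eqtP => x.
    by rewrite !val_scalet [in RHS]exprD [in RHS]rmorphM mulrA.
  by rewrite val_scalet [in RHS]linearZ /= val_combZ.
- by rewrite -scalemxAl -scalemxAr {2}/a addnC exprD -scalerA AB !scaler0.
- by rewrite -scalemxAl -scalemxAr {2}/a exprD -scalerA BA !scaler0.
Qed.

End Coordinates.
End Phi.

(** * From exact fibres to exactness *)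

Section Exactness.
Variables (k : closedFieldType) (n : nat) (X : two_component_curve k n) (T : twister X).
Variables (delta : nat) (i : int).
Hypothesis delta_gt0 : (0 < delta)%N.

Lemma coords_base N (R R' : kalg k) (g : khom R R') (I : invertible (idX X) R) f M
    (v w : 'I_N -> tsec T I) A B :
  coords delta i f M v w A B ->
  coords delta i (g f) M (fun j => tsec_base g (v j)) (fun j => tsec_base g (w j))
    (map_mx g A) (map_mx g B).
Proof.
move=> [up down AB BA]; split.
- move=> j; apply: phi_up_eqt (phi_up_base g (up j)); apply/eqtP => x.
    by rewrite val_base_scalet val_scalet rmorphXn.
  by rewrite val_base_comb map_row.
- move=> j; apply: phi_down_eqt (phi_down_base g (down j)); apply/eqtP => x.
    by rewrite val_base_scalet val_scalet rmorphXn.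
  by rewrite val_base_comb map_row.
- by rewrite -map_mxM AB map_mx0.
- by rewrite -map_mxM BA map_mx0.
Qed.

Section FixR.
Variables (R : kalg k) (I : invertible (idX X) R) (V W : tsec T I -> Prop) (N : nat).
Hypothesis VW : adjacent delta i V W.
Implicit Types (v w : 'I_N -> tsec T I) (f e : R).

(** Where [f] is invertible, rows c with c A = 0 are the coordinates of sections killed by [phi_up];
    exactness provides a preimage in [W], whose coordinates give [d]. *)
Lemma exact_kermxV (f u : R) M v w A B : loc_basis V f v -> loc_basis W f w -> u * f = 1 ->
  coords delta i f M v w A B -> exact_pair delta i V W ->
  forall c : 'rV[R]_N, c *m A = 0 -> exists d, c = d *m B.
Proof.
move=> Vv Ww uf co [_ ex] c cA; have [[Vt Wt] [smV smW] up down] := VW.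
have [Vv' _ indep] := Vv; have uM := unitlX M uf.
have phi0 : phi_up delta i (comb c v) (zerot T I).
  apply: (phi_up0_unit uM); apply: phi_up_eqt (coords_up c co); first exact: eqt_refl.
  by apply/eqtP => x; rewrite cA val_comb0 val_zerot.
have [s Ws sd] := ex _ (submod_comb smV c Vv') phi0.
have [|d sE] := loc_basis_unit Ww _ Ws; first by exists u.
exists (u ^+ M *: d); rewrite -scalemxAl.
have e1 : eqt (scalet (f ^+ M) (comb c v)) (comb (d *m B) v).
  apply: (phi_down_fun (m := i)) (phi_down_eqt _ (eqt_refl _) (phi_down_scale (f ^+ M) sd)) (coords_down d co).
  - by apply: Vt; apply: submod_scale => //; apply: submod_comb.
  - by apply: Vt; apply: submod_comb.
  by apply/eqtP => x; rewrite !val_scalet; move/eqtP: sE => ->.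
have e2 : f ^+ M *: c - d *m B = 0.
  have [l] : exists l, f ^+ l *: (f ^+ M *: c - d *m B) = 0.
    apply: (loc_basis_indep Vv); apply/eqtP => x; rewrite val_combB val_combZ.
    by move/eqtP: e1 => /(_ x) <-; rewrite val_scalet subrr val_zerot.
  move=> e0; rewrite -[_ - _]scale1r -(unitlX l uf) -scalerA e0.
  by rewrite scaler0.
by rewrite -[c in LHS]scale1r -uM -scalerA (subr0_eq e2).
Qed.

Lemma exact_kermxW (f u : R) M v w A B : loc_basis V f v -> loc_basis W f w -> u * f = 1 ->
  coords delta i f M v w A B -> exact_pair delta i V W ->
  forall c : 'rV[R]_N, c *m B = 0 -> exists d, c = d *m A.
Proof.
move=> Vv Ww uf co [ex _] c cB; have [[Vt Wt] [smV smW] up down] := VW.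
have [Ww' _ indep] := Ww; have uM := unitlX M uf.
have phi0 : phi_down delta i (comb c w) (zerot T I).
  apply: (phi_down0_unit uM); apply: phi_down_eqt (coords_down c co); first exact: eqt_refl.
  by apply/eqtP => x; rewrite cB val_comb0 val_zerot.
have [s Vs sd] := ex _ (submod_comb smW c Ww') phi0.
have [|d sE] := loc_basis_unit Vv _ Vs; first by exists u.
exists (u ^+ M *: d); rewrite -scalemxAl.
have e1 : eqt (scalet (f ^+ M) (comb c w)) (comb (d *m A) w).
  apply: (phi_up_fun (m := i + 1)) (phi_up_eqt _ (eqt_refl _) (phi_up_scale (f ^+ M) sd)) (coords_up d co).
  - by apply: Wt; apply: submod_scale => //; apply: submod_comb.
  - by apply: Wt; apply: submod_comb.
  by apply/eqtP => x; rewrite !val_scalet; move/eqtP: sE => ->.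
have e2 : f ^+ M *: c - d *m A = 0.
  have [l] : exists l, f ^+ l *: (f ^+ M *: c - d *m A) = 0.
    apply: (loc_basis_indep Ww); apply/eqtP => x; rewrite val_combB val_combZ.
    by move/eqtP: e1 => /(_ x) <-; rewrite val_scalet subrr val_zerot.
  move=> e0; rewrite -[_ - _]scale1r -(unitlX l uf) -scalerA e0.
  by rewrite scaler0.
by rewrite -[c in LHS]scale1r -uM -scalerA (subr0_eq e2).
Qed.

(* S and U form a contracting homotopy of the complex V -> W -> V -> ..., so
   the complex is split exact where e is invertible. *)
Definition splitting e v w (A B S U : 'M[R]_N) M K : Prop :=
  [/\ loc_basis V e v, loc_basis W e w, coords delta i e M v w A B,
      A *m S + U *m B = (e ^+ K)%:M & B *m U + S *m A = (e ^+ K)%:M].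

End FixR.

Section Fibres.
Variables (R : kalg k) (I : invertible (idX X) R) (V W : tsec T I -> Prop) (N : nat).
Hypothesis VW : adjacent delta i V W.
Hypothesis exK : forall (K : fieldType) (j : {rmorphism k -> K}) (g : khom R (KAlg j)),
  exact_pair delta i (span_base g V) (span_base g W).
Implicit Types (v w : 'I_N -> tsec T I) (f e : R).

Lemma split_near (Mx : R -> Prop) f v w : max_ideal Mx -> ~ Mx f ->
  loc_basis V f v -> loc_basis W f w ->
  exists e A B S U M K, ~ Mx e /\ splitting V W e v w A B S U M K.
Proof.
move=> mM nMf Vv Ww; have [M [A [B co]]] := coords_exist VW Vv Ww.
have [K [g [gs gM]]] := residue_field mM.
pose j : {rmorphism k -> K} := g \o kstr R.
pose g' : khom R (KAlg j) := @KHom k R (KAlg j) g (fun=> erefl).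
have gf0 : g f != 0 by apply/eqP => /gM.
have uf : (g f)^-1 * g' f = 1 by apply: mulVf.
have co' := coords_base g' co.
have [_ _ AB BA] := co'.
have Vv' := loc_basis_base g' Vv; have Ww' := loc_basis_base g' Ww.
have VW' := adjacent_base g' VW.
have ex := exK g'.
have kA : (kermx (map_mx g A) <= map_mx g B)%MS.
  apply/rV_subP => c /sub_kermxP cA.
  have [d ->] := exact_kermxV VW' Vv' Ww' uf co' ex cA.
  exact: submxMl.
have kB : (kermx (map_mx g B) <= map_mx g A)%MS.
  apply/rV_subP => c /sub_kermxP cB.
  have [d ->] := exact_kermxW VW' Vv' Ww' uf co' ex cB.
  exact: submxMl.
have [S0 [U0 [h1 h2]]] := field_split AB BA kA kB.
have lift (C : 'M[K]_N) : exists C', map_mx g C' = C.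
  have [C' HC] := choice (fun ij : 'I_N * 'I_N => gs (C ij.1 ij.2)).
  by exists (\matrix_(a, b) C' (a, b)); apply/matrixP => a b; rewrite !mxE HC.
have [S eS] := lift S0; have [U eU] := lift U0.
have [_ _ AB0 BA0] := co.
(* The lifts contract the complex up to two matrices that reduce to 1 modulo [Mx]; so the product
   [d] of their determinants is not in [Mx]. *)
have [S1 [U1 [H1 H2]]] := lift_split S U AB0 BA0.
set d := \det _ * \det _ in H1 H2.
have nMd : ~ Mx d.
  move=> /gM; rewrite /d rmorphM -!det_map_mx !map_mxD !map_mxM eS eU.
  rewrite -[X in \det X * _]/(map_mx g A *m S0 + U0 *m map_mx g B) h1.
  rewrite -[X in _ * \det X]/(map_mx g B *m U0 + S0 *m map_mx g A) h2.
  by rewrite !det1 mulr1 => /eqP; rewrite oner_eq0.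
clearbody d.
(* For e = f d the maps are scaled by d ^ M, since [coords] is normalized by e ^ M. With f ^ (M + 1)
   on the homotopies the total factor becomes e ^ (M + 1). *)
exists (f * d), (d ^+ M *: A), (d ^+ M *: B), (f ^+ M.+1 *: S1), (f ^+ M.+1 *: U1), M, M.+1.
split; first by apply: max_ideal_mulN.
split.
- exact: loc_basis_mul.
- exact: loc_basis_mul.
- by apply: (coords_scale _ co); rewrite exprMn mulrC.
- rewrite -!scalemxAl -!scalemxAr !scalerA [f ^+ _ * _]mulrC -scalerDr H1.
  by rewrite scale_scalar_mx mulrAC -exprSr mulrC -exprMn.
- rewrite -!scalemxAl -!scalemxAr !scalerA [f ^+ _ * _]mulrC -scalerDr H2.
  by rewrite scale_scalar_mx mulrAC -exprSr mulrC -exprMn.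
Qed.

End Fibres.

Section Exact.
Variables (R : kalg k) (I : invertible (idX X) R) (V W : tsec T I -> Prop) (r : int).
Hypothesis VW : adjacent delta i V W.
Hypotheses (Vr : locally_free_subsheaf r V) (Wr : locally_free_subsheaf r W).
Hypothesis exK : forall (K : fieldType) (j : {rmorphism k -> K}) (g : khom R (KAlg j)),
  exact_pair delta i (span_base g V) (span_base g W).

Lemma split_cover : exists N : nat, N%:Z = r + 1 /\ forall Mx : R -> Prop, max_ideal Mx ->
  exists e (v w : 'I_N -> tsec T I) A B S U M K, ~ Mx e /\ splitting V W e v w A B S U M K.
Proof.
have [[Vt Wt] [smV smW] up down] := VW.
have [N [Nr [m [f [f1 Hf]]]]] := locally_free_cover smV Vt Vr.
have [N' [Nr' [m' [f' [f1' Hf']]]]] := locally_free_cover smW Wt Wr.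
have eN : N' = N by apply/eqP; rewrite -eqz_nat Nr Nr'.
rewrite {}eN in Nr' Hf'; exists N; split=> // Mx mM.
have [l nl] := unit_idealN f1 mM; have [l' nl'] := unit_idealN f1' mM.
have [v Vv] := Hf l; have [w Ww] := Hf' l'.
have [||e H] := split_near (v := v) (w := w) VW exK mM (max_ideal_mulN mM nl nl').
- exact: loc_basis_mul.
- by rewrite mulrC; apply: loc_basis_mul.
by exists e, v, w.
Qed.

Lemma exact_of_fibres : exact_pair delta i V W.
Proof.
have [[Vt Wt] [smV smW] up down] := VW; have [N [_ H]] := split_cover; split=> t.
  move=> Wt' t0.
  (* The image of [V] is a submodule of [W], so membership in it can be tested near each maximal
     ideal, where a splitting is available. *)
  pose V' t := W t /\ exists2 s, V s & phi_up delta i s t.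
  suff [] : V' t by [].
  apply: submod_local; last first.
    move=> Mx mM; have [e [v [w [A [B [S [U [M [K [nMe [Vv Ww co _ h2]]]]]]]]]]] := H Mx mM.
    have [Vv' _ _] := Vv; have [Ww' sp _] := Ww.
    have [m [c tc]] := sp t Wt'.
    have [l cB] : exists l, e ^+ l *: (c *m B) = 0.
      apply: loc_basis_indep Vv _.
      apply: (phi_down_fun (m := i)) (coords_down c co) (phi_down_eqt _ _ (phi_down_scale (e ^+ M * e ^+ m) t0)).
      - by apply: Vt; apply: submod_comb.
      - exact: zerot_is_tsec.
      - by apply/eqtP => x; rewrite !val_scalet; move/eqtP: tc => <-; rewrite val_scalet rmorphM mulrA.
      - by apply/eqtP => x; rewrite val_scalet val_zerot mulr0.
    exists (e ^+ K * (e ^+ l * e ^+ m)); last first.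
      by rewrite -!exprD => /(max_ideal_exp mM).
    split; first exact: submod_scale.
    exists (scalet (e ^+ M) (comb (e ^+ l *: c *m S) v)).
      by apply: submod_scale => //; apply: submod_comb.
    apply: phi_up_eqt (eqt_refl _) _ (coords_up _ co); apply/eqtP => x.
    (* As c B is killed by e ^ l, only the term with S A survives in the homotopy identity. *)
    have -> : e ^+ l *: c *m S *m A = e ^+ K *: (e ^+ l *: c).
      rewrite -[in RHS]mul_mx_scalar -h2 mulmxDr !mulmxA.
      by rewrite -[in RHS]scalemxAl cB mul0mx add0r.
    by rewrite !val_combZ val_scalet; move/eqtP: tc => <-; rewrite val_scalet !rmorphM !mulrA.
  move=> K c s u Vs us; split; first by apply: smW us => j; have [] := Vs j.
  have Hs j : exists t, V t /\ phi_up delta i t (s j) by have [_ [y ? ?]] := Vs j; exists y.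
  have [y Hy] := choice Hs; exists (lincombt c y).
    by apply: smV (eqt_refl _) => j; have [] := Hy j.
  apply: phi_up_eqt (eqt_refl _) (eqt_sym us) _.
  by apply: phi_up_lincomb => j; have [] := Hy j.
move=> Vt' t0.
pose V' t := V t /\ exists2 s, W s & phi_down delta i s t.
suff [] : V' t by [].
apply: submod_local; last first.
  move=> Mx mM; have [e [v [w [A [B [S [U [M [K [nMe [Vv Ww co h1 _]]]]]]]]]]] := H Mx mM.
  have [Vv' sp _] := Vv; have [Ww' _ _] := Ww.
  have [m [c tc]] := sp t Vt'.
  have [l cA] : exists l, e ^+ l *: (c *m A) = 0.
    apply: loc_basis_indep Ww _.
    apply: (phi_up_fun (m := i + 1)) (coords_up c co) (phi_up_eqt _ _ (phi_up_scale (e ^+ M * e ^+ m) t0)).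
    - by apply: Wt; apply: submod_comb.
    - exact: zerot_is_tsec.
    - by apply/eqtP => x; rewrite !val_scalet; move/eqtP: tc => <-; rewrite val_scalet rmorphM mulrA.
    - by apply/eqtP => x; rewrite val_scalet val_zerot mulr0.
  exists (e ^+ K * (e ^+ l * e ^+ m)); last first.
    by rewrite -!exprD => /(max_ideal_exp mM).
  split; first exact: submod_scale.
  exists (scalet (e ^+ M) (comb (e ^+ l *: c *m U) w)).
    by apply: submod_scale => //; apply: submod_comb.
  apply: phi_down_eqt (eqt_refl _) _ (coords_down _ co); apply/eqtP => x.
  have -> : e ^+ l *: c *m U *m B = e ^+ K *: (e ^+ l *: c).
    rewrite -[in RHS]mul_mx_scalar -h1 mulmxDr !mulmxA.
    by rewrite -[in RHS]scalemxAl cA mul0mx add0r.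
  by rewrite !val_combZ val_scalet; move/eqtP: tc => <-; rewrite val_scalet !rmorphM !mulrA.
move=> K c s u Vs us; split; first by apply: smV us => j; have [] := Vs j.
have Hs j : exists t, W t /\ phi_down delta i t (s j) by have [_ [y ? ?]] := Vs j; exists y.
have [y Hy] := choice Hs; exists (lincombt c y).
  by apply: smW (eqt_refl _) => j; have [] := Hy j.
apply: phi_down_eqt (eqt_refl _) (eqt_sym us) _.
by apply: phi_down_lincomb => j; have [] := Hy j.
Qed.

End Exact.
End Exactness.

(** * Refinement of the index *)

Section Indices.
Variables (delta c : nat).
Hypotheses (delta_gt0 : (0 < delta)%N) (c_gt0 : (0 < c)%N).
Local Notation D := (c * delta)%N.

Lemma D_gt0 : (0 < D)%N. Proof. by rewrite muln_gt0 c_gt0. Qed.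

Lemma dvdz_mulc (i : int) : (D %| i * c%:Z)%Z = (delta %| i)%Z.
Proof. by rewrite PoszM [i * _]mulrC dvdz_mul2l // eqz_nat -lt0n. Qed.

Lemma dvdz_interior (i : int) (j : nat) : (0 < j < c)%N -> (D %| i * c%:Z + j%:Z)%Z = false.
Proof.
move=> /andP[j0 jc]; apply/negP => Dm.
have : (c %| i * c%:Z + j%:Z)%Z by apply: dvdz_trans Dm; rewrite PoszM dvdz_mulr.
move=> cm; have : (c %| j%:Z)%Z.
  by rewrite -[j%:Z](addrK (i * c%:Z)) [j%:Z + _]addrC rpredB // dvdz_mull.
by rewrite dvdzE /= gtnNdvd.
Qed.

Lemma mexp_interior (i : int) (j : nat) : (j < c)%N -> mexp D (i * c%:Z + j%:Z) = mexp delta i.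
Proof.
move=> jc; apply: divz_unique; first exact: D_gt0.
  have h : (i %/ delta)%Z * delta%:Z <= i by rewrite lez_floor // eqz_nat -lt0n.
  rewrite PoszM mulrCA (mulrC i).
  apply: (@le_trans _ _ (c%:Z * i)); last by rewrite lerDl.
  by rewrite ler_wpM2l.
have h : i + 1 <= ((i %/ delta)%Z + 1) * delta%:Z by rewrite lezD1 ltz_ceil.
rewrite PoszM mulrCA; apply: (@lt_le_trans _ _ (c%:Z * (i + 1))).
  by rewrite mulrDr mulr1 [c%:Z * i]mulrC ltrD2l ltz_nat.
by rewrite ler_wpM2l // mulrC.
Qed.

Lemma lexp_interior (i : int) (j : nat) : (0 < j <= c)%N ->
  lexp D (i * c%:Z + j%:Z) = lexp delta (i + 1).
Proof.
case: j => // j /= jc; rewrite -addn1 PoszD addrA !lexpS ?D_gt0 //.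
by rewrite mexp_interior.
Qed.

Lemma mexp_c (i : int) : mexp D (i * c%:Z) = mexp delta i.
Proof. by have := mexp_interior i c_gt0; rewrite addr0. Qed.

Lemma lexp_c (i : int) : lexp D (i * c%:Z) = lexp delta i.
Proof.
have -> : i = i - 1 + 1 by rewrite subrK.
rewrite mulrDl mul1r lexp_interior ?c_gt0 ?leqnn //.
Qed.

Lemma int_split (m : int) : exists i (j : nat), (j < c)%N /\ m = i * c%:Z + j%:Z.
Proof.
have c0 : c%:Z != 0 by rewrite eqz_nat -lt0n.
have m0 := modz_ge0 m c0; exists (m %/ c)%Z, `|(m %% c)%Z|%N; split; last first.
  by rewrite gez0_abs // -divz_eq.
by rewrite -ltz_nat gez0_abs // (ltz_mod m c0).
Qed.

End Indices.

Section Refine.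
Variables (k : closedFieldType) (n : nat) (X : two_component_curve k n) (T : twister X).
Variables (delta c : nat).
Hypotheses (delta_gt0 : (0 < delta)%N) (c_gt0 : (0 < c)%N).
Local Notation D := (c * delta)%N.
Local Notation onY L := (restr (@idXY k n X) L).
Local Notation onZ L := (restr (@idXZ k n X) L).
Local Notation TT R := (const_sheaf R T).

Section FixR.
Variables (R : kalg k) (I : invertible (idX X) R).
Implicit Types (s t : tsec T I).

Lemma is_tsec_c (i : int) s : is_tsec D (i * c%:Z) s <-> is_tsec delta i s.
Proof.
rewrite /is_tsec -/(lexp D (i * c%:Z)) -/(mexp D (i * c%:Z)) -/(lexp delta i) -/(mexp delta i).
by rewrite lexp_c // mexp_c // dvdz_mulc.
Qed.

Lemma is_tsec_interior (i : int) (j : nat) s : (0 < j < c)%N ->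
  is_tsec D (i * c%:Z + j%:Z) s <-> [/\ is_section (lexp delta (i + 1)) (tY s),
    is_section (mexp delta i) (tZ s) & eqsec (tX s) (zerosec I _)].
Proof.
move=> /andP[j0 jc].
rewrite /is_tsec -/(lexp D (i * c%:Z + j%:Z)) -/(mexp D (i * c%:Z + j%:Z)).
have j01 : (0 < j <= c)%N by rewrite j0 ltnW.
have j02 : (0 < j < c)%N by rewrite j0.
have e1 := lexp_interior delta_gt0 c_gt0 i j01; have e2 := mexp_interior delta_gt0 c_gt0 i jc.
have e3 := dvdz_interior delta i j02.
by rewrite e1 e2 e3.
Qed.

(** Between i c and (i + 1) c the factor of level delta is concentrated in one step: the lowest one
    on Y, and, in [fZ_D], the highest one on Z. *)
Lemma fY_D (i : int) (j : nat) p (tau : frame (onY (TT R) p)) : (j < c)%N ->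
  fY D (i * c%:Z + j%:Z) tau = if j == 0%N then fY delta i tau else 1.
Proof.
rewrite /fY; case: j => [|j] jc; first by rewrite addr0 dvdz_mulc.
by rewrite dvdz_interior.
Qed.

Lemma fZ_D (i : int) (j : nat) p (tau : frame (onZ (TT R) p)) : (j < c)%N ->
  fZ D (i * c%:Z + j%:Z) tau = if j.+1 == c then fZ delta i tau else 1.
Proof.
rewrite /fZ -addrA -PoszD addn1; case: eqP => [->|/eqP jc'] jc.
  by rewrite -{2}[c%:Z]mul1r -mulrDl dvdz_mulc.
by rewrite dvdz_interior //= ltn_neqAle jc' jc.
Qed.

Variable V : int -> tsec T I -> Prop.
Hypothesis VV : forall m, adjacent D m (V m) (V (m + 1)).

(** The case j = l, in which the section does not change, is included so that the end points of a
    block need no separate treatment later. *)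
Lemma up_iter (i : int) (j l : nat) s : (j <= l <= c)%N -> V (i * c%:Z + j%:Z) s ->
  exists2 t, V (i * c%:Z + l%:Z) t &
    [/\ (j < l)%N -> eqsec (tY t) (zerosec _ _), j = l -> eqsec (tY t) (tY s) &
        forall p e tau, tZ t p e tau =
          (if (j < l)%N && (l == c) then fZ delta i tau else 1) * tZ s p e tau].
Proof.
move=> /andP[jl lc] Vs; elim: l jl lc => [|l IHl] jl lc.
  move: jl; rewrite leqn0 => /eqP j0; rewrite j0 in Vs *.
  by exists s => //; split=> // p e tau; rewrite mul1r.
move: jl; rewrite leq_eqVlt => /orP[/eqP jl|jl].
  rewrite -jl; exists s => //; split=> //; first by rewrite ltnn.
  by move=> p e tau; rewrite ltnn mul1r.
have [t Vt [_ _ tZs]] := IHl jl (ltnW lc).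
have [_ _ up _] := VV (i * c%:Z + l%:Z); have [u Vu [uY uZ]] := up t Vt.
exists u; first by rewrite -addn1 PoszD addrA.
split=> // [jl'|p e tau]; first by rewrite jl' ltnn in jl.
rewrite jl /= uZ -/(fZ D (i * c%:Z + l%:Z) tau) fZ_D // tZs.
by rewrite (ltn_eqF lc) andbF mul1r.
Qed.

Lemma down_iter (i : int) (j l : nat) s : (j <= l <= c)%N -> V (i * c%:Z + l%:Z) s ->
  exists2 t, V (i * c%:Z + j%:Z) t &
    [/\ (j < l)%N -> eqsec (tZ t) (zerosec _ _), j = l -> eqsec (tZ t) (tZ s) &
        forall p e tau, tY t p e tau =
          (if (j < l)%N && (j == 0%N) then fY delta i tau else 1) * tY s p e tau].
Proof.
move=> /andP[]; have [a] := ubnP (l - j)%N.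
elim: a j => // a IHa j laj; rewrite leq_eqVlt => /orP[/eqP jl|jl] lc Vs.
  rewrite jl; exists s => //; split=> //; first by rewrite ltnn.
  by move=> p e tau; rewrite ltnn mul1r.
have [|t Vt [_ _ tYs]] := IHa j.+1 _ jl lc Vs.
  by rewrite subnS -ltnS prednK // subn_gt0.
have [_ _ _ down] := VV (i * c%:Z + j%:Z).
have [|u Vu [uY uZ]] := down t; first by rewrite -addrA -PoszD addn1.
exists u => //; split=> // [jl'|p e tau]; first by rewrite jl' ltnn in jl.
rewrite jl /= uY -/(fY D (i * c%:Z + j%:Z) tau) fY_D ?(leq_trans jl) // tYs.
by rewrite andbF mul1r.
Qed.

Lemma coarse_adjacent (i : int) :
  adjacent delta i (V (i * c%:Z)) (V ((i + 1) * c%:Z)).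
Proof.
have ic : (i + 1) * c%:Z = i * c%:Z + c%:Z by rewrite mulrDl mul1r.
have [[Vt _] [smV _] _ _] := VV (i * c%:Z); have [[Wt _] [smW _] _ _] := VV ((i + 1) * c%:Z).
split; [split|by split| |].
- by move=> s /Vt /is_tsec_c.
- by move=> s /Wt /is_tsec_c.
- rewrite -[i * c%:Z]addr0 => s Vs.
  have [|t Vt' [tY _ tZ]] := @up_iter i 0 c s _ Vs; first by rewrite leq0n leqnn.
  exists t; first by rewrite ic.
  by split=> [|p e tau]; [apply: tY|rewrite tZ eqxx c_gt0].
rewrite ic => s Vs.
have [|t Vt' [tZ _ tY]] := @down_iter i 0 c s _ Vs; first by rewrite leq0n leqnn.
exists t; first by rewrite addr0 in Vt'.
by split=> [p e tau|]; [rewrite tY eqxx c_gt0|apply: tZ].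
Qed.

(** A section killed by [phi_down] lives on Z alone, so pushing it up to (i + 1) c loses nothing;
    the preimage found at i c is pushed up to index i c + j. The other half is symmetric, on Y. *)
Lemma exact_refine (i : int) (j : nat) : (j < c)%N ->
  exact_pair delta i (V (i * c%:Z)) (V ((i + 1) * c%:Z)) ->
  exact_pair D (i * c%:Z + j%:Z) (V (i * c%:Z + j%:Z)) (V (i * c%:Z + j%:Z + 1)).
Proof.
have ic : (i + 1) * c%:Z = i * c%:Z + c%:Z by rewrite mulrDl mul1r.
have jS : i * c%:Z + j%:Z + 1 = i * c%:Z + j.+1%:Z by rewrite -addrA -PoszD addn1.
move=> jc [exu exd]; have [[Vt Wt] _ _ _] := VV (i * c%:Z + j%:Z).
have V0 : V (i * c%:Z) = V (i * c%:Z + 0%:Z) by rewrite addr0.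
split=> t Vt' [h1 h2].
  have tY0 : eqsec (tY t) (zerosec _ _).
    apply: (fY_inj (i := i * c%:Z + j%:Z) (delta := D) (tsecY (Wt _ Vt'))) => p e tau.
    by have := h1 p e tau; rewrite /= /zerosec => ->.
  have [|t' Vtt' [t'Y t'Y' t'Z]] := @up_iter i j.+1 c t _ (eq_ind _ (V ^~ t) Vt' _ jS).
    by rewrite jc leqnn.
  have t'Y0 : eqsec (tY t') (zerosec _ _).
    move: (jc); rewrite leq_eqVlt => /orP[/eqP jc'|]; last exact: t'Y.
    by move=> p e tau; rewrite t'Y' // tY0.
  have [||s Vs [sY sZ]] := exu t'; first by rewrite ic.
    by split=> // p e tau; rewrite t'Y0 /zerosec mulr0.
  rewrite V0 in Vs.
  have [|s' Vs' [_ _ s'Z]] := @up_iter i 0 j s _ Vs; first by rewrite leq0n ltnW.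
  exists s' => //; split=> // p e tau; rewrite -/(fZ D (i * c%:Z + j%:Z) tau) fZ_D //.
  have s'Z' : tZ s' p e tau = tZ s p e tau by rewrite s'Z (ltn_eqF jc) andbF mul1r.
  rewrite s'Z'; have := sZ p e tau; rewrite t'Z -/(fZ delta i tau).
  (* If j + 1 = c the section was not moved, and the factor [fZ] belongs to the map itself;
     otherwise it occurs on both sides and is cancelled. *)
  case: (eqVneq j.+1 c) => [jc'|jc']; first by rewrite -jc' ltnn mul1r => ->.
  move=> _; rewrite mul1r; apply/eqP; rewrite -subr_eq0; apply/eqP.
  have jc2 : (j.+1 < c)%N by rewrite ltn_neqAle jc' jc.
  have tsP : is_section (mexp delta i) (tZ t).
    by rewrite -(mexp_interior delta_gt0 c_gt0 i jc2) -jS; apply: tsecZ (Wt _ Vt').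
  have [[Vt0 _] _ _ _] := VV (i * c%:Z); rewrite -V0 in Vs.
  have ssP : is_section (mexp delta i) (tZ s).
    by rewrite -(mexp_c delta_gt0 c_gt0); apply: tsecZ (Vt0 _ Vs).
  apply: (fZ_inj (i := i) (delta := delta) (sub_section tsP ssP)) => q e' tau'.
  rewrite /subsec mulrBr; apply/eqP; rewrite subr_eq0; apply/eqP.
  by have := sZ q e' tau'; rewrite t'Z jc2 eqxx.
have tZ0 : eqsec (tZ t) (zerosec _ _).
  apply: (fZ_inj (i := i * c%:Z + j%:Z) (delta := D) (tsecZ (Vt _ Vt'))) => p e tau.
  by have := h2 p e tau; rewrite /= /zerosec => ->.
have [|t' Vtt' [t'Z t'Z' t'Y]] := @down_iter i 0 j t _ Vt'; first by rewrite leq0n ltnW.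
have t'Z0 : eqsec (tZ t') (zerosec _ _).
  case: (posnP j) => [j0|]; last exact: t'Z.
  by move=> p e tau; rewrite t'Z' // tZ0.
have [||s Vs [sY sZ]] := exd t'; first by rewrite V0.
  by split=> // p e tau; rewrite t'Z0 /zerosec mulr0.
rewrite ic in Vs.
have [|s' Vs' [_ _ s'Y]] := @down_iter i j.+1 c s _ Vs; first by rewrite jc leqnn.
exists s'; first by rewrite jS.
split=> // p e tau; rewrite -/(fY D (i * c%:Z + j%:Z) tau) fY_D //.
have s'Y' : tY s' p e tau = tY s p e tau by rewrite s'Y andbF mul1r.
rewrite s'Y'; have := sY p e tau; rewrite t'Y -/(fY delta i tau).
case: (posnP j) => [j0|j0]; first by rewrite /= mul1r => ->.
move=> _; rewrite mul1r; apply/eqP; rewrite -subr_eq0; apply/eqP.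
have tsP : is_section (lexp delta (i + 1)) (tY t).
  have j01 : (0 < j <= c)%N by rewrite j0 ltnW.
  by rewrite -(lexp_interior delta_gt0 c_gt0 i j01); apply: tsecY (Vt _ Vt').
have [[Vtc _] _ _ _] := VV (i * c%:Z + c%:Z).
have ssP : is_section (lexp delta (i + 1)) (tY s).
  have c01 : (0 < c <= c)%N by rewrite c_gt0 leqnn.
  by rewrite -(lexp_interior delta_gt0 c_gt0 i c01); apply: tsecY (Vtc _ Vs).
apply: (fY_inj (i := i) (delta := delta) (sub_section tsP ssP)) => q e' tau'.
rewrite /subsec mulrBr; apply/eqP; rewrite subr_eq0; apply/eqP.
by have := sY q e' tau'; rewrite t'Y j0 eqxx.
Qed.

End FixR.
End Refine.

Lemma is_tensor_scale (A B : comNzRingType) (f : {rmorphism A -> B}) (N : lmodType B) :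
  @is_tensor A B f A^o N N (fun a x => f a *: x).
Proof.
split.
  split=> [a m m' x|a m x x']; first by rewrite rmorphD rmorphM scalerDl scalerA.
  by rewrite scalerDr !scalerA mulrC.
move=> Q b [b1 b2].
have bZ a m x : b (a *: m) x = f a *: b m x.
  have b0 y : b 0 y = 0.
    by have := b1 (-1) 0 0 y; rewrite scaler0 addr0 rmorphN rmorph1 scaleN1r addNr.
  by have := b1 a m 0 x; rewrite b0 !addr0.
have bZ2 a m x : b m (a *: x) = a *: b m x.
  have b0 y : b y 0 = 0.
    by have := b2 (-1) y 0 0; rewrite scaler0 addr0 scaleN1r addNr.
  by have := b2 a m x 0; rewrite b0 !addr0.
exists (b 1); split.
- by move=> a x y; rewrite b2.
- by move=> m x; rewrite bZ2 -bZ -[m *: (1 : A^o)]/(m * 1) mulr1.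
- by move=> l llin lb x; have := lb 1 x; rewrite rmorph1 scale1r.
Qed.

(** * The forgetful morphism between levels *)

Section Lls.
Variables (k : closedFieldType) (n : nat) (X : two_component_curve k n) (T : twister X).

Local Notation onY L := (restr (@idXY k n X) L).
Local Notation onZ L := (restr (@idXZ k n X) L).
Local Notation TT R := (const_sheaf R T).

Lemma lls_adjacent d r delta R (x : lls_data T R) : is_lls d r delta x ->
  forall i, adjacent delta i (llsV x i) (llsV x (i + 1)).
Proof.
move=> [_ _ H] i; have [Vt smV _ up down] := H i; have [Wt smW _ _ _] := H (i + 1).
by split.
Qed.

Lemma exact_pair_of_lls delta R (x : lls_data T R) i :
  exact_lls delta x -> exact_pair delta i (llsV x i) (llsV x (i + 1)).
Proof.
by move=> /(_ i) [H1 H2]; split=> t Vt t0; [apply/(H1 t Vt)|apply/(H2 t Vt)].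
Qed.

Lemma exact_lls_of_pairs delta R (x : lls_data T R) :
  (forall i, exact_pair delta i (llsV x i) (llsV x (i + 1))) -> exact_lls delta x.
Proof.
move=> H i; have [H1 H2] := H i; split=> t Vt; split; try by [apply: H1|apply: H2].
  by move=> [s _ [sY sZ]]; split=> // p e tau; rewrite sY /zerosec mulr0.
by move=> [s _ [sY sZ]]; split=> // p e tau; rewrite sZ /zerosec mulr0.
Qed.

Section Refl.
Variables (R : kalg k) (I : invertible (idX X) R).
Let b (p : chart (idX X) R) (a : R^o) (s : I p) : I p := cstr p a *: s.

Lemma scale_natural p q (h : chom p q) (a : R^o) (s : I p) :
  b a (res h s) = res h (b a s).
Proof. by rewrite /b resZ cmap_str. Qed.

(** [twistedt] compares coordinates in two unrelated frames of I, so reflexivity depends on [s]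
    transforming like a section. *)
Lemma twisted_one delta m (s : tsec T I) : is_tsec delta m s -> twistedt b 1 s s.
Proof.
have bT p : is_tensor (cstr p) (@b p) by apply: is_tensor_scale.
have b1 p (e : frame (I p)) : coord e (b 1 e) = 1.
  by rewrite /b rmorph1 scale1r coord_gen.
move=> [sY sZ sX]; split.
- case: ifP sX => _; last by move=> sX p e' e tau; rewrite !sX /zerosec mulr0.
  move=> [sX _ _] p e' e tau.
  rewrite (twisted_frame bT 1 sX e e' e tau).
  by rewrite b1 mul1r.
- move=> p e' e tau.
  rewrite (twisted_frame (I := onY I) (I' := onY I) (T := onY (TT R))
    (b := fun p => @b (incl (@idXY k n X) p)) (fun p => bT _) 1 sY e e' e tau).
  by rewrite b1 mul1r.
- move=> p e' e tau.
  rewrite (twisted_frame (I := onZ I) (I' := onZ I) (T := onZ (TT R))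
    (b := fun p => @b (incl (@idXZ k n X) p)) (fun p => bT _) 1 sZ e e' e tau).
  by rewrite b1 mul1r.
Qed.

Lemma twisted_scale (a : R^o) (s' s : tsec T I) : twistedt b a s' s -> eqt s (scalet a s').
Proof.
have ba p (e : frame (I p)) : coord e (b a e) = cstr p a by rewrite /b genK.
move=> [tX tY tZ]; split=> p e tau; rewrite /= /lincomb big_ord1.
- by rewrite (tX p e e) ba.
- by rewrite (tY p e e) ba.
- by rewrite (tZ p e e) ba.
Qed.

End Refl.

Lemma lls_iso_refl delta R (x : lls_data T R) :
  (forall i s, llsV x i s -> is_tsec delta i s) -> (forall i, submodule (llsV x i)) ->
  lls_iso delta x x.
Proof.
move=> Vt smV; exists R^o, (fun p a s => cstr p a *: s); split.
- exists R^o, (fun a x => idfun a *: x); exact: is_tensor_scale.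
- by move=> p; apply: is_tensor_scale.
- by move=> p q h a s; apply: scale_natural.
move=> i t; split=> [Vi|[N [a [s' [s [H /eqtP tE]]]]]].
  exists 1%N, (fun=> 1), (fun=> t), (fun=> t); split.
    by move=> _; split=> //; [apply: Vt|apply: twisted_one (Vt _ _ Vi)].
  by apply/eqtP => x0; rewrite val_lincombt big_ord1 rmorph1 mul1r.
apply: (smV i N (fun=> 1) s); last by apply/eqtP.
move=> j; have [Vs' _ tw] := H j.
apply: (submod_eqt (smV i) (eqt_sym (twisted_scale tw))).
exact: submod_scale.
Qed.

Section Rho.
Variables (delta c : nat).
Hypotheses (delta_gt0 : (0 < delta)%N) (c_gt0 : (0 < c)%N).
Local Notation D := (c * delta)%N.

Lemma rho_is_lls d r R (x : lls_data T R) : is_lls d r D x -> is_lls d r delta (rho c x).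
Proof.
move=> lx; have adj := lls_adjacent lx; have [dY dZ H] := lx; split=> // i.
have [[Vt _] [smV _] up down] := coarse_adjacent delta_gt0 c_gt0 adj i.
by have [_ _ lf _ _] := H (i * c%:Z); split.
Qed.

Lemma rho_morphism d r : fmorphism (Gmod T d r D) (Gmod T d r delta) (rho c).
Proof.
split=> [R x|R x y lx ly [Lambda [b [Linv bT bN bV]]]|R R' g x lx].
- exact: rho_is_lls.
- exists Lambda, b; split=> // i t; rewrite /= bV.
  split=> -[N [a [s' [s [H tE]]]]]; exists N, a, s', s; split=> // j.
    by have [? /(is_tsec_c delta_gt0 c_gt0) ? ?] := H j; split.
  by have [? ? ?] := H j; split=> //; apply/(is_tsec_c delta_gt0 c_gt0).
apply: lls_iso_refl => i; last exact: span_base_submodule.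
have /rho_is_lls [_ _ /(_ i) [Vt _ _ _ _]] := lx.
exact: span_base_tsec.
Qed.

Lemma rho_inv_exact d r R (x : lls_data T R) : is_lls d r D x ->
  exact_fibres delta (rho c x) -> exact_fibres D x.
Proof.
move=> lx ex K i g; apply: exact_lls_of_pairs => m.
have adj j : adjacent D j (llsV (lls_base g x) j) (llsV (lls_base g x) (j + 1)).
  exact/adjacent_base/(lls_adjacent lx).
have [l [j [jc ->]]] := int_split c_gt0 m.
apply: (exact_refine delta_gt0 c_gt0 adj jc).
exact: (exact_pair_of_lls l (ex K i g)).
Qed.

End Rho.
End Lls.

(** * Lifting an exact series to a finer level *)

Section RefineExact.
Variables (k : closedFieldType) (n : nat) (X : two_component_curve k n) (T : twister X).
Variables (delta c : nat).
Hypotheses (delta_gt0 : (0 < delta)%N) (c_gt0 : (0 < c)%N).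
Local Notation D := (c * delta)%N.

Definition glued R (I : invertible (idX X) R) (V W : tsec T I -> Prop) (m : int)
    (t : tsec T I) : Prop :=
  [/\ is_tsec D m t, exists2 u, W u & eqsec (tY t) (tY u) &
      exists2 v, V v & eqsec (tZ t) (tZ v)].

Lemma glued_submodule R (I : invertible (idX X) R) (V W : tsec T I -> Prop) m :
  submodule V -> submodule W -> submodule (glued V W m).
Proof.
move=> smV smW N a s t Hs ts; split.
- apply: eqt_is_tsec (eqt_sym ts) _; apply: lincombt_is_tsec => j.
  by have [] := Hs j.
- have H j : exists u, W u /\ eqsec (tY (s j)) (tY u) by have [_ [u ? ?] _] := Hs j; exists u.
  have [u Hu] := choice H; exists (lincombt a u).
    by apply: smW (eqt_refl _) => j; have [] := Hu j.
  move=> p e tau; have [_ -> _] := ts; rewrite /= /lincomb; apply: eq_bigr => j _.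
  by have [_ ->] := Hu j.
- have H j : exists u, V u /\ eqsec (tZ (s j)) (tZ u) by have [_ _ [u ? ?]] := Hs j; exists u.
  have [u Hu] := choice H; exists (lincombt a u).
    by apply: smV (eqt_refl _) => j; have [] := Hu j.
  move=> p e tau; have [_ _ ->] := ts; rewrite /= /lincomb; apply: eq_bigr => j _.
  by have [_ ->] := Hu j.
Qed.

(** The maps are injective on Y-parts going down and on Z-parts going up. If u and v have
    coordinates p and q, then u|_Y depends only on p B and v|_Z only on q A; so a row x is needed
    with x B = p B and x S A = q A, up to powers of [e]. *)
Lemma glued_loc_basis N R (I : invertible (idX X) R) (V W : tsec T I -> Prop) (i : int) (j : nat)
    e (v w : 'I_N -> tsec T I) A B S U M K : (0 < j < c)%N ->
  adjacent delta i V W -> splitting delta i V W e v w A B S U M K ->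
  loc_basis (glued V W (i * c%:Z + j%:Z)) e
    (fun l => TSec (zerosec I _) (tY (w l)) (tZ (comb (row l S) v))).
Proof.
move=> jc VW [Vv Ww co h1 h2].
have [[Vt Wt] [smV smW] _ _] := VW.
have [Vv' spv indv] := Vv; have [Ww' spw indw] := Ww; have [_ _ AB BA] := co.
set s := fun l => _.
have combY R' (g : khom R R') (a : 'rV[R']_N) p f tau :
    tY (comb a (fun l => tsec_base g (s l))) p f tau =
    tY (comb a (fun l => tsec_base g (w l))) p f tau by [].
have combZ (a : 'rV[R]_N) p f tau : tZ (comb a s) p f tau = tZ (comb (a *m S) v) p f tau.
  by have := val_comb_mulmx (ptZ f tau) a S v => /= ->.
have combZ' R' (g : khom R R') (a : 'rV[R']_N) p f tau :
    tZ (comb a (fun l => tsec_base g (s l))) p f tau =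
    tZ (comb (a *m map_mx g S) (fun l => tsec_base g (v l))) p f tau.
  have := val_comb_mulmx (ptZ f tau) a (map_mx g S) (fun l => tsec_base g (v l)) => /= ->.
  apply: eq_bigr => l _; congr (_ * _).
  have := val_base_comb (ptZ f tau : pt T (base_change g I)) (row l S) v.
  by rewrite map_row.
have sP l : is_tsec D (i * c%:Z + j%:Z) (s l).
  apply/(is_tsec_interior delta_gt0 c_gt0 _ _ jc); split=> //.
    exact: tsecY (Wt _ (Ww' l)).
  exact: tsecZ (Vt _ (submod_comb smV (row l S) Vv')).
have clearW (a b : 'rV[R]_N) : a *m B = b *m B ->
    eqsec (scalesec (e ^+ M) (tY (comb a w))) (scalesec (e ^+ M) (tY (comb b w))).
  move=> ab; pose d := scalet (e ^+ M) (comb (a - b) w).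
  have Wd : W d by apply: submod_scale => //; apply: submod_comb.
  have d0 : eqsec (tY d) (zerosec _ _).
    apply: (fY_inj (i := i) (delta := delta) (tsecY (Wt _ Wd))) => p f tau.
    have [h _] := coords_down (a - b) co; have := h p f tau.
    rewrite mulmxBl ab subrr -/(fY delta i tau) => <-.
    exact: (val_comb0 (ptY f tau) v).
  move=> p f tau; have := d0 p f tau.
  have := val_scalet (ptY f tau) (e ^+ M) (comb (a - b) w) => /= ->.
  have := val_combB (ptY f tau) a b w => /= ->.
  by rewrite mulrBr => /eqP; rewrite subr_eq0 => /eqP.
have clearV (a b : 'rV[R]_N) : a *m A = b *m A ->
    eqsec (scalesec (e ^+ M) (tZ (comb a v))) (scalesec (e ^+ M) (tZ (comb b v))).
  move=> ab; pose d := scalet (e ^+ M) (comb (a - b) v).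
  have Vd : V d by apply: submod_scale => //; apply: submod_comb.
  have d0 : eqsec (tZ d) (zerosec _ _).
    apply: (fZ_inj (i := i) (delta := delta) (tsecZ (Vt _ Vd))) => p f tau.
    have [_ h] := coords_up (a - b) co; have := h p f tau.
    rewrite mulmxBl ab subrr -/(fZ delta i tau) => <-.
    exact: (val_comb0 (ptZ f tau) w).
  move=> p f tau; have := d0 p f tau.
  have := val_scalet (ptZ f tau) (e ^+ M) (comb (a - b) v) => /= ->.
  have := val_combB (ptZ f tau) a b v => /= ->.
  by rewrite mulrBr => /eqP; rewrite subr_eq0 => /eqP.
split.
- move=> l; split=> //; first by exists (w l).
  by exists (comb (row l S) v) => //; apply: submod_comb.
- move=> t [tP [u Wu tu] [u' Vu' tu']].
  have [m1 [p0 /eqtP e1]] := spw u Wu; have [m2 [q0 /eqtP e2]] := spv u' Vu'.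
  pose m0 := (m1 + m2)%N; pose p1 := e ^+ m2 *: p0; pose q1 := e ^+ m1 *: q0.
  have e1' x : pts x (e ^+ m0) * ptval x u = ptval x (comb p1 w).
    by rewrite val_combZ -e1 val_scalet mulrA -rmorphM -exprD addnC.
  have e2' x : pts x (e ^+ m0) * ptval x u' = ptval x (comb q1 v).
    by rewrite val_combZ -e2 val_scalet mulrA -rmorphM -exprD.
  clearbody p1 q1; pose E := e ^+ K.
  have BUB : B *m U *m B = E *: B.
    rewrite -mulmxA (_ : U *m B = E%:M - A *m S); last by rewrite -h1 addrC addKr.
    by rewrite mulmxBr mulmxA BA mul0mx subr0 mul_mx_scalar.
  have ASA : A *m S *m A = E *: A.
    rewrite -mulmxA (_ : S *m A = E%:M - B *m U); last by rewrite -h2 addrC addKr.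
    by rewrite mulmxBr mulmxA AB mul0mx subr0 mul_mx_scalar.
  (* The first term solves the equation for B and the last one the equation for A, up to E * E. The
     middle term cancels the contribution of the first to x S A, and B kills it as well as the
     last. *)
  pose x := E *: (p1 *m B *m U) - p1 *m B *m U *m S *m A + E *: (q1 *m A).
  have xB : x *m B = (E * E *: p1) *m B.
    have z1 : p1 *m B *m U *m S *m A *m B = 0 by rewrite -mulmxA AB mulmx0.
    have z2 : q1 *m A *m B = 0 by rewrite -mulmxA AB mulmx0.
    have z3 : p1 *m B *m U *m B = E *: (p1 *m B).
      by rewrite -!mulmxA [B *m (U *m B)]mulmxA BUB -scalemxAr.
    by rewrite /x mulmxDl mulmxBl -!scalemxAl z1 z2 z3 subr0 scaler0 addr0 scalerA.
  have xSA : x *m S *m A = (E * E *: q1) *m A.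
    have z1 (y : 'rV_N) : y *m A *m S *m A = E *: (y *m A).
      by rewrite -!mulmxA [A *m (S *m A)]mulmxA ASA -scalemxAr.
    rewrite /x !mulmxDl !mulNmx -!scalemxAl !z1 !scalerA.
    by rewrite addrN add0r.
  have cW := clearW _ _ xB; have cV := clearV _ _ xSA.
  exists (M + (K + K) + m0)%N, (e ^+ M *: x).
  apply: (tsec_ext (delta := D) (m := i * c%:Z + j%:Z)).
  + exact: lincombt_is_tsec.
  + exact: lincombt_is_tsec.
  + move=> p f tau.
    have -> : tY (scalet (e ^+ (M + (K + K) + m0)) t) p f tau =
        cstr p (e ^+ (M + (K + K) + m0)) * tY t p f tau.
      exact: (val_scalet (ptY f tau)).
    have -> : tY (comb (e ^+ M *: x) s) p f tau = cstr p (e ^+ M) * tY (comb x w) p f tau.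
      exact: (val_combZ (ptY f tau) (e ^+ M) x w).
    have := cW p f tau; rewrite /scalesec => ->.
    have -> : tY (comb (E * E *: p1) w) p f tau = cstr p (E * E) * tY (comb p1 w) p f tau.
      exact: (val_combZ (ptY f tau) (E * E) p1 w).
    have := e1' (ptY f tau) => /= <-; rewrite -tu !mulrA -!rmorphM.
    by rewrite /E -!exprD !addnA.
  + move=> p f tau.
    have -> : tZ (scalet (e ^+ (M + (K + K) + m0)) t) p f tau =
        cstr p (e ^+ (M + (K + K) + m0)) * tZ t p f tau.
      exact: (val_scalet (ptZ f tau)).
    rewrite combZ -scalemxAl.
    have -> : tZ (comb (e ^+ M *: (x *m S)) v) p f tau = cstr p (e ^+ M) * tZ (comb (x *m S) v) p f tau.
      exact: (val_combZ (ptZ f tau) (e ^+ M) (x *m S) v).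
    have := cV p f tau; rewrite /scalesec => ->.
    have -> : tZ (comb (E * E *: q1) v) p f tau = cstr p (E * E) * tZ (comb q1 v) p f tau.
      exact: (val_combZ (ptZ f tau) (E * E) q1 v).
    have := e2' (ptZ f tau) => /= <-; rewrite -tu' !mulrA -!rmorphM.
    by rewrite /E -!exprD !addnA.
move=> R' g a [y ye] [_ a0Y a0Z].
have co' := coords_base g co; have VW' := adjacent_base g VW.
have [[Vt' Wt'] [smV' smW'] _ _] := VW'.
have [gVv _ _] := loc_basis_base g Vv; have [gWw _ _] := loc_basis_base g Ww.
have aB : a *m map_mx g B = 0.
  apply: (indv R' g); first by exists y.
  apply: (tsec_ext (delta := delta) (m := i)).
  - by apply: Vt'; apply: submod_comb.
  - exact: zerot_is_tsec.
  - have [h _] := coords_down a co'; move=> p f tau; rewrite h.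
    have -> : tY (scalet (g e ^+ M) (comb a (fun l => tsec_base g (w l)))) p f tau =
        cstr p (g e ^+ M) * tY (comb a (fun l => tsec_base g (w l))) p f tau.
      exact: (val_scalet (ptY f tau : pt T (base_change g I))).
    by rewrite -combY a0Y /= /zerosec !mulr0.
  - by have [_ h] := coords_down a co'.
have aSA : a *m map_mx g S *m map_mx g A = 0.
  apply: (indw R' g); first by exists y.
  apply: (tsec_ext (delta := delta) (m := i + 1)).
  - by apply: Wt'; apply: submod_comb.
  - exact: zerot_is_tsec.
  - by have [h _] := coords_up (a *m map_mx g S) co'.
  - have [_ h] := coords_up (a *m map_mx g S) co'; move=> p f tau; rewrite h.
    have -> : tZ (scalet (g e ^+ M) (comb (a *m map_mx g S) (fun l => tsec_base g (v l)))) p f tau =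
        cstr p (g e ^+ M) * tZ (comb (a *m map_mx g S) (fun l => tsec_base g (v l))) p f tau.
      exact: (val_scalet (ptZ f tau : pt T (base_change g I))).
    by rewrite -combZ' a0Z /= /zerosec !mulr0.
have ea : g e ^+ K *: a = 0.
  rewrite -mul_mx_scalar -rmorphXn -map_scalar_mx -h2 map_mxD !map_mxM mulmxDr !mulmxA.
  by rewrite aB aSA mul0mx addr0.
by rewrite -[a]scale1r -(unitlX K ye) -scalerA ea scaler0.
Qed.

End RefineExact.

Section Surjective.
Variables (k : closedFieldType) (n : nat) (X : two_component_curve k n) (T : twister X).
Variables (d r : int) (delta c : nat).
Hypotheses (delta_gt0 : (0 < delta)%N) (c_gt0 : (0 < c)%N).
Local Notation D := (c * delta)%N.
Local Notation onY L := (restr (@idXY k n X) L).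
Local Notation onZ L := (restr (@idXZ k n X) L).

Section FixY.
Variables (R : kalg k) (y : lls_data T R).
Local Notation V := (llsV y).

(* The only family indexed by m that restricts to V at the multiples of c,
   when V is exact. *)
Definition refine_lls : lls_data T R :=
  @LLSData k n X T R (llsI y) (fun m => if (m %% c)%Z == 0 then V (m %/ c)%Z
    else glued delta c (V (m %/ c)%Z) (V ((m %/ c)%Z + 1)) m).

Lemma refine_c i : llsV refine_lls (i * c%:Z) = V i.
Proof. by rewrite /= modzMl eqxx mulzK // eqz_nat -lt0n. Qed.

Lemma refine_interior i (j : nat) : (0 < j < c)%N ->
  llsV refine_lls (i * c%:Z + j%:Z) = glued delta c (V i) (V (i + 1)) (i * c%:Z + j%:Z).
Proof.
move=> /andP[j0 jc]; have jm : ((i * c%:Z + j%:Z) %% c)%Z = j%:Z.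
  by rewrite modzMDl modz_small //= ltz_nat.
have jd : ((i * c%:Z + j%:Z) %/ c)%Z = i.
  by rewrite divzMDl ?eqz_nat -?lt0n // divz_small ?addr0 //= ltz_nat.
by rewrite /= jm jd eqz_nat (gtn_eqF j0).
Qed.

Lemma rho_refine : rho c refine_lls = y.
Proof.
have -> : rho c refine_lls = @LLSData k n X T R (llsI y) V.
  by congr LLSData; apply: funext => i; apply: refine_c.
by case: y.
Qed.

Hypothesis ly : is_lls d r delta y.
Let adj := lls_adjacent ly.

Lemma refine_tZ i (j : nat) s : (j < c)%N -> llsV refine_lls (i * c%:Z + j%:Z) s ->
  exists2 v, V i v & eqsec (tZ s) (tZ v).
Proof.
case: (posnP j) => [->|j0] jc; first by rewrite addr0 refine_c => Vs; exists s.
by rewrite refine_interior ?j0 // => -[].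
Qed.

Lemma refine_tY i (j : nat) s : (0 < j <= c)%N -> llsV refine_lls (i * c%:Z + j%:Z) s ->
  exists2 u, V (i + 1) u & eqsec (tY s) (tY u).
Proof.
move=> /andP[j0]; rewrite leq_eqVlt => /orP[/eqP ->|jc].
  by rewrite -{2}[c%:Z]mul1r -mulrDl refine_c => Vs; exists s.
by rewrite refine_interior ?j0 // => -[].
Qed.

Lemma refine_submodule m : submodule (llsV refine_lls m).
Proof.
have [i [j [jc ->]]] := int_split c_gt0 m.
have [_ [smV smW] _ _] := adj i.
case: (posnP j) => [->|j0]; first by rewrite addr0 refine_c.
by rewrite refine_interior ?j0 //; apply: glued_submodule.
Qed.

Lemma refine_tsec m s : llsV refine_lls m s -> is_tsec D m s.
Proof.
have [i [j [jc ->]]] := int_split c_gt0 m.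
have [[Vt _] _ _ _] := adj i.
case: (posnP j) => [->|j0]; last by rewrite refine_interior ?j0 // => -[].
by rewrite addr0 refine_c => /Vt ?; apply/(is_tsec_c delta_gt0 c_gt0).
Qed.

Lemma refine_up m s : llsV refine_lls m s ->
  exists2 t, llsV refine_lls (m + 1) t & phi_up D m s t.
Proof.
have [i [j [jc ->]]] := int_split c_gt0 m.
have [[Vt Wt] [smV smW] up _] := adj i => Vs.
have [v Vv sv] := refine_tZ jc Vs.
have jS : i * c%:Z + j%:Z + 1 = i * c%:Z + j.+1%:Z by rewrite -addrA -PoszD addn1.
move: (jc); rewrite leq_eqVlt => /orP[/eqP jc'|jc'].
  have [t Wt' [tY tZ]] := up v Vv; exists t.
    by rewrite jS jc' -{2}[c%:Z]mul1r -mulrDl refine_c.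
  split=> // p e tau; rewrite tZ -sv -/(fZ delta i tau) -/(fZ D (i * c%:Z + j%:Z) tau).
  by rewrite fZ_D // jc' eqxx.
exists (TSec (zerosec (llsI y) _) (zerosec (onY (llsI y)) _) (tZ s)); last first.
  split=> // p e tau; rewrite -/(fZ D (i * c%:Z + j%:Z) tau) fZ_D //.
  by rewrite (ltn_eqF jc') mul1r.
rewrite jS refine_interior //; split.
- apply/(is_tsec_interior delta_gt0 c_gt0) => //; split=> //; first exact: zero_section.
  by apply: eqsec_section (tsecZ (Vt _ Vv)) => p e tau; rewrite sv.
- by exists (zerot T (llsI y)) => //; apply: submod_zero.
- by exists v.
Qed.

Lemma refine_down m s : llsV refine_lls (m + 1) s ->
  exists2 t, llsV refine_lls m t & phi_down D m s t.
Proof.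
have [i [j [jc ->]]] := int_split c_gt0 m.
have [[Vt Wt] [smV smW] _ down] := adj i.
have jS : i * c%:Z + j%:Z + 1 = i * c%:Z + j.+1%:Z by rewrite -addrA -PoszD addn1.
rewrite jS => Vs; have jc1 : (0 < j.+1 <= c)%N by [].
have [u Wu su] := refine_tY jc1 Vs.
case: (posnP j) => [j0|j0].
  have [t Vt' [tY tZ]] := down u Wu; exists t.
    by rewrite j0 addr0 refine_c.
  split=> // p e tau; rewrite tY -su -/(fY delta i tau) -/(fY D (i * c%:Z + j%:Z) tau).
  by rewrite fY_D // j0.
have j0c : (0 < j < c)%N by rewrite j0.
exists (TSec (zerosec (llsI y) _) (tY s) (zerosec (onZ (llsI y)) _)); last first.
  split=> // p e tau; rewrite -/(fY D (i * c%:Z + j%:Z) tau) fY_D //.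
  by rewrite (gtn_eqF j0) mul1r.
rewrite refine_interior //; split.
- apply/(is_tsec_interior delta_gt0 c_gt0) => //; split=> //; last exact: zero_section.
  by apply: eqsec_section (tsecY (Wt _ Wu)) => p e tau; rewrite su.
- by exists u.
- by exists (zerot T (llsI y)) => //; apply: submod_zero.
Qed.

Hypothesis ex : exact_fibres delta y.

Lemma refine_is_lls : is_lls d r D refine_lls.
Proof.
have [dY dZ H] := ly; split=> // m; split.
- exact: refine_tsec.
- exact: refine_submodule.
- have [i [j [jc ->]]] := int_split c_gt0 m.
  have [_ _ Vr _ _] := H i; have [_ _ Wr _ _] := H (i + 1).
  case: (posnP j) => [->|j0]; first by rewrite addr0 refine_c.
  have j0c : (0 < j < c)%N by rewrite j0.
  rewrite refine_interior //.
  have exK (K : fieldType) (f : {rmorphism k -> K}) (g : khom R (KAlg f)) :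
      exact_pair delta i (span_base g (V i)) (span_base g (V (i + 1))).
    exact: (exact_pair_of_lls i (ex g)).
  have [N [Nr HN]] := split_cover (adj i) Vr Wr exK.
  pose P e := exists (v w : 'I_N -> tsec T (llsI y)) A B S U M K,
    splitting delta i (V i) (V (i + 1)) e v w A B S U M K.
  have [Mx mM|m0 [f [Pf f1]]] := @max_ideal_finite _ P.
    have [e [v [w [A [B [S [U [M [K [nMe sp]]]]]]]]]] := HN Mx mM.
    by exists e => //; exists v, w, A, B, S, U, M, K.
  apply: (cover_locally_free Nr f1) => l.
  have [v [w [A [B [S [U [M [K sp]]]]]]]] := Pf l.
  exists (fun l => TSec (zerosec (llsI y) _) (tY (w l)) (tZ (comb (row l S) v))).
  exact: (glued_loc_basis delta_gt0 c_gt0 j0c (adj i) sp).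
- exact: refine_up.
- exact: refine_down.
Qed.

End FixY.
End Surjective.

(** * Injectivity *)

Section TwistedSections.
Variables (k : closedFieldType) (n : nat) (J : {mpoly k[n.+1]} -> Prop) (R : kalg k).
Variables (I I' T : invertible J R) (Lambda : lmodType R).
Variable b : forall p : chart J R, Lambda -> I' p -> I p.

(** [twisted] constrains a section only on charts where I' has a frame; such charts exist near every
    point. *)
Lemma twisted_unique m lambda (s : presec I' T) (t t' : presec I T) :
  is_section m t -> is_section m t' -> twisted b lambda s t -> twisted b lambda s t' ->
  eqsec t t'.
Proof.
move=> tP tP' tw tw' p e tau; apply/eqP; rewrite -subr_eq0; apply/eqP.
apply: (sec_loc0 e tau (sub_section tP tP')) => M mM.
have [f1 nM1 H1] := frame_near I mM; have [f2 nM2 H2] := frame_near I' mM.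
have [f3 nM3 H3] := frame_near T mM.
exists (f1 * f2 * f3); split; first by do 2?apply: max_ideal_mulN.
move=> q h [[u uf] _ _] _.
have [|e1] := H1 q h.
  by exists (u * h (f2 * f3)); rewrite -mulrA -rmorphM -uf; congr (_ * h _); ring.
have [|e2] := H2 q h.
  by exists (u * h (f1 * f3)); rewrite -mulrA -rmorphM -uf; congr (_ * h _); ring.
have [|t1] := H3 q h; first by exists (u * h (f1 * f2)); rewrite -mulrA -rmorphM.
by exists e1, t1; rewrite /subsec (tw q e2) (tw' q e2) subrr.
Qed.

End TwistedSections.

Section Injective.
Variables (k : closedFieldType) (n : nat) (X : two_component_curve k n) (T : twister X).
Local Notation onY L := (restr (@idXY k n X) L).
Local Notation onZ L := (restr (@idXZ k n X) L).
Local Notation TT R := (const_sheaf R T).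

Lemma twistedt_exists R (I I' : invertible (idX X) R) (Lambda : lmodType R)
    (b : forall p, Lambda -> I' p -> I p) delta m lambda (s : tsec T I') :
  (forall p, is_tensor (cstr p) (b p)) ->
  (forall p q (h : chom p q) a u, b q a (res h u) = res h (b p a u)) ->
  (0 < delta)%N -> is_tsec delta m s -> exists t, is_tsec delta m t /\ twistedt b lambda s t.
Proof.
move=> bT bN delta_gt0 [sY sZ]; case: ifP => dm.
  move=> [sX sXY sXZ].
  have [t [tP tw]] := twisted_exists bT bN lambda sX.
  exists (TSec t (fun p e u => t (incl (@idXY k n X) p) e u)
    (fun p e u => t (incl (@idXZ k n X) p) e u)).
  split.
    split.
    - by rewrite -/(lexp delta m) lexp_dvd //; apply: restr_section.
    - exact: restr_section.
    - by rewrite dm; split.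
  split=> // p e' e tau.
    by rewrite sXY; exact: (tw (incl (@idXY k n X) p) e' e tau).
  by rewrite sXZ; exact: (tw (incl (@idXZ k n X) p) e' e tau).
move=> sX.
have [tY [tYP twY]] := twisted_exists (I := onY I) (I' := onY I') (T := onY (TT R))
  (b := fun p => b (incl (@idXY k n X) p)) (fun p => bT _)
  (fun p q h => bN _ _ (incl_hom _ h)) lambda sY.
have [tZ [tZP twZ]] := twisted_exists (I := onZ I) (I' := onZ I') (T := onZ (TT R))
  (b := fun p => b (incl (@idXZ k n X) p)) (fun p => bT _)
  (fun p q h => bN _ _ (incl_hom _ h)) lambda sZ.
exists (TSec (zerosec I _) tY tZ); split; first by split=> //; rewrite dm.
by split=> // p e' e tau; rewrite /= sX /zerosec mulr0.
Qed.

Variables (d r : int) (delta c : nat).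
Hypotheses (delta_gt0 : (0 < delta)%N) (c_gt0 : (0 < c)%N).
Local Notation D := (c * delta)%N.

Section Description.
Variables (R : kalg k) (x : lls_data T R).
Hypotheses (lx : is_lls d r D x) (ex : exact_fibres delta (rho c x)).
Let adj := lls_adjacent lx.

Lemma coarse_exact i : exact_pair delta i (llsV x (i * c%:Z)) (llsV x ((i + 1) * c%:Z)).
Proof.
have [_ _ H] := lx.
have [_ _ Vr _ _] := H (i * c%:Z); have [_ _ Wr _ _] := H ((i + 1) * c%:Z).
apply: (exact_of_fibres (coarse_adjacent delta_gt0 c_gt0 adj i) Vr Wr).
by move=> K f g; apply: (exact_pair_of_lls i (ex g)).
Qed.

Lemma interior_glued i (j : nat) t : (0 < j < c)%N ->
  llsV x (i * c%:Z + j%:Z) t <->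
  glued delta c (llsV x (i * c%:Z)) (llsV x ((i + 1) * c%:Z)) (i * c%:Z + j%:Z) t.
Proof.
move=> jc; have /andP[j0 jc'] := jc.
have ic : (i + 1) * c%:Z = i * c%:Z + c%:Z by rewrite mulrDl mul1r.
have [[Vt _] [smV _] _ _] := adj (i * c%:Z + j%:Z).
have [[V0t _] _ _ _] := adj (i * c%:Z); have [[Vct _] _ _ _] := adj ((i + 1) * c%:Z).
have V0E : llsV x (i * c%:Z) = llsV x (i * c%:Z + 0%:Z) by rewrite addr0.
have [exu exd] := coarse_exact i.
split=> [Vi|[tP [u Wu tu] [v Vv tv]]].
  have tP := Vt _ Vi; split=> //.
    have j0c : (0 <= j <= c)%N by rewrite leq0n ltnW.
    have [t' V0t' [t'Z _ t'Y]] := down_iter adj (i := i) (j := 0) (l := j) j0c Vi.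
    rewrite -V0E in V0t'.
    have [|u Wu [uY uZ]] := exd t' V0t'.
      by split=> // p e tau; rewrite t'Z // /zerosec mulr0.
    exists u => // p e tau; apply/eqP; rewrite -subr_eq0; apply/eqP.
    have tsP : is_section (lexp delta (i + 1)) (tY t).
      have j1c : (0 < j <= c)%N by rewrite j0 ltnW.
      by rewrite -(lexp_interior delta_gt0 c_gt0 i j1c); apply: tsecY tP.
    have usP : is_section (lexp delta (i + 1)) (tY u).
      by rewrite -(lexp_c delta_gt0 c_gt0); apply: tsecY (Vct _ Wu).
    apply: (fY_inj (i := i) (delta := delta) (sub_section tsP usP)) => q f tau'.
    rewrite /subsec mulrBr; apply/eqP; rewrite subr_eq0; apply/eqP.
    by have := uY q f tau'; rewrite t'Y j0.
  have jcc : (j <= c <= c)%N by rewrite leqnn ltnW.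
  have [t' Vct' [t'Y _ t'Z]] := up_iter c_gt0 adj (i := i) (j := j) (l := c) jcc Vi.
  rewrite -ic in Vct'.
  have [|v Vv [vY vZ]] := exu t' Vct'.
    by split=> // p e tau; rewrite t'Y // /zerosec mulr0.
  exists v => // p e tau; apply/eqP; rewrite -subr_eq0; apply/eqP.
  have tsP : is_section (mexp delta i) (tZ t).
    by rewrite -(mexp_interior delta_gt0 c_gt0 i jc'); apply: tsecZ tP.
  have vsP : is_section (mexp delta i) (tZ v).
    by rewrite -(mexp_c delta_gt0 c_gt0); apply: tsecZ (V0t _ Vv).
  apply: (fZ_inj (i := i) (delta := delta) (sub_section tsP vsP)) => q f tau'.
  rewrite /subsec mulrBr; apply/eqP; rewrite subr_eq0; apply/eqP.
  by have := vZ q f tau'; rewrite t'Z jc' eqxx.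
(* Conversely, [u] brought down from (i + 1) c vanishes on Z and [v] brought up from i c vanishes on
   Y, and their sum has the prescribed parts. *)
rewrite V0E in Vv; rewrite ic in Wu.
have j0c : (0 <= j <= c)%N by rewrite leq0n ltnW.
have jcc : (j <= c <= c)%N by rewrite leqnn ltnW.
have [v' Vv' [v'Y _ v'Z]] := up_iter c_gt0 adj (i := i) (j := 0) (l := j) j0c Vv.
have [u' Wu' [u'Z _ u'Y]] := down_iter adj (i := i) (j := j) (l := c) jcc Wu.
apply: (submod_eqt smV _ (submod_add smV Wu' Vv')).
apply: (tsec_ext (delta := D) (m := i * c%:Z + j%:Z)) => // [|p e tau|p e tau].
- by apply: Vt; apply: submod_add.
- apply: etrans (val_addt (ptY e tau) u' v') _.
  by rewrite /= u'Y jc' (gtn_eqF j0) mul1r v'Y // addr0 tu.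
- apply: etrans (val_addt (ptZ e tau) u' v') _.
  by rewrite /= v'Z j0 (ltn_eqF jc') mul1r u'Z // add0r tv.
Qed.

End Description.

Lemma rho_injective R (x x' : lls_data T R) : is_lls d r D x -> is_lls d r D x' ->
  exact_fibres delta (rho c x) -> exact_fibres delta (rho c x') ->
  lls_iso delta (rho c x) (rho c x') -> lls_iso D x x'.
Proof.
move=> lx lx' ex ex' [Lambda [b [Linv bT bN bV]]].
have adj := lls_adjacent lx; have adj' := lls_adjacent lx'.
exists Lambda, b; split=> // m t.
have [i [j [jc ->]]] := int_split c_gt0 m.
case: (posnP j) => [->|j0].
  rewrite addr0 -[llsV x (i * c%:Z) t]/(llsV (rho c x) i t) bV /=.
  split=> -[N [a [s' [s [H tE]]]]]; exists N, a, s', s; split=> // l.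
    by have [? ? ?] := H l; split=> //; apply/(is_tsec_c delta_gt0 c_gt0).
  by have [? /(is_tsec_c delta_gt0 c_gt0) ? ?] := H l; split.
have j0c : (0 < j < c)%N by rewrite j0.
have ic : (i + 1) * c%:Z = i * c%:Z + c%:Z by rewrite mulrDl mul1r.
have [[Vt' _] [smV' _] _ _] := adj' (i * c%:Z + j%:Z).
have [[Vt _] [smV _] _ _] := adj (i * c%:Z + j%:Z).
(* At an inner index a section is a free pair of its parts on Y and on Z. The twisting data of the
   coarse terms at i + 1 and i are truncated to these parts and concatenated. *)
pose Y0 (I : invertible (idX X) R) (s : tsec T I) := TSec (zerosec I _) (tY s) (zerosec (onZ I) _).
pose Z0 (I : invertible (idX X) R) (s : tsec T I) := TSec (zerosec I _) (zerosec (onY I) _) (tZ s).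
rewrite (interior_glued lx ex _ _ j0c); split.
  move=> [tP [u Wu tu] [v Vv tv]].
  have [N1 [a1 [s1' [s1 [H1 u1]]]]] := proj1 (bV (i + 1) u) Wu.
  have [N2 [a2 [s2' [s2 [H2 v2]]]]] := proj1 (bV i v) Vv.
  have K1 l : exists w, llsV x' (i * c%:Z + j%:Z) w /\
      [/\ eqsec (tX w) (zerosec _ _), eqsec (tY w) (tY (s1' l)) & eqsec (tZ w) (zerosec _ _)].
    have [Vs1 _ _] := H1 l; rewrite /= ic in Vs1.
    have jcc : (j <= c <= c)%N by rewrite leqnn ltnW.
    have [w Vw [wZ _ wY]] := down_iter adj' (i := i) (j := j) (l := c) jcc Vs1.
    exists w; split=> //; have /(is_tsec_interior delta_gt0 c_gt0 _ _ j0c) [_ _ wX] := Vt' _ Vw.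
    split=> //; last exact: wZ.
    by move=> p e tau; rewrite wY (gtn_eqF j0) andbF mul1r.
  have K2 l : exists w, llsV x' (i * c%:Z + j%:Z) w /\
      [/\ eqsec (tX w) (zerosec _ _), eqsec (tY w) (zerosec _ _) & eqsec (tZ w) (tZ (s2' l))].
    have [Vs2 _ _] := H2 l; rewrite /= -[i * c%:Z]addr0 in Vs2.
    have jcc : (0 <= j <= c)%N by rewrite leq0n ltnW.
    have [w Vw [wY _ wZ]] := up_iter c_gt0 adj' (i := i) (j := 0) (l := j) jcc Vs2.
    exists w; split=> //; have /(is_tsec_interior delta_gt0 c_gt0 _ _ j0c) [_ _ wX] := Vt' _ Vw.
    split=> //; first exact: wY.
    by move=> p e tau; rewrite wZ (ltn_eqF jc) andbF mul1r.
  have [w1 Hw1] := choice K1; have [w2 Hw2] := choice K2.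
  exists (N1 + N2)%N,
    (fun l => match split l with inl l => a1 l | inr l => a2 l end),
    (fun l => match split l with inl l => w1 l | inr l => w2 l end),
    (fun l => match split l with inl l => Y0 _ (s1 l) | inr l => Z0 _ (s2 l) end).
  split.
    move=> l; case: (split l) => {}l.
      have [Vw [wX wY wZ]] := Hw1 l; have [_ s1P [_ twY _]] := H1 l.
      split=> //.
        apply/(is_tsec_interior delta_gt0 c_gt0 _ _ j0c); split=> //.
          exact: tsecY s1P.
        exact: zero_section.
      split=> p e' e tau; first by rewrite wX /= /zerosec mulr0.
        by rewrite wY; apply: twY.
      by rewrite wZ /= /zerosec mulr0.
    have [Vw [wX wY wZ]] := Hw2 l; have [_ s2P [_ _ twZ]] := H2 l.
    split=> //.
      apply/(is_tsec_interior delta_gt0 c_gt0 _ _ j0c); split=> //.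
        exact: zero_section.
      exact: tsecZ s2P.
    split=> p e' e tau; first by rewrite wX /= /zerosec mulr0.
      by rewrite wY /= /zerosec mulr0.
    by rewrite wZ; apply: twZ.
  have sumE (q : pt T (llsI x)) : ptval q (lincombt (fun=> 1)
      (fun l : 'I_(N1 + N2) => match split l with inl l => Y0 _ (s1 l) | inr l => Z0 _ (s2 l) end)) =
      \sum_l ptval q (Y0 _ (s1 l)) + \sum_l ptval q (Z0 _ (s2 l)).
    rewrite val_lincombt big_split_ord /=; congr (_ + _); apply: eq_bigr => l _.
      by rewrite (unsplitK (inl l : 'I_N1 + 'I_N2)) rmorph1 mul1r.
    by rewrite (unsplitK (inr l : 'I_N1 + 'I_N2)) rmorph1 mul1r.
  have [_ u1Y _] := u1; have [_ _ v2Z] := v2.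
  have /(is_tsec_interior delta_gt0 c_gt0 _ _ j0c) [_ _ tX0] := tP.
  apply/eqtP => q; rewrite sumE; case: q => p e tau /=.
  - by rewrite !big1 ?addr0 // tX0.
  - rewrite [X in _ + X]big1 // addr0 tu u1Y /= /lincomb.
    by apply: eq_bigr => l _; rewrite rmorph1 mul1r.
  - rewrite [X in X + _]big1 // add0r tv v2Z /= /lincomb.
    by apply: eq_bigr => l _; rewrite rmorph1 mul1r.
(* For the converse, each [s' l] has its parts from coarse terms of x'. Their twists lie in coarse
   terms of x and, by uniqueness of twists, have the same parts as [s l]. *)
move=> [N [a [s' [s [H tE]]]]].
rewrite -(interior_glued lx ex _ _ j0c).
apply: (smV N (fun=> 1) s) tE => l; have [Vs' sP [_ twY twZ]] := H l.
have [_ [u' Wu' su'] [v' Vv' sv']] := proj1 (interior_glued lx' ex' _ _ j0c) Vs'.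
have coarse_in i0 w' : llsV x' (i0 * c%:Z) w' -> exists w, [/\ llsV x (i0 * c%:Z) w,
    is_tsec delta i0 w & twistedt b (a l) w' w].
  move=> Vw'; have [[Vt0 _] _ _ _] := adj' (i0 * c%:Z).
  have /(is_tsec_c delta_gt0 c_gt0) w'P := Vt0 _ Vw'.
  have [w [wP tw]] := twistedt_exists (a l) bT bN delta_gt0 w'P.
  exists w; split=> //; apply/bV.
  exists 1%N, (fun=> a l), (fun=> w'), (fun=> w); split=> //.
  by apply/eqtP => q; rewrite val_lincombt big_ord1 rmorph1 mul1r.
have [u [Wu uP [_ twuY _]]] := coarse_in _ _ Wu'.
have [v [Vv vP [_ _ twvZ]]] := coarse_in _ _ Vv'.
apply/(interior_glued lx ex _ _ j0c); split=> //.
- exists u => //; have /(is_tsec_interior delta_gt0 c_gt0 _ _ j0c) [sY _ _] := sP.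
  apply: (twisted_unique sY (tsecY uP) twY) => p e' e tau.
  by rewrite su'; apply: twuY.
- exists v => //; have /(is_tsec_interior delta_gt0 c_gt0 _ _ j0c) [_ sZ _] := sP.
  apply: (twisted_unique sZ (tsecZ vP) twZ) => p e' e tau.
  by rewrite sv'; apply: twvZ.
Qed.

End Injective.

(** * Interpolation over a field *)

(** [X] and [Y] are the maps up and down between two terms with Y-parts P1, P2 and Z-parts Q1, Q2:
    going up kills the Y-part and keeps the Z-part, going down does the opposite. [S] and [U]
    contract the pair. *)
Definition link (R : nzRingType) N (P1 Q1 P2 Q2 X Y S U : 'M[R]_N) : Prop :=
  [/\ X *m P2 = 0, X *m Q2 = Q1, Y *m Q1 = 0 & Y *m P1 = P2] /\
  [/\ X *m Y = 0, Y *m X = 0, X *m S + U *m Y = 1%:M & Y *m U + S *m X = 1%:M].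

Section ExactChain.
Variables (K : fieldType) (N : nat) (A B : 'M[K]_N).
Hypotheses (AB : A *m B = 0) (BA : B *m A = 0).

(* Q agrees with A on a complement of ker A, kills im B, and maps a complement
   of im B in ker A onto a complement of im A in ker B. *)
Lemma exact_intermediate : exists G Q S U : 'M[K]_N,
  [/\ A *m G *m A = A, A *m G *m Q = A, Q *m B = 0 /\ B *m Q = 0,
      Q *m S + U *m B = 1%:M & B *m U + S *m Q = 1%:M].
Proof.
have [G AGA] : exists G, A *m G *m A = A by exists (pinvmx A); apply: mulmxKpV.
have BkA : (B <= kermx A)%MS by apply/sub_kermxP.
have AkB : (A <= kermx B)%MS by apply/sub_kermxP.
pose D1 := row_base (kermx A :\: B)%MS.
(* Both complements have dimension N minus the ranks of A and B. *)
have rk : \rank (kermx B :\: A)%MS = \rank (kermx A :\: B)%MS.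
  have := mxrank_cap_compl (kermx A) B; have := mxrank_cap_compl (kermx B) A.
  rewrite (capmx_idPr BkA).1 (capmx_idPr AkB).1 !mxrank_ker => h1 h2.
  apply/eqP; rewrite -(eqn_add2l (\rank A + \rank B)) -{1}addnA [(\rank B + _)%N]addnC addnA h1.
  by rewrite [(\rank A + \rank B)%N]addnC -addnA [(\rank A + _)%N]addnC addnA h2 !subnK ?rank_leq_row.
have [D2 D2E] : exists D2 : 'M[K]_(\rank (kermx A :\: B)%MS, N), (D2 :=: kermx B :\: A)%MS.
  by case: _ / rk; exists (row_base (kermx B :\: A)%MS); apply: eq_row_base.
have D1A : D1 *m A = 0.
  by apply/sub_kermxP; rewrite eq_row_base diffmxSl.
have D2B : D2 *m B = 0 by apply/sub_kermxP; rewrite D2E diffmxSl.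
pose E := D1 *m cokermx B.
have Efree : row_free E.
  rewrite -kermx_eq0; apply/rowV0P => c /sub_kermxP; rewrite mulmxA => /eqP.
  rewrite -submxE => cB.
  have : (c *m D1 <= (kermx A :\: B) :&: B)%MS.
    by rewrite sub_capmx cB andbT (submx_trans (submxMl _ _)) // eq_row_base.
  rewrite capmx_diff submx0 => /eqP /(congr1 (mulmxr (pinvmx D1))) /=.
  by rewrite mul0mx -mulmxA mulmxVp ?row_base_free // mulmx1.
pose P := 1%:M - A *m G.
have BP : B *m P = B by rewrite mulmxBr mulmx1 mulmxA BA mul0mx subr0.
have AGP : A *m G *m P = 0 by rewrite mulmxBr mulmx1 mulmxA AGA subrr.
have D1P : D1 *m P = D1 by rewrite mulmxBr mulmx1 mulmxA D1A mul0mx subr0.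
have [F EF FB] : exists2 F, E *m F = D2 & F *m B = 0.
  exists (pinvmx E *m D2); last by rewrite -mulmxA D2B mulmx0.
  by rewrite mulmxA mulmxVp // mul1mx.
(* The cokernel makes the correction vanish on the image of B, and the projector [P] confines it to
   the kernel of A, which keeps A G Q = A. *)
pose Q := A + P *m (cokermx B *m F).
have QB : Q *m B = 0 by rewrite mulmxDl AB -2!mulmxA FB !mulmx0 addr0.
have BQ : B *m Q = 0.
  by rewrite mulmxDr BA (mulmxA B P) BP (mulmxA B) mulmx_coker mul0mx addr0.
have AGQ : A *m G *m Q = A by rewrite mulmxDr AGA (mulmxA _ P) AGP mul0mx addr0.
have D1Q : D1 *m Q = D2.
  by rewrite mulmxDr D1A add0r (mulmxA _ P) D1P (mulmxA D1).
have kBQ : (kermx B <= Q)%MS.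
  rewrite -(addsmx_diff_cap_eq (kermx B) A) addsmx_sub -D2E -{1}D1Q submxMl /=.
  by rewrite (capmx_idPr AkB) -{1}AGQ submxMl.
have BkQ : (B <= kermx Q)%MS by apply/sub_kermxP.
(* A dimension count: Q has rank at least that of ker B, so ker Q has at most the rank of B, which
   it contains. *)
have kQB : (kermx Q <= B)%MS.
  have := mxrank_leqif_sup BkQ; rewrite mxrank_ker => -[_ <-].
  have := mxrankS kBQ; rewrite mxrank_ker leq_subLR => h.
  by rewrite eqn_leq leq_subLR addnC h andbT -mxrank_ker mxrankS.
have [S [U [h1 h2]]] := field_split QB BQ kQB kBQ.
by exists G, Q, S, U.
Qed.

Lemma idem_link (X Y : 'M[K]_N) : X + Y = 1%:M -> X *m X = X ->
  [/\ X *m Y = 0, Y *m X = 0, X *m 1%:M + 1%:M *m Y = 1%:M & Y *m 1%:M + 1%:M *m X = 1%:M].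
Proof.
move=> XY XX; have -> : Y = 1%:M - X by rewrite -XY addrC addKr.
by rewrite !mulmxBr !mulmxBl !mulmx1 !mul1mx XX !subrr subrK addrC subrK.
Qed.

(** The successive pairs of maps are (A G, 1 - A G), then (Q, B), then (1 - B H, B H) repeated. The
    pairs of complementary idempotents are contracted by 1; the exact pair (Q, B) carries the
    passage from A to B. [L] and [M] provide the independence of the bases. *)
Lemma exact_chain c : (1 < c)%N -> exists P Q X Y S U L M : nat -> 'M[K]_N,
  [/\ [/\ P 0 = 1%:M, Q 0 = A, P c = B & Q c = 1%:M],
      forall j, (0 < j < c)%N -> [/\ P j *m A = 0, Q j *m B = 0 & P j *m L j + Q j *m M j = 1%:M] &
      forall j, (j < c)%N -> link (P j) (Q j) (P j.+1) (Q j.+1) (X j) (Y j) (S j) (U j)].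
Proof.
move=> c1; have [G [Q [S [U [AGA AGQ [QB BQ] h1 h2]]]]] := exact_intermediate.
have [H BHB] : exists H, B *m H *m B = B by exists (pinvmx B); apply: mulmxKpV.
pose E (F0 F1 F2 : 'M[K]_N) (j : nat) := match j with 0 => F0 | 1 => F1 | _ => F2 end.
(* At index c the Z-part is 1 instead of 1 - B H, because the last term is [W] with its own
   basis. *)
exists (E 1%:M (1%:M - A *m G) B), (fun j => if j == c then 1%:M else E A Q (1%:M - B *m H) j),
  (E (A *m G) Q (1%:M - B *m H)), (E (1%:M - A *m G) B (B *m H)),
  (E 1%:M S 1%:M), (E 1%:M U 1%:M), (E 0 (1%:M - Q *m G) H), (E 0 G 1%:M).
have c2 : c = c.-2.+2 by case: c c1 => [|[]].
split.
- by rewrite eqxx c2; split.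
- case=> [|[|j]] //= /ltn_eqF ->.
    split=> //; first by rewrite mulmxBl mul1mx AGA subrr.
    rewrite mulmxBl mul1mx !mulmxBr !mulmx1 !mulmxA AGQ.
    by rewrite subrr subr0 subrK.
  split; [by rewrite BA|by rewrite mulmxBl mul1mx BHB subrr|].
  by rewrite mulmx1 addrC subrK.
have I2 : (B *m H) *m (B *m H) = B *m H by rewrite mulmxA BHB.
have J2 : (1%:M - B *m H) *m (1%:M - B *m H) = 1%:M - B *m H.
  by rewrite mulmxBr mulmx1 mulmxBl mul1mx I2 subrr subr0.
have JB : (1%:M - B *m H) *m B = 0 by rewrite mulmxBl mul1mx BHB subrr.
have QJ : Q *m (1%:M - B *m H) = Q by rewrite mulmxBr mulmx1 mulmxA QB mul0mx subr0.
have BP : B *m (1%:M - A *m G) = B by rewrite mulmxBr mulmx1 mulmxA BA mul0mx subr0.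
case=> [|[|j]] /= jc; rewrite (ltn_eqF jc).
- split; last by apply: idem_link; rewrite ?mulmxA ?AGA // addrC subrK.
  have Q1 : (if 1%N == c then 1%:M else Q) = Q by rewrite (ltn_eqF c1).
  rewrite Q1 AGQ mulmx1 mulmxBl mul1mx AGA subrr mulmxBr mulmx1 mulmxA AGA subrr.
  by split.
- split; last by split.
  by rewrite BQ BP QB; split=> //; case: ifP => _; rewrite ?mulmx1.
- split; last by apply: idem_link; rewrite ?subrK.
  rewrite JB mulmxBr mulmx1 I2 subrr BHB; split=> //.
  by case: ifP => _; rewrite ?mulmx1 ?J2.
Qed.

End ExactChain.

(** * Realization of the chain of matrices by sections *)

Section Chain.
Variables (k : closedFieldType) (n : nat) (X : two_component_curve k n) (T : twister X).

Definition spans R (I : invertible (idX X) R) N (s : 'I_N -> tsec T I) (t : tsec T I) : Prop :=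
  exists a : 'rV[R]_N, eqt t (comb a s).

Section Spans.
Variables (R : kalg k) (I : invertible (idX X) R) (N : nat).
Implicit Types (s : 'I_N -> tsec T I) (V W : tsec T I -> Prop).

Lemma spans_submodule s : submodule (spans s).
Proof.
move=> m a t u Vt tu; have [b Hb] := choice Vt.
exists (\sum_j a j *: b j); apply/eqtP => x.
move/eqtP: tu => ->; rewrite val_lincombt.
elim/big_rec2: _ => [|j y d _ ->]; first by rewrite val_comb0.
by rewrite val_combD val_combZ; move/eqtP: (Hb j) => ->.
Qed.

Lemma spans_mem s l : spans s (s l).
Proof. by exists (delta_mx 0 l); apply/eqtP => x; rewrite val_comb_delta. Qed.

Lemma spans_basis s V : submodule V -> loc_basis V 1 s -> spans s = V.
Proof.
move=> smV Vs; apply: funext => t; apply: propext; split=> [[a ta]|Vt].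
  by apply: (submod_eqt smV (eqt_sym ta)); apply: submod_comb; have [] := Vs.
by apply: loc_basis_unit Vs _ _ Vt; exists 1; rewrite mulr1.
Qed.

Lemma spans_loc_basis s : (forall (R' : kalg k) (g : khom R R') (a : 'rV[R']_N),
    eqt (comb a (fun l => tsec_base g (s l))) (zerot T _) -> a = 0) ->
  loc_basis (spans s) 1 s.
Proof.
move=> indep; split=> [|t [a ta]|R' g a _]; [exact: spans_mem| |exact: indep].
by exists 0%N, a; apply/eqtP => x; rewrite val_scalet expr0 rmorph1 mul1r; move/eqtP: ta => ->.
Qed.

Lemma coords1_up delta i M (v w : 'I_N -> tsec T I) A B (a : 'rV[R]_N) :
  coords delta i 1 M v w A B -> phi_up delta i (comb a v) (comb (a *m A) w).
Proof.
move=> /coords_up h; apply: phi_up_eqt (h a); last exact: eqt_refl.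
by apply/eqtP => x; rewrite val_scalet expr1n rmorph1 mul1r.
Qed.

Lemma coords1_down delta i M (v w : 'I_N -> tsec T I) A B (a : 'rV[R]_N) :
  coords delta i 1 M v w A B -> phi_down delta i (comb a w) (comb (a *m B) v).
Proof.
move=> /coords_down h; apply: phi_down_eqt (h a); last exact: eqt_refl.
by apply/eqtP => x; rewrite val_scalet expr1n rmorph1 mul1r.
Qed.

Lemma spans_adjacent delta i (v w : 'I_N -> tsec T I) A B M :
  (forall l, is_tsec delta i (v l)) -> (forall l, is_tsec delta (i + 1) (w l)) ->
  coords delta i 1 M v w A B -> adjacent delta i (spans v) (spans w).
Proof.
move=> vP wP co; split.
- by split=> s [a sa]; apply: eqt_is_tsec (eqt_sym sa) _; apply: lincombt_is_tsec.
- by split; apply: spans_submodule.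
- move=> s [a sa]; exists (comb (a *m A) w); first by exists (a *m A).
  exact: phi_up_eqt (eqt_sym sa) (eqt_refl _) (coords1_up a co).
- move=> s [a sa]; exists (comb (a *m B) v); first by exists (a *m B).
  exact: phi_down_eqt (eqt_sym sa) (eqt_refl _) (coords1_down a co).
Qed.

Lemma splitting_exact delta i V W (v w : 'I_N -> tsec T I) A B S U M K :
  adjacent delta i V W -> splitting delta i V W 1 v w A B S U M K -> exact_pair delta i V W.
Proof.
move=> [[Vt Wt] [smV smW] _ _] [Vv Ww co h1 h2]; rewrite expr1n in h1 h2.
have [Vv' _ _] := Vv; have [Ww' _ _] := Ww.
have u1 : exists u : R, u * 1 = 1 by exists 1; rewrite mulr1.
split=> t Vt' t0.
  have [a ta] := loc_basis_unit Ww u1 Vt'.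
  have [m aB] : exists m, 1 ^+ m *: (a *m B) = 0.
    apply: (loc_basis_indep Vv); apply: (phi_down_fun (m := i)) (coords1_down a co) _.
    - by apply: Vt; apply: submod_comb.
    - exact: zerot_is_tsec.
    - exact: phi_down_eqt ta (eqt_refl _) t0.
  rewrite expr1n scale1r in aB.
  exists (comb (a *m S) v); first exact: submod_comb.
  have := coords1_up (a *m S) co; rewrite -mulmxA.
  have -> : a *m (S *m A) = a by rewrite -[RHS]mulmx1 -h2 mulmxDr (mulmxA a B) aB mul0mx add0r.
  exact: phi_up_eqt (eqt_refl _) (eqt_sym ta).
have [a ta] := loc_basis_unit Vv u1 Vt'.
have [m aB] : exists m, 1 ^+ m *: (a *m A) = 0.
  apply: (loc_basis_indep Ww); apply: (phi_up_fun (m := i + 1)) (coords1_up a co) _.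
  - by apply: Wt; apply: submod_comb.
  - exact: zerot_is_tsec.
  - exact: phi_up_eqt ta (eqt_refl _) t0.
rewrite expr1n scale1r in aB.
exists (comb (a *m U) w); first exact: submod_comb.
have := coords1_down (a *m U) co; rewrite -mulmxA.
have -> : a *m (U *m B) = a by rewrite -[RHS]mulmx1 -h1 mulmxDr (mulmxA a A) aB mul0mx add0r.
exact: phi_down_eqt (eqt_refl _) (eqt_sym ta).
Qed.

End Spans.

Lemma splitting_base delta i R R' (g : khom R R') (I : invertible (idX X) R)
    (V W : tsec T I -> Prop) N e (v w : 'I_N -> tsec T I) A B S U M K :
  splitting delta i V W e v w A B S U M K ->
  splitting delta i (span_base g V) (span_base g W) (g e) (fun l => tsec_base g (v l))
    (fun l => tsec_base g (w l)) (map_mx g A) (map_mx g B) (map_mx g S) (map_mx g U) M K.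
Proof.
move=> [Vv Ww co h1 h2]; split.
- exact: loc_basis_base.
- exact: loc_basis_base.
- exact: coords_base.
- by rewrite -!map_mxM -map_mxD h1 map_scalar_mx rmorphXn.
- by rewrite -!map_mxM -map_mxD h2 map_scalar_mx rmorphXn.
Qed.

Variables (delta c : nat).
Hypotheses (delta_gt0 : (0 < delta)%N) (c_gt0 : (0 < c)%N).
Local Notation D := (c * delta)%N.
Variables (N : nat) (i : int).

(* The Y-parts and Z-parts of the sections s are described through those of v
   and w; at the inner steps of the chain these are only determined after
   multiplication by the equations of P. *)
Definition chain_rep R (I : invertible (idX X) R) (v w : 'I_N -> tsec T I) (j : nat)
    (P Q : 'M[R]_N) (s : 'I_N -> tsec T I) : Prop :=
  [/\ forall l, is_tsec D (i * c%:Z + j%:Z) (s l),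
      forall l p e tau, (if j == 0%N then 1 else fY delta i tau) * tY (s l) p e tau =
        tY (comb (row l P) v) p e tau &
      forall l p e tau, (if j == c then 1 else fZ delta i tau) * tZ (s l) p e tau =
        tZ (comb (row l Q) w) p e tau].

Lemma chain_rep_base R R' (g : khom R R') (I : invertible (idX X) R)
    (v w : 'I_N -> tsec T I) j P Q s : chain_rep v w j P Q s ->
  chain_rep (fun l => tsec_base g (v l)) (fun l => tsec_base g (w l)) j (map_mx g P)
    (map_mx g Q) (fun l => tsec_base g (s l)).
Proof.
move=> [sP sY sZ]; split=> l.
- exact: (tsec_base_is_tsec g (sP l)).
- move=> p e tau; apply: etrans (sY l (cbase g p) e tau) _.
  have := val_base_comb (ptY e tau : pt T (base_change g I)) (row l P) v.
  by rewrite map_row.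
- move=> p e tau; apply: etrans (sZ l (cbase g p) e tau) _.
  have := val_base_comb (ptZ e tau : pt T (base_change g I)) (row l Q) w.
  by rewrite map_row.
Qed.

Section FixR.
Variables (R : kalg k) (I : invertible (idX X) R) (v w : 'I_N -> tsec T I).
Implicit Types (s : 'I_N -> tsec T I) (P Q : 'M[R]_N).

Lemma chain_repY j P Q s (a : 'rV[R]_N) p e tau : chain_rep v w j P Q s ->
  (if j == 0%N then 1 else fY delta i tau) * tY (comb a s) p e tau =
  tY (comb (a *m P) v) p e tau.
Proof.
move=> [_ sY _]; apply: etrans _ (esym (val_comb_mulmx (ptY e tau) a P v)).
rewrite -[tY (comb a s) p e tau]/(ptval (ptY e tau) (comb a s)) val_comb mulr_sumr.
by apply: eq_bigr => l _; rewrite mulrCA -[ptval _ (comb _ v)]/(tY _ p e tau) -sY.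
Qed.

Lemma chain_repZ j P Q s (a : 'rV[R]_N) p e tau : chain_rep v w j P Q s ->
  (if j == c then 1 else fZ delta i tau) * tZ (comb a s) p e tau =
  tZ (comb (a *m Q) w) p e tau.
Proof.
move=> [_ _ sZ]; apply: etrans _ (esym (val_comb_mulmx (ptZ e tau) a Q w)).
rewrite -[tZ (comb a s) p e tau]/(ptval (ptZ e tau) (comb a s)) val_comb mulr_sumr.
by apply: eq_bigr => l _; rewrite mulrCA -[ptval _ (comb _ w)]/(tZ _ p e tau) -sZ.
Qed.

(** The identities of [link] concern parts multiplied by the equations of P. These are cancelled at
    inner indices; at an end of the chain one side carries no factor, and the remaining one is the
    factor of the map. *)
Lemma chain_rep_coords j P1 Q1 P2 Q2 s1 s2 (A B S U : 'M[R]_N) : (j < c)%N ->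
  chain_rep v w j P1 Q1 s1 -> chain_rep v w j.+1 P2 Q2 s2 ->
  link P1 Q1 P2 Q2 A B S U -> coords D (i * c%:Z + j%:Z) 1 0 s1 s2 A B.
Proof.
move=> jc r1 r2 [[AP AQ BQ BP] [AB BA _ _]].
have [s1P s1Y s1Z] := r1; have [s2P s2Y s2Z] := r2.
have jn : j == c = false by rewrite ltn_eqF.
have secY a : is_section (lexp delta (i + 1)) (tY (comb a s2)).
  rewrite -(lexp_interior delta_gt0 c_gt0 i (j := j.+1)) //.
  by apply: tsecY; apply: lincombt_is_tsec.
have secZ a : is_section (mexp delta i) (tZ (comb a s1)).
  rewrite -(mexp_interior delta_gt0 c_gt0 i jc).
  by apply: tsecZ; apply: lincombt_is_tsec.
have one (t : tsec T I) : eqt t (scalet (1 ^+ 0) t).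
  by apply/eqtP => x; rewrite val_scalet expr0 rmorph1 mul1r.
split=> // l.
  apply: (phi_up_eqt (one (s1 l)) (eqt_refl _)); split.
    apply: (fY_inj (i := i) (delta := delta) (secY _)) => p e tau.
    apply: etrans (chain_repY _ e tau r2) _.
    by rewrite -row_mul AP row0; apply: (val_comb0 (ptY e tau) v).
  move=> p e tau; rewrite -/(fZ D (i * c%:Z + j%:Z) tau) fZ_D //.
  have E q f tau' : (if j.+1 == c then 1 else fZ delta i tau') * tZ (comb (row l A) s2) q f tau' =
      fZ delta i tau' * tZ (s1 l) q f tau'.
    by rewrite (chain_repZ _ f tau' r2) -row_mul AQ -s1Z jn.
  case: eqP E => [_|/eqP jc'] E; first by rewrite -E mul1r.
  have secZ1 : is_section (mexp delta i) (tZ (comb (row l A) s2)).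
    have jc1 : (j.+1 < c)%N by rewrite ltn_neqAle jc' jc.
    rewrite -(mexp_interior delta_gt0 c_gt0 i jc1).
    by apply: tsecZ; apply: lincombt_is_tsec.
  have secZ2 : is_section (mexp delta i) (tZ (s1 l)).
    by rewrite -(mexp_interior delta_gt0 c_gt0 i jc); apply: tsecZ.
  rewrite mul1r; apply/eqP; rewrite -subr_eq0; apply/eqP.
  apply: (fZ_inj (i := i) (delta := delta) (sub_section secZ1 secZ2)) => q f tau'.
  by rewrite /subsec mulrBr E subrr.
apply: (phi_down_eqt (one (s2 l)) (eqt_refl _)); split; last first.
  apply: (fZ_inj (i := i) (delta := delta) (secZ _)) => p e tau.
  have := chain_repZ (row l B) e tau r1; rewrite jn -row_mul BQ row0 => ->.
  exact: (val_comb0 (ptZ e tau) w).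
move=> p e tau; rewrite -/(fY D (i * c%:Z + j%:Z) tau) fY_D //.
have E q f tau' : (if j == 0%N then 1 else fY delta i tau') * tY (comb (row l B) s1) q f tau' =
    fY delta i tau' * tY (s2 l) q f tau'.
  by rewrite (chain_repY _ f tau' r1) -row_mul BP -s2Y.
case: eqP E => [_|/eqP j0] E; first by rewrite -E mul1r.
rewrite -lt0n in j0.
have secY1 : is_section (lexp delta (i + 1)) (tY (comb (row l B) s1)).
  have jc0 : (0 < j <= c)%N by rewrite j0 ltnW.
  rewrite -(lexp_interior delta_gt0 c_gt0 i jc0).
  by apply: tsecY; apply: lincombt_is_tsec.
have secY2 : is_section (lexp delta (i + 1)) (tY (s2 l)).
  by rewrite -(lexp_interior delta_gt0 c_gt0 i (j := j.+1)) //; apply: tsecY.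
rewrite mul1r; apply/eqP; rewrite -subr_eq0; apply/eqP.
apply: (fY_inj (i := i) (delta := delta) (sub_section secY1 secY2)) => q f tau'.
by rewrite /subsec mulrBr E subrr.
Qed.

Variables (V W : tsec T I -> Prop) (A B : 'M[R]_N) (M : nat).
Hypotheses (VW : adjacent delta i V W) (Vv : loc_basis V 1 v) (Ww : loc_basis W 1 w).
Hypothesis co : coords delta i 1 M v w A B.

Let v_tsec l : is_tsec delta i (v l).
Proof. by have [[Vt _] _ _ _] := VW; have [Vv' _ _] := Vv; apply: Vt. Qed.

Let w_tsec l : is_tsec delta (i + 1) (w l).
Proof. by have [[_ Wt] _ _ _] := VW; have [Ww' _ _] := Ww; apply: Wt. Qed.

Lemma comb_tZ0 (a : 'rV[R]_N) : a *m A = 0 -> eqsec (tZ (comb a v)) (zerosec _ _).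
Proof.
move=> aA; apply: (fZ_inj (i := i) (delta := delta)) => [|p e tau].
  by apply: tsecZ; apply: lincombt_is_tsec.
have [_ h] := coords1_up a co; rewrite -[fZ _ _ _ * _](h p e tau) aA.
exact: (val_comb0 (ptZ e tau) w).
Qed.

Lemma comb_tY0 (a : 'rV[R]_N) : a *m B = 0 -> eqsec (tY (comb a w)) (zerosec _ _).
Proof.
move=> aB; apply: (fY_inj (i := i) (delta := delta)) => [|p e tau].
  by apply: tsecY; apply: lincombt_is_tsec.
have [h _] := coords1_down a co; rewrite -[fY _ _ _ * _](h p e tau) aB.
exact: (val_comb0 (ptY e tau) v).
Qed.

(** P A = 0 makes the combinations of [v] vanish on Z, so that their Y-parts are divisible as in
    [tsec_divY]; Q B = 0 does the same for the Z-parts of the combinations of [w]. *)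
Lemma chain_rep_exists j P Q : (0 < j < c)%N -> P *m A = 0 -> Q *m B = 0 ->
  exists s, chain_rep v w j P Q s.
Proof.
move=> jc PA QB.
have H l : exists s : tsec T I, [/\ is_tsec D (i * c%:Z + j%:Z) s,
    forall p e tau, fY delta i tau * tY s p e tau = tY (comb (row l P) v) p e tau &
    forall p e tau, fZ delta i tau * tZ s p e tau = tZ (comb (row l Q) w) p e tau].
  have [||a [aP aE]] := @tsec_divY _ _ _ _ _ _ _ delta_gt0 i (comb (row l P) v).
  - exact: lincombt_is_tsec.
  - by apply: comb_tZ0; rewrite -row_mul PA row0.
  have [||b [bP bE]] := @tsec_divZ _ _ _ _ _ _ _ delta_gt0 i (comb (row l Q) w).
  - exact: lincombt_is_tsec.
  - by apply: comb_tY0; rewrite -row_mul QB row0.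
  exists (TSec (zerosec I _) a b); split=> [|p e tau|p e tau].
  - by apply/(is_tsec_interior delta_gt0 c_gt0).
  - by rewrite -aE.
  - by rewrite -bE.
have [s Hs] := choice H; exists s; have /andP[j0 jc'] := jc.
split=> l; rewrite ?(gtn_eqF j0) ?(ltn_eqF jc'); have [] := Hs l => //.
Qed.

(** A relation forces a P = 0 and a Q = 0, first on one component by the representation and on the
    other because P A = 0 and Q B = 0; the block row (P, Q) has a right inverse. *)
Lemma chain_rep_indep j P Q L L' s (a : 'rV[R]_N) : (0 < j < c)%N ->
  P *m A = 0 -> Q *m B = 0 -> P *m L + Q *m L' = 1%:M -> chain_rep v w j P Q s ->
  eqt (comb a s) (zerot T I) -> a = 0.
Proof.
move=> jc PA QB PQ rs [_ aY aZ].
have aP : a *m P = 0.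
  have [m] : exists m, 1 ^+ m *: (a *m P) = 0.
    apply: (loc_basis_indep Vv); apply: (tsec_ext (delta := delta) (m := i)).
    - exact: lincombt_is_tsec.
    - exact: zerot_is_tsec.
    - by move=> p e tau; rewrite -(chain_repY a e tau rs) aY /= /zerosec mulr0.
    - by apply: comb_tZ0; rewrite -mulmxA PA mulmx0.
  by rewrite expr1n scale1r.
have aQ : a *m Q = 0.
  have [m] : exists m, 1 ^+ m *: (a *m Q) = 0.
    apply: (loc_basis_indep Ww); apply: (tsec_ext (delta := delta) (m := i + 1)).
    - exact: lincombt_is_tsec.
    - exact: zerot_is_tsec.
    - by apply: comb_tY0; rewrite -mulmxA QB mulmx0.
    - by move=> p e tau; rewrite -(chain_repZ a e tau rs) aZ /= /zerosec mulr0.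
  by rewrite expr1n scale1r.
by rewrite -[a]mulmx1 -PQ mulmxDr !mulmxA aP aQ !mul0mx addr0.
Qed.

Lemma chain_rep_first : chain_rep v w 0 1%:M A v.
Proof.
split=> l.
- by rewrite addr0; apply/(is_tsec_c delta_gt0 c_gt0).
- by move=> p e tau; rewrite mul1r row1; apply: esym (val_comb_delta (ptY e tau) l v).
- move=> p e tau; rewrite (ltn_eqF c_gt0) rowE.
  have [_ h] := coords1_up (delta_mx 0 l) co; rewrite h -/(fZ delta i tau).
  by congr (_ * _); apply: esym (val_comb_delta (ptZ e tau) l v).
Qed.

Lemma chain_rep_last : chain_rep v w c B 1%:M w.
Proof.
split=> l.
- have -> : i * c%:Z + c%:Z = (i + 1) * c%:Z by rewrite mulrDl mul1r.
  exact/(is_tsec_c delta_gt0 c_gt0).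
- move=> p e tau; rewrite (gtn_eqF c_gt0) rowE.
  have [h _] := coords1_down (delta_mx 0 l) co; rewrite h -/(fY delta i tau).
  by congr (_ * _); apply: esym (val_comb_delta (ptY e tau) l w).
- by move=> p e tau; rewrite eqxx mul1r row1; apply: esym (val_comb_delta (ptZ e tau) l w).
Qed.

End FixR.

Lemma chain_rep_basis R (I : invertible (idX X) R) (v w : 'I_N -> tsec T I) V W A B M j P Q L L' s :
  adjacent delta i V W -> loc_basis V 1 v -> loc_basis W 1 w -> coords delta i 1 M v w A B ->
  (0 < j < c)%N -> P *m A = 0 -> Q *m B = 0 -> P *m L + Q *m L' = 1%:M ->
  chain_rep v w j P Q s -> loc_basis (spans s) 1 s.
Proof.
move=> VW Vv Ww co jc PA QB PQ rs; apply: spans_loc_basis => R' g a.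
have Vv' := loc_basis_base g Vv; have Ww' := loc_basis_base g Ww.
have co' := coords_base g co; rewrite rmorph1 in Vv' Ww' co'.
have PA' : map_mx g P *m map_mx g A = 0 by rewrite -map_mxM PA map_mx0.
have QB' : map_mx g Q *m map_mx g B = 0 by rewrite -map_mxM QB map_mx0.
have PQ' : map_mx g P *m map_mx g L + map_mx g Q *m map_mx g L' = 1%:M.
  by rewrite -!map_mxM -map_mxD PQ map_mx1.
exact: (chain_rep_indep (adjacent_base g VW) Vv' Ww' co' jc PA' QB' PQ' (chain_rep_base g rs)).
Qed.

End Chain.

Lemma is_tensor_scale_iso (A B : comNzRingType) (f : {rmorphism A -> B}) (N Q : lmodType B)
    (u : N -> Q) (u' : Q -> N) : linear u -> linear u' -> cancel u u' -> cancel u' u ->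
  @is_tensor A B f A^o N Q (fun a x => f a *: u x).
Proof.
move=> ulin u'lin uK u'K; have [[t1 t2] t3] := is_tensor_scale f N.
split.
  split=> [a m m' x|a m x x']; first by rewrite rmorphD rmorphM scalerDl scalerA.
  by rewrite ulin scalerDr !scalerA mulrC.
move=> Q' b' bb; have [l [llin lb lu]] := t3 Q' b' bb.
exists (l \o u'); split.
- by move=> a x y; rewrite /= u'lin llin.
- move=> m x /=; rewrite -lb; congr l.
  have -> : f m *: u x = u (f m *: x).
    have u0 : u 0 = 0 by have := ulin (-1) 0 0; rewrite scaler0 addr0 scaleN1r addNr.
    by have := ulin (f m) x 0; rewrite u0 !addr0.
  by rewrite uK.
- move=> l' l'lin l'b x /=; rewrite -[x in LHS]u'K; apply: (lu (l' \o u)) => [a y z|m y] /=.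
    by rewrite ulin l'lin.
  rewrite -l'b; congr l'.
  have u0 : u 0 = 0 by have := ulin (-1) 0 0; rewrite scaler0 addr0 scaleN1r addNr.
  by have := ulin (f m) y 0; rewrite u0 !addr0.
Qed.

(** * Base change along the identity *)

Section BaseId.
Variables (k : closedFieldType) (n : nat).

Section FixJ.
Variables (J : {mpoly k[n.+1]} -> Prop) (R : kalg k) (g : khom R R).
Hypothesis gid : g =1 id.

Lemma cbase_id_str (p : chart J R) a : idfun (cstr (cbase g p) a) = cstr p a.
Proof. by rewrite /= gid. Qed.

Definition cbase_id (p : chart J R) : chom (cbase g p) p :=
  @CHom _ _ J R (cbase g p) p (@KHom _ (cring p) (cring p) idfun (fun=> erefl))
    (cbase_id_str p) (idchom_vec p).

Lemma cbase_id_inv_str (p : chart J R) a : idfun (cstr p a) = cstr (cbase g p) a.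
Proof. by rewrite /= gid. Qed.

Definition cbase_id_inv (p : chart J R) : chom p (cbase g p) :=
  @CHom _ _ J R p (cbase g p) (@KHom _ (cring p) (cring p) idfun (fun=> erefl))
    (cbase_id_inv_str p) (idchom_vec p).

Variables (I : invertible J R) (T : invertible J (kself k)).

Lemma base_id_tensor p :
  @is_tensor _ _ (cstr p) R^o (base_change g I p) (I p)
    (fun a s => cstr p a *: res (cbase_id p) s).
Proof.
apply: (@is_tensor_scale_iso _ _ (cstr p) (base_change g I p) (I p)
  (@res _ _ _ _ I _ _ (cbase_id p)) (@res _ _ _ _ I _ _ (cbase_id_inv p))).
- by move=> a x y; apply: resZD.
- by move=> a x y; exact: (@resZD _ _ _ _ I _ _ (cbase_id_inv p) a x y).
- move=> s; have E : idchom (cbase g p) =1 cbase_id_inv p \o cbase_id p by [].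
  by have := res_comp (i := I) E s; rewrite (@res_id _ _ _ _ I) // => /esym.
- move=> s; have E : idchom p =1 cbase_id p \o cbase_id_inv p by [].
  by have := res_comp (i := I) E s; rewrite (@res_id _ _ _ _ I) // => /esym.
Qed.

Lemma base_id_natural p q (h : chom p q) (a : R^o) (s : base_change g I p) :
  cstr q a *: res (cbase_id q) (res h s) = res h (cstr p a *: res (cbase_id p) s).
Proof.
rewrite resZ cmap_str; congr (_ *: _).
pose h' := chcomp (cbase_id p) h.
have E1 : h' =1 h \o cbase_id p by [].
have E2 : h' =1 cbase_id q \o cbase_hom g h by [].
by have := res_comp (i := I) E1 s; rewrite (res_comp (i := I) E2 s).
Qed.

Lemma base_id_twisted m (s : presec I (const_sheaf R T)) : is_section m s ->
  forall p (e' : frame (I (cbase g p))) e (tau : frame (const_sheaf R T p)),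
    s p e tau = coord e (res (cbase_id p) e') * s (cbase g p) e' tau.
Proof.
move=> sP p e' e tau.
have tau1 : res (i := T) (cconst_hom (cbase_id p)) tau = tau by apply: res_id.
have := sP (cbase g p) p (cbase_id p) e' tau e tau 1.
rewrite /= tau1 coord_gen mulr1 upow1 mulr1 mulrC => H; exact: H.
Qed.

End FixJ.
End BaseId.

Section IsoBaseId.
Variables (k : closedFieldType) (n : nat) (X : two_component_curve k n) (T : twister X).
Variables (R : kalg k) (g : khom R R).
Hypothesis gid : g =1 id.

Section FixI.
Variable I : invertible (idX X) R.
Let b (p : chart (idX X) R) (a : R^o) (s : base_change g I p) : I p :=
  cstr p a *: res (i := I) (cbase_id gid p) s.

Lemma base_id_twistedt delta m (x : tsec T I) : is_tsec delta m x ->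
  twistedt b 1 (tsec_base g x) x.
Proof.
move=> [xY xZ xX]; split=> p e' e tau; rewrite /b rmorph1 scale1r.
- case: ifP xX => _; last by move=> xX; rewrite /= /presec_base !xX /zerosec mulr0.
  by move=> [xX _ _]; apply: (base_id_twisted gid xX).
- move/restr_const_section: xY => xY; rewrite [LHS](base_id_twisted gid xY e' e tau).
  congr (coord _ _ * _); exact: (@res_eq _ _ _ _ I _ _
    (incl_hom _ (cbase_id gid p)) (cbase_id gid (incl _ p)) e' (fun=> erefl)).
- move/restr_const_section: xZ => xZ; rewrite [LHS](base_id_twisted gid xZ e' e tau).
  congr (coord _ _ * _); exact: (@res_eq _ _ _ _ I _ _
    (incl_hom _ (cbase_id gid p)) (cbase_id gid (incl _ p)) e' (fun=> erefl)).
Qed.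

Lemma base_id_scale (a : R^o) (x s : tsec T I) s' : twistedt b 1 (tsec_base g x) x ->
  eqt s' (tsec_base g x) -> twistedt b a s' s -> eqt s (scalet a x).
Proof.
move=> [xX xY xZ] [eX eY eZ] [sX sY sZ].
have push p (e : frame (I p)) : frame (I (cbase g p)) by exact: fpush (cbase_id_inv gid p) e.
split=> p e tau; rewrite /= /lincomb big_ord1.
- rewrite (sX p (push p e)) eX (xX p (push p e)) /b rmorph1 scale1r coordZ.
  by rewrite -mulrA.
- rewrite (sY p (push (incl (@idXY k n X) p) e)) eY
    (xY p (push (incl (@idXY k n X) p) e)) /b rmorph1 scale1r coordZ.
  by rewrite -mulrA.
- rewrite (sZ p (push (incl (@idXZ k n X) p) e)) eZ
    (xZ p (push (incl (@idXZ k n X) p) e)) /b rmorph1 scale1r coordZ.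
  by rewrite -mulrA.
Qed.

End FixI.

(** [fsurj] compares with a base change of the given point. The lift exists over the same field, so
    the base change is along the identity, which yields an isomorphic but not an identical
    family. *)
Lemma lls_iso_base_id delta (y : lls_data T R) :
  (forall i s, llsV y i s -> is_tsec delta i s) -> (forall i, submodule (llsV y i)) ->
  lls_iso delta y (lls_base g y).
Proof.
move=> Vt smV; exists R^o, (fun p a s => cstr p a *: res (i := llsI y) (cbase_id gid p) s); split.
- exists R^o, (fun a x => idfun a *: x); exact: is_tensor_scale.
- exact: base_id_tensor.
- exact: base_id_natural.
move=> i t; split=> [Vi|[N [a [s' [s [H /eqtP tE]]]]]].
  exists 1%N, (fun=> 1), (fun=> tsec_base g t), (fun=> t); split.
    move=> _; split; [|exact: Vt|exact: base_id_twistedt (Vt _ _ Vi)].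
    exists 1%N, (fun=> 1), (fun=> t); split=> //.
    by apply/eqtP => x0; rewrite val_lincombt big_ord1 rmorph1 mul1r.
  by apply/eqtP => x0; rewrite val_lincombt big_ord1 rmorph1 mul1r.
apply: (smV i N (fun=> 1) s); last by apply/eqtP.
move=> j; have [[m [c [w [Vw s'E]]]] _ tw] := H j.
have Vx : llsV y i (lincombt c w) by apply: smV (eqt_refl _).
apply: (submod_eqt (smV i) _ (submod_scale (smV i) (a j) Vx)).
apply: eqt_sym; apply: base_id_scale (base_id_twistedt (Vt _ _ Vx)) _ tw.
apply: eqt_trans s'E _; apply/eqtP => x0; rewrite val_lincombt.
move/eqtP: (base_lincombt g c w) => ->; rewrite val_lincombt.
by apply: eq_bigr => l _; rewrite gid.
Qed.

End IsoBaseId.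

(** * Exact lifts over a field *)

Section Surjective.
Variables (k : closedFieldType) (n : nat) (X : two_component_curve k n) (T : twister X).
Variables (d r : int) (delta c : nat).
Hypotheses (delta_gt0 : (0 < delta)%N) (c_gt1 : (1 < c)%N).
Local Notation D := (c * delta)%N.
Variables (K : fieldType) (i : {rmorphism k -> K}).
Local Notation R := (KAlg i).
Let c_gt0 : (0 < c)%N. Proof. exact: ltnW. Qed.

Lemma field_basis (I : invertible (idX X) R) (V : tsec T I -> Prop) delta' m N :
  submodule V -> (forall s, V s -> is_tsec delta' m s) -> locally_free_subsheaf r V ->
  N%:Z = r + 1 -> exists v : 'I_N -> tsec T I, loc_basis V 1 v.
Proof.
move=> smV Vt /(locally_free_cover smV Vt) [N' [Nr' [M [f [[w w1] H]]]]] Nr.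
have eN : N' = N by apply/eqP; rewrite -eqz_nat Nr Nr'.
rewrite {}eN {Nr'} in H.
have [l fl] : exists l, f l != 0.
  apply: contrapT => /forallNP f0.
  move: w1; rewrite big1 => [/eqP|l _]; first by rewrite eq_sym oner_eq0.
  by have /negP/negPn/eqP -> := f0 l; rewrite mulr0.
have [v Vv] := H l; have [Vv' _ indep] := Vv.
have uf : (f l)^-1 * f l = 1 by apply: mulVf.
exists v; split=> // [t Vt'|R' g a _].
  have [|a ta] := loc_basis_unit Vv _ Vt'; first by exists (f l)^-1.
  by exists 0%N, a; apply/eqtP => x; rewrite val_scalet expr0 rmorph1 mul1r; move/eqtP: ta.
by apply: indep; exists (g (f l)^-1); rewrite -rmorphM uf rmorph1.
Qed.

(** The first and last bases are the given [v] and [w] themselves, so that blocks for consecutive m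
    fit together. *)
Lemma block_exists N (I : invertible (idX X) R) (V W : tsec T I -> Prop) (m : int)
    (v w : 'I_N -> tsec T I) : adjacent delta m V W -> loc_basis V 1 v -> loc_basis W 1 w ->
  exists s : nat -> 'I_N -> tsec T I, [/\ s 0 = v, s c = w,
    forall j, (j <= c)%N -> forall l, is_tsec D (m * c%:Z + j%:Z) (s j l) &
    forall j, (j < c)%N -> exists A B S U,
      splitting D (m * c%:Z + j%:Z) (spans (s j)) (spans (s j.+1)) 1 (s j) (s j.+1) A B S U 0 0].
Proof.
move=> VW Vv Ww; have [M [A [B co]]] := coords_exist VW Vv Ww.
have [_ _ AB BA] := co.
have [P [Q [X1 [Y1 [S [U [L [L' [[P0 Q0 Pc Qc] Hin Hlink]]]]]]]]] := exact_chain AB BA c_gt1.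
have H j : exists s, (0 < j < c)%N -> chain_rep delta c m v w j (P j) (Q j) s.
  case: (boolP (0 < j < c)%N) => [jc|_]; last by exists v.
  have [PA QB _] := Hin j jc.
  by have [s Hs] := chain_rep_exists delta_gt0 c_gt0 VW Vv Ww co jc PA QB; exists s.
have [s Hs] := choice H.
pose s' j := if j == 0%N then v else if j == c then w else s j.
have Hs' j : (j <= c)%N -> chain_rep delta c m v w j (P j) (Q j) (s' j).
  rewrite /s'; case: (posnP j) => [->|j0] jc.
    by rewrite P0 Q0; exact: (chain_rep_first delta_gt0 c_gt0 VW Vv co).
  case: eqP => [->|/eqP jc']; first by rewrite Pc Qc; exact: (chain_rep_last delta_gt0 c_gt0 VW Ww co).
  by apply: Hs; rewrite j0 ltn_neqAle jc'.
have [[_ _] [smV smW] _ _] := VW.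
have basis j : (j <= c)%N -> loc_basis (spans (s' j)) 1 (s' j).
  move=> jc; case: (boolP (0 < j < c)%N) => [j0c|].
    have [PA QB PQ] := Hin j j0c.
    exact: (chain_rep_basis VW Vv Ww co j0c PA QB PQ (Hs' j jc)).
  rewrite /s'; case: (posnP j) => [->|j0] /=; first by rewrite (spans_basis smV Vv).
  by rewrite -leqNgt => cj; rewrite eqn_leq jc cj (spans_basis smW Ww).
exists s'; split.
- by [].
- by rewrite /s' eqxx (gtn_eqF c_gt0).
- by move=> j jc; have [] := Hs' j jc.
move=> j jc; exists (X1 j), (Y1 j), (S j), (U j); have [[_ _ _ _] [_ _ h1 h2]] := Hlink j jc.
split; [exact/basis/ltnW|exact: basis| |by rewrite expr0|by rewrite expr0].
exact: (chain_rep_coords delta_gt0 c_gt0 jc (Hs' j (ltnW jc)) (Hs' j.+1 jc) (Hlink j jc)).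
Qed.

Lemma exact_lift (y : lls_data T R) : is_lls d r delta y ->
  exists x : lls_data T R, [/\ is_lls d r D x, exact_fibres D x & rho c x = y].
Proof.
move=> ly; have adj := lls_adjacent ly; have [dY dZ H] := ly.
have [_ _ [N Nr _] _ _] := H 0.
have Hv m : exists v : 'I_N -> tsec T (llsI y), loc_basis (llsV y m) 1 v.
  by have [Vt smV lf _ _] := H m; apply: (field_basis smV Vt lf Nr).
have [v Vv] := choice Hv.
have [s Hs] := choice (fun m => block_exists (adj m) (Vv m) (Vv (m + 1))).
have spv m : spans (v m) = llsV y m by have [_ smV _ _ _] := H m; apply: spans_basis.
pose Vx (m : int) := spans (s (m %/ c)%Z `|(m %% c)%Z|%N).
pose x := @LLSData k n X T R (llsI y) Vx.
have Vc m : Vx (m * c%:Z) = llsV y m.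
  rewrite /Vx modzMl mulzK ?eqz_nat -?lt0n //.
  by have [-> _ _ _] := Hs m.
(* The bound includes j = c: the end of one block is the beginning of the next, so a pair of
   consecutive terms always lies within a single block. *)
have Vin m (j : nat) : (j <= c)%N -> Vx (m * c%:Z + j%:Z) = spans (s m j).
  rewrite leq_eqVlt => /orP[/eqP ->|jc].
    rewrite -{2}[c%:Z]mul1r -mulrDl Vc.
    by have [_ -> _ _] := Hs m.
  rewrite /Vx modzMDl modz_small //= divzMDl ?eqz_nat -?lt0n // divz_small ?addr0 //=.
have split_at m : exists (u w : 'I_N -> tsec T (llsI y)) A B S U, [/\
    forall l, is_tsec D m (u l), forall l, is_tsec D (m + 1) (w l),
    Vx m = spans u, Vx (m + 1) = spans w &
    splitting D m (spans u) (spans w) 1 u w A B S U 0 0].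
  have [l [j [jc ->]]] := int_split c_gt0 m.
  have [_ _ sP /(_ j jc) [A [B [S [U sp]]]]] := Hs l.
  have jS : l * c%:Z + j%:Z + 1 = l * c%:Z + j.+1%:Z by rewrite -addrA -PoszD addn1.
  exists (s l j), (s l j.+1), A, B, S, U; rewrite jS; split=> //.
  - exact/sP/ltnW.
  - exact: sP.
  - exact/Vin/ltnW.
  - exact: Vin.
have adjx m : adjacent D m (Vx m) (Vx (m + 1)).
  have [u [w [A [B [S [U [uP wP -> -> [_ _ co _ _]]]]]]]] := split_at m.
  exact: spans_adjacent co.
exists x; split.
- split=> // m; have [[Vt _] [smV _] up down] := adjx m; split=> //.
  have [u [w [A [B [S [U [uP _ E _ [Vu _ _ _ _]]]]]]]] := split_at m.
  apply: (@cover_locally_free _ _ _ _ _ _ _ _ N 1 (fun=> 1) Nr).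
    by exists (fun=> 1); rewrite big_ord1 mulr1.
  by move=> _; exists u; rewrite /= E.
- move=> K' i' g; apply: exact_lls_of_pairs => m.
  have [u [w [A [B [S [U [uP wP E E' sp]]]]]]] := split_at m.
  have sp' := splitting_base g sp; rewrite rmorph1 -E -E' in sp'.
  exact: (splitting_exact (adjacent_base g (adjx m)) sp').
- have -> : rho c x = @LLSData k n X T R (llsI y) (llsV y).
    by congr LLSData; apply: funext => m; apply: Vc.
  by have eta (z : lls_data T R) : LLSData (llsV z) = z by case: z.
Qed.

End Surjective.

Lemma rho_surjective (k : closedFieldType) (n : nat) (X : two_component_curve k n)
    (T : twister X) (d r : int) (delta c : nat) : (0 < delta)%N -> (1 < c)%N ->
  fsurj (Gstar T d r (c * delta)) (Gmod T d r delta) (rho c).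
Proof.
move=> delta_gt0 c_gt1 K i y ly.
have [x [lx ex xy]] := exact_lift delta_gt0 c_gt1 ly.
pose g : khom (KAlg i) (KAlg i) := @KHom k (KAlg i) (KAlg i) idfun (fun=> erefl).
exists K, i, g, x; split; first by split.
rewrite xy; have [_ _ H] := ly.
apply: (lls_iso_base_id (g := g)) => // m; by have [] := H m.
Qed.

Lemma rho_iso (k : closedFieldType) (n : nat) (X : two_component_curve k n)
    (T : twister X) (d r : int) (delta c : nat) : (0 < delta)%N -> (0 < c)%N ->
  fiso (fsub (F := Gmod T d r (c * delta)) (fun R x => exact_fibres delta (rho c x)))
    (Gstar T d r delta) (rho c).
Proof.
move=> delta_gt0 c_gt0; have [m1 m2 m3] := rho_morphism T delta_gt0 c_gt0 d r.
split.
- split=> [R x [lx ex]|R x x' [lx _] [lx' _]|R R' g x [lx _]].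
  + by split=> //; apply: m1.
  + exact: m2.
  + exact: m3.
- by move=> R x x' [lx ex] [lx' ex']; apply: (rho_injective delta_gt0 c_gt0 lx lx').
- move=> R y [ly ey]; exists (refine_lls delta c y); rewrite ?rho_refine //.
    by split; [apply: refine_is_lls|rewrite rho_refine].
  by have [_ _ H] := ly; apply: lls_iso_refl => m; have [] := H m.
Qed.

Close Scope ring_scope.

(* The first conjunct (rho is a morphism from G^r_{d,delta'}(X) to
   G^r_{d,delta}(X)) gives one inclusion in the last equality of sets. *)
Theorem proposition4p3 (k : closedFieldType) (n : nat)
    (X : two_component_curve k n) (T : twister X) (d r : int) (delta delta' : nat)
    (delta_gt0 : 0 < delta) (delta'_gt0 : 0 < delta')
    (dvd_delta : delta %| delta') :
  [/\ fmorphism (Gmod T d r delta') (Gmod T d r delta)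
        (rho (delta' %/ delta)),
      forall R (x : lls_data T R),
        fmem (rho_inv_Gstar T d r delta delta') x ->
        fmem (Gstar T d r delta') x,
      fiso (rho_inv_Gstar T d r delta delta') (Gstar T d r delta)
        (rho (delta' %/ delta)) &
      delta < delta' ->
        fsurj (Gstar T d r delta') (Gmod T d r delta)
          (rho (delta' %/ delta))].
Proof.
have /dvdnP [c dE] := dvd_delta; subst delta'; rewrite /rho_inv_Gstar mulnK //.
have c_gt0 : (0 < c)%N by move: delta'_gt0; rewrite muln_gt0 => /andP[].
split.
- exact: rho_morphism.
- by move=> R x [lx ex]; split=> //; apply: (rho_inv_exact delta_gt0 c_gt0 lx ex).
- exact: rho_iso.
- by rewrite -{1}[delta]mul1n ltn_pmul2r //; apply: rho_surjective.
Qed.
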